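(* For any real $a>0$, consider the following element $\gamma_0$ of $(\Lambda SL_2\mathbb{C})_\sigma$: $$\gamma_0(\lambda)=\begin{pmatrix} 1/\sqrt a & -\lambda/\sqrt a\\ 0&\sqrt a\end{pmatrix}=\begin{pmatrix}1&0\\0&\lambda\end{pmatrix}^{-1}\begin{pmatrix} 1/\sqrt a & -1/\sqrt a\\ 0&\sqrt a\end{pmatrix}\begin{pmatrix}1&0\\0&\lambda\end{pmatrix}.$$ Let $L$ be the $(\Lambda SL_2\mathbb{C})_\sigma$-valued map defined in the context, and let $w=\begin{pmatrix}0&\lambda\\-1/\lambda&0\end{pmatrix}$. Then: (a) $\gamma_0^{-1}L$ admits an Iwasawa factorization $$\gamma_0^{-1}L=F\,w\,B$$ on some domain $U=V\cap(\mathbb{C}-(-\infty,0])$, where $V$ is a neighbourhood of $z=0$ in $\mathbb{C}$. (b) $B$ is homogeneous, i.e. $B(\epsilon^2z,\epsilon\lambda)=T(\epsilon)^{-1}B(z,\lambda)T(\epsilon)$ for all $\epsilon\in S^1$ (whenever $z,\epsilon^2z\in U$), where $T(\epsilon)=\mathrm{diag}(1,\epsilon)$. (This implies that the $1$-form $\alpha=(Fw)^{-1}d(Fw)$ is homogeneous, i.e. substituting $\epsilon^2z$ for $z$ (pulling back under $z\mapsto\epsilon^2z$) and $\epsilon\lambda$ for $\lambda$ transforms $\alpha$ into $T(\epsilon)^{-1}\alpha\,T(\epsilon)$.) (c) $B=\mathrm{diag}(k,k^{-1})+O(\lambda)$, where $k$ is equal to $\sqrt{-a-t-\bar t}$, with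 $t=\log z$, times a function which approaches $1$ as $z\to0$.
   Context: Loop groups. $\Lambda SL_2\mathbb{C}$ is the group of smooth maps $S^1\to SL_2\mathbb{C}$, with $\lambda\in S^1$ the loop parameter. Let $D=\mathrm{diag}(1,-1)$. The twisted loop group $(\Lambda SL_2\mathbb{C})_\sigma$ consists of the $\gamma\in\Lambda SL_2\mathbb{C}$ with $\sigma(\gamma)=\gamma$, where $\sigma(\gamma)(\lambda)=D\gamma(-\lambda)D$. Let $C(\gamma)(\lambda)=D\big(\overline{\gamma(1/\bar\lambda)}^{\,t}\big)^{-1}D$ (superscript $t$ on a matrix denotes transpose), and let $(\Lambda SU_{1,1})_\sigma=\{\gamma\in(\Lambda SL_2\mathbb{C})_\sigma : C(\gamma)=\gamma\}$. $(\Lambda_+SL_2\mathbb{C})_\sigma$ is the subgroup of those $\gamma\in(\Lambda SL_2\mathbb{C})_\sigma$ which extend holomorphically to the interior $|\lambda|<1$ of $S^1$. Iwasawa factorization. For $w=I$ or $w=\begin{pmatrix}0&\lambda\\-1/\lambda&0\end{pmatrix}$, an Iwasawa factorization of an $(\Lambda SL_2\mathbb{C})_\sigma$-valued map $X$ on a domain is a factorization $X=FwB$ with (smooth) maps $F$ valued in $(\Lambda SU_{1,1})_\sigma$ and $B$ valued in $(\Lambda_+SL_2\mathbb{C})_\sigma$, where $B$ is normalized to be of the form $B=\mathrm{diag}(k,k^{-1})+O(\lambda)$ with $k=k(z,\bar z)>0$; with this normalization $F$ and $B$ are unique. $F$ and $B$ are functions of $z,\bar z,\lambda$, but the dependence on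 $\bar z$ is suppressed in the notation. The map $L$. Put $t=\log z$ (a single-valued branch on $\mathbb{C}-(-\infty,0]$), $N=\begin{pmatrix}0&0\\1&0\end{pmatrix}$, $\partial=z\,d/dz$, and $$f_0(z)=\sum_{i\ge0}\frac{z^i}{(i!)^2\lambda^{2i}},\qquad f_1(z)=-\frac2\lambda\sum_{i\ge1}\Big(1+\cdots+\frac1i\Big)\frac{z^i}{(i!)^2\lambda^{2i}}.$$ Then $$L=e^{tN/\lambda}L_0=\begin{pmatrix}1&0\\ \tfrac1\lambda\log z&1\end{pmatrix}\begin{pmatrix}f_0&\lambda\partial f_0\\ f_1&f_0+\lambda\partial f_1\end{pmatrix}.$$ $L_0$ is holomorphic in $z\in\mathbb{C}$ with $L_0(0)=I$, and $L$ satisfies $L^{-1}dL=\frac1\lambda\begin{pmatrix}0&1\\1/z&0\end{pmatrix}dz$. *)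

(* Defs.v *)
From HB Require Import structures.
From mathcomp Require Import all_boot all_order all_algebra.
From mathcomp Require Import complex.
From mathcomp Require Import all_classical all_reals all_analysis.

Set Implicit Arguments.
Unset Strict Implicit.
Unset Printing Implicit Defensive.

Import Order.TTheory GRing.Theory Num.Theory.
Import numFieldNormedType.Exports.

Local Open Scope classical_set_scope.
Local Open Scope ring_scope.
Local Open Scope complex_scope.

(* R[i] as a normed space over itself: [derivable f z 1] for f : R[i] -> R[i]
   is complex differentiability, and [derive1] is the complex derivative. *)
#[non_forgetful_inheritance]
HB.instance Definition _ (R : rcfType) := GRing.ComAlgebra.copy R[i] R[i]^o.
#[non_forgetful_inheritance]
HB.instance Definition _ (R : rcfType) := Vector.copy R[i] R[i]^o.
#[non_forgetful_inheritance]
HB.instance Definition _ (R : rcfType) := NormedModule.copy R[i] R[i]^o.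

Definition mx2 (K : Type) (a b c d : K) : 'M[K]_2 :=
  \matrix_(i, j) if i == ord0 then (if j == ord0 then a else b)
                 else (if j == ord0 then c else d).

(* C^k on a set O, which is always open below.  V is always R or R * R * R, so
   asking for derivatives in all directions is the same as asking for all
   partial derivatives. *)
Fixpoint Ck_on (R : realType) (V : normedModType R) (k : nat) (O : set V)
    (f : V -> R) : Prop :=
  (forall x, O x -> {for x, continuous f}) /\
  match k with
  | 0 => True
  | k'.+1 => forall v : V,
      (forall x, O x -> derivable f x v) /\ Ck_on k' O ('D_v f)
  end.

Definition smooth_on (R : realType) (V : normedModType R) (O : set V)
    (f : V -> R) : Prop := forall k, Ck_on k O f.

Definition smooth_mx_on (R : realType) (V : normedModType R) (O : set V)
    (f : V -> 'M[R[i]]_2) : Prop :=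
  forall i j, smooth_on O (fun x => complex.Re (f x i j)) /\
              smooth_on O (fun x => complex.Im (f x i j)).

Section LoopGroups.
Variable R : realType.
Local Notation C := R[i].

Definition cis (theta : R) : C := cos theta +i* sin theta.

Definition cexp (z : C) : C :=
  (expR (complex.Re z))%:C * cis (complex.Im z).

(* A map on S^1 is represented by a total function on C of which only the
   values on the unit circle are used. *)
Definition loop := C -> 'M[C]_2.

Definition smooth_loop (g : loop) : Prop :=
  smooth_mx_on [set: R] (fun theta => g (cis theta)).

Definition LSL2 (g : loop) : Prop :=
  smooth_loop g /\ forall l : C, `|l| = 1 -> \det (g l) = 1.

Definition Dmx : 'M[C]_2 := mx2 1 0 0 (-1).

Definition sigma (g : loop) : loop := fun l => Dmx *m g (- l) *m Dmx.

Definition LSL2s (g : loop) : Prop :=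
  LSL2 g /\ forall l : C, `|l| = 1 -> sigma g l = g l.

Definition Cinv (g : loop) : loop := fun l =>
  Dmx *m invmx (map_mx (@conjc R) (g (conjc l)^-1))^T *m Dmx.

Definition LSU11s (g : loop) : Prop :=
  LSL2s g /\ forall l : C, `|l| = 1 -> Cinv g l = g l.

(* The boundary values of a holomorphic extension are taken continuously. *)
Definition holo_extension (g G : loop) : Prop :=
  (forall l : C, `|l| = 1 -> G l = g l) /\
  forall i j,
    {within [set l : C | `|l| <= 1], continuous (fun l => G l i j)} /\
    (forall l : C, `|l| < 1 -> derivable (fun m : C => G m i j) l 1).

Definition LplusSL2s (g : loop) : Prop :=
  LSL2s g /\ exists G, holo_extension g G.

(* g = diag(k, 1/k) + O(lambda) *)
Definition leading_diag (g : loop) (k : R) : Prop :=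
  exists2 G, holo_extension g G &
    (fun l => G l - mx2 k%:C 0 0 (k^-1)%:C) =O_ (nbhs (0 : C)) (@id C).

(* Smoothness of a map U -> Lambda SL_2 C, i.e. joint smoothness on U x S^1 *)
Definition smooth_family (U : set C) (X : C -> loop) : Prop :=
  smooth_mx_on [set p : R * R * R | U (p.1.1 +i* p.1.2)]
    (fun p : R * R * R => X (p.1.1 +i* p.1.2) (cis p.2)).

Record Iwasawa (U : set C) (w : loop) (X F B : C -> loop) (k : C -> R) : Prop :=
  { Iwasawa_smoothF : smooth_family U F;
    Iwasawa_smoothB : smooth_family U B;
    Iwasawa_F : forall z, U z -> LSU11s (F z);
    Iwasawa_B : forall z, U z -> LplusSL2s (B z);
    Iwasawa_k : forall z, U z -> 0 < k z /\ leading_diag (B z) (k z);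
    Iwasawa_eq : forall z l : C, U z -> `|l| = 1 ->
      X z l = F z l *m w l *m B z l }.

Definition winding : loop := fun l => mx2 0 l (- l^-1) 0.

(* C - (-oo, 0]: in the order of R[i], z <= 0 means Im z = 0 and Re z <= 0. *)
Definition slit_plane : set C := [set z | ~ (z <= 0)].

Definition log_branch (t : C -> C) : Prop :=
  forall z, slit_plane z -> {for z, continuous t} /\ cexp (t z) = z.

Definition f0 (l z : C) : C :=
  \big[+%R/0]_(0 <= i <oo) (z ^+ i / ((i`!%:R) ^+ 2 * l ^+ (2 * i))).

Definition f1 (l z : C) : C :=
  - (2 / l) * \big[+%R/0]_(1 <= i <oo)
    ((\sum_(1 <= j < i.+1) (j%:R)^-1) *
     (z ^+ i / ((i`!%:R) ^+ 2 * l ^+ (2 * i)))).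

(* z d/dz *)
Definition euler (f : C -> C) (z : C) : C := z * derive1 f z.

Definition L0 (z : C) : loop := fun l =>
  mx2 (f0 l z) (l * euler (f0 l) z)
      (f1 l z) (f0 l z + l * euler (f1 l) z).

Definition Lmap (t : C -> C) (z : C) : loop := fun l =>
  mx2 1 0 (l^-1 * t z) 1 *m L0 z l.

Definition gamma0 (a : R) : loop := fun l =>
  mx2 (1 / Num.sqrt a)%:C (- (l / (Num.sqrt a)%:C)) 0 (Num.sqrt a)%:C.

Definition Tmx (e : C) : 'M[C]_2 := mx2 1 0 0 e.

Definition homogeneous_on (U : set C) (B : C -> loop) : Prop :=
  forall e l z : C, `|e| = 1 -> `|l| = 1 -> U z -> U (e ^+ 2 * z) ->
    B (e ^+ 2 * z) (e * l) = invmx (Tmx e) *m B z l *m Tmx e.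

(* Differential of M at z (in the real sense: M may depend on z and its
   conjugate), applied to the tangent vector v. *)
Definition mx_differential (M : C -> 'M[C]_2) (z v : C) : 'M[C]_2 :=
  \matrix_(i, j)
    (derive1 (fun s : R => complex.Re (M (z + s%:C * v) i j)) 0
     +i* derive1 (fun s : R => complex.Im (M (z + s%:C * v) i j)) 0).

(* G^-1 dG, as a matrix-valued 1-form in z with parameter l *)
Definition maurer_cartan (G : C -> loop) (l z v : C) : 'M[C]_2 :=
  invmx (G z l) *m mx_differential (fun x => G x l) z v.

(* The tangent map of z |-> e^2 z is v |-> e^2 v. *)
Definition homogeneous_form_on (U : set C) (alpha : C -> C -> C -> 'M[C]_2) :
    Prop :=
  forall e l z v : C, `|e| = 1 -> `|l| = 1 -> U z -> U (e ^+ 2 * z) ->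
    alpha (e * l) (e ^+ 2 * z) (e ^+ 2 * v) =
    invmx (Tmx e) *m alpha l z v *m Tmx e.

End LoopGroups.

(* Main.v *)
Require Import Defs.
From HB Require Import structures.
From mathcomp Require Import all_boot all_order all_algebra.
From mathcomp Require Import complex.
From mathcomp Require Import all_classical all_reals all_analysis.
From mathcomp Require Import ring lra zify.

Set Implicit Arguments.
Unset Strict Implicit.
Unset Printing Implicit Defensive.

Import Order.TTheory GRing.Theory Num.Theory.
Import numFieldNormedType.Exports.

Local Open Scope classical_set_scope.
Local Open Scope ring_scope.
Local Open Scope complex_scope.

(** * Formal power series *)

Section TriangularSums.
Variable V : nmodType.
Implicit Type F : nat -> nat -> V.

Lemma big_tri F N :
  \sum_(n < N) \sum_(i < n.+1) F i (n - i)%N =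
  \sum_(i < N) \sum_(j < N - i) F i j.
Proof.
elim: N => [|N IH]; first by rewrite !big_ord0.
rewrite big_ord_recr/= IH [RHS]big_ord_recr/= subSnn big_ord1.
rewrite [in LHS]big_ord_recr/= subnn addrA -big_split/=; congr (_ + _).
apply: eq_bigr => i _; rewrite subSn ?big_ord_recr//=; exact: ltnW.
Qed.

Lemma big_tri_exch F N :
  \sum_(l < N.+1) \sum_(j < (N - l).+1) F l j =
  \sum_(j < N.+1) \sum_(l < (N - j).+1) F l j.
Proof.
have E (G : nat -> nat -> V) : \sum_(l < N.+1) \sum_(j < (N - l).+1) G l j =
           \sum_(l < N.+1) \sum_(j < N.+1 | (l + j < N.+1)%N) G l j.
  apply: eq_bigr => l _.
  have h : ((N - l).+1 <= N.+1)%N by rewrite ltnS leq_subr.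
  rewrite (big_ord_widen _ (G l) h); apply: eq_bigl => j.
  by case: l h => l /= hl _; lia.
rewrite !E (E (fun j l => F l j)) (exchange_big_dep predT)//=.
by apply: eq_bigr => i _; apply: eq_bigl => j; rewrite addnC.
Qed.

End TriangularSums.

(** Coefficient sequences, with the Cauchy product. *)
Definition fps (A : Type) : Type := nat -> A.

Section Fps.
Variable A : comNzRingType.
Implicit Types u v w : fps A.

HB.instance Definition _ := GRing.Zmodule.copy (fps A) (nat -> A).

Definition fps1 : fps A := fun n => (n == 0)%:R.
Definition fps_mul u v : fps A := fun n => \sum_(i < n.+1) u i * v (n - i)%N.

Lemma fps_mulA : associative fps_mul.
Proof.
move=> u v w; apply/funext => n; rewrite /fps_mul.
under eq_bigr do rewrite mulr_sumr.
under [RHS]eq_bigr do rewrite mulr_suml.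
have := big_tri (fun i j => u i * (v j * w (n - i - j)%N)) n.+1.
under [X in _ = X]eq_bigr => i _ do rewrite subSn -1?ltnS//.
move=> <-; apply: eq_bigr => m _; apply: eq_bigr => i _.
by rewrite mulrA; congr (_ * w _); case: m i => m /= hm [i /= hi]; lia.
Qed.

Lemma fps_mulC : commutative fps_mul.
Proof.
move=> u v; apply/funext => n; rewrite /fps_mul (reindex_inj rev_ord_inj)/=.
apply: eq_bigr => i _; rewrite mulrC; congr (v _ * u _);
  by case: i => i /= hi; lia.
Qed.

Lemma fps_mul1 : left_id fps1 fps_mul.
Proof.
move=> u; apply/funext => n; rewrite /fps_mul big_ord_recl/= /fps1 eqxx mul1r.
rewrite subn0 big1 ?addr0// => i _; by rewrite mul0r.
Qed.

Lemma fps_mulDl : left_distributive fps_mul +%R.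
Proof.
move=> u v w; apply/funext => n; 
transitivity (\sum_(i < n.+1) (u i * w (n - i)%N + v i * w (n - i)%N)).
  by apply: eq_bigr => i _; exact: mulrDl.
by rewrite big_split.
Qed.

Lemma fps1_neq0 : fps1 != 0.
Proof. by apply/eqP => /(congr1 (@^~ 0%N)); rewrite /fps1 eqxx => /eqP; rewrite oner_eq0. Qed.

HB.instance Definition _ := GRing.Zmodule_isComNzRing.Build (fps A)
  fps_mulA fps_mulC fps_mul1 fps_mulDl fps1_neq0.

Lemma fpsM u v n : (u * v) n = \sum_(i < n.+1) u i * v (n - i)%N.
Proof. by []. Qed.

Lemma fps1E n : (1 : fps A) n = (n == 0%N)%:R. Proof. by []. Qed.

Lemma fpsD u v n : (u + v) n = u n + v n. Proof. by []. Qed.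
Lemma fpsN u n : (- u) n = - u n. Proof. by []. Qed.
Lemma fps0 n : (0 : fps A) n = 0. Proof. by []. Qed.

Lemma fps_sum I (r : seq I) (P : pred I) (F : I -> fps A) n :
  (\sum_(i <- r | P i) F i) n = \sum_(i <- r | P i) F i n.
Proof. by elim/big_rec2 : _ => // i x y _ <-. Qed.

End Fps.

(** * Birkhoff factorization in formal power series *)

Section Bigraded.
Variable R : comNzRingType.

(** Series in two variables: [u i j] is the coefficient of [x ^ i * y ^ j]. *)
Definition ps2 : Type := fps (fps R).

HB.instance Definition _ := GRing.ComNzRing.on ps2.

Implicit Types u v : ps2.

Lemma ps2M u v i j :
  (u * v) i j = \sum_(k < i.+1) \sum_(l < j.+1) u k l * v (i - k)%N (j - l)%N.
Proof. by rewrite fpsM fps_sum. Qed.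

Lemma ps2_1 i j : (1 : ps2) i j = ((i == 0%N) && (j == 0%N))%:R.
Proof. by rewrite fps1E; case: eqP => //= _; rewrite fps1E. Qed.

Lemma ps2P u v : (forall i j, u i j = v i j) -> u = v.
Proof. by move=> e; apply/funext => i; apply/funext => j. Qed.

Lemma ps2_sum I (r : seq I) (P : pred I) (F : I -> ps2) i j :
  (\sum_(n <- r | P n) F n) i j = \sum_(n <- r | P n) F n i j.
Proof. by rewrite !fps_sum. Qed.

Definition star u : ps2 := fun i j => u j i.

Lemma star_is_additive : {morph star : u v / u - v}.
Proof. by []. Qed.

Lemma star_is_multiplicative : monoid_morphism star.
Proof.
split; first by apply: ps2P => i j; rewrite /star !ps2_1 andbC.
by move=> u v; apply: ps2P => i j; rewrite /star !ps2M exchange_big.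
Qed.

HB.instance Definition _ := GRing.isZmodMorphism.Build ps2 ps2 star star_is_additive.
HB.instance Definition _ := GRing.isMonoidMorphism.Build ps2 ps2 star star_is_multiplicative.

Lemma starK : involutive star. Proof. by []. Qed.

(** On the circle, [x = z / l ^ 2] and [y = conj x], and the entry [(r, c)] of a
matrix comes with the factor [l ^ (c - r)]; so the coefficient of
[x ^ i * y ^ j] in it contributes to the power [(2 j + c) - (2 i + r)] of the
loop parameter.  [wplus] and [wminus] bound these powers, and [wct] keeps the
power zero. *)
Definition wplus (r c : nat) u :=
  forall i j, (j.*2 + c < i.*2 + r)%N -> u i j = 0.
Definition wminus (r c : nat) u :=
  forall i j, (i.*2 + r < j.*2 + c)%N -> u i j = 0.
Definition wct (r c : nat) u : ps2 :=
  fun i j => if (i.*2 + r == j.*2 + c)%N then u i j else 0.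

Lemma wplusM r m c u v : wplus r m u -> wplus m c v -> wplus r c (u * v).
Proof.
move=> hu hv i j h; rewrite ps2M big1// => -[k /= hk] _; rewrite big1// => -[l /= hl] _.
have [h1|h1] := ltnP (l.*2 + m) (k.*2 + r); first by rewrite hu ?mul0r.
by rewrite (hv (i - k)%N (j - l)%N) ?mulr0//; lia.
Qed.

Lemma wminusM r m c u v : wminus r m u -> wminus m c v -> wminus r c (u * v).
Proof.
move=> hu hv i j h; rewrite ps2M big1// => -[k /= hk] _; rewrite big1// => -[l /= hl] _.
have [h1|h1] := ltnP (k.*2 + r) (l.*2 + m); first by rewrite hu ?mul0r.
by rewrite (hv (i - k)%N (j - l)%N) ?mulr0//; lia.
Qed.

Lemma wctM r m c u v : wminus r m u -> wminus m c v ->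
  wct r c (u * v) = wct r m u * wct m c v.
Proof.
move=> hu hv; apply: ps2P => i j; rewrite /wct !ps2M.
case: eqP => h; last first.
  symmetry; rewrite big1// => -[k /= hk] _; rewrite big1// => -[l /= hl] _.
  by do 2 case: eqP => ?; rewrite ?mul0r ?mulr0//; exfalso; lia.
apply: eq_bigr => -[k /= hk] _; apply: eq_bigr => -[l /= hl] _.
case: eqP => h1; last first.
  have [h2|h2] := ltnP (k.*2 + r) (l.*2 + m); first by rewrite hu ?mul0r.
  by rewrite (hv (i - k)%N (j - l)%N) ?mulr0 ?mul0r//; lia.
by case: eqP => h2 //; exfalso; lia.
Qed.

Lemma wctP r c u : wplus r c u -> wminus r c u -> wct r c u = u.
Proof.
move=> hp hm; apply: ps2P => i j; rewrite /wct; case: eqP => // h.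
by have [h1|h1] := ltnP (i.*2 + r) (j.*2 + c); [rewrite hm|rewrite hp//; lia].
Qed.

Lemma wctD r c u v : wct r c (u + v) = wct r c u + wct r c v.
Proof.
apply: ps2P => i j; rewrite !fpsD /wct; case: eqP => // _; by rewrite addr0.
Qed.

Lemma wctN r c u : wct r c (- u) = - wct r c u.
Proof. by apply: ps2P => i j; rewrite !fpsN /wct; case: eqP => // _; rewrite oppr0. Qed.

Lemma wplusD r c u v : wplus r c u -> wplus r c v -> wplus r c (u + v).
Proof. by move=> hu hv i j h; rewrite !fpsD hu// hv// addr0. Qed.

Lemma wplusN r c u : wplus r c u -> wplus r c (- u).
Proof. by move=> hu i j h; rewrite !fpsN hu// oppr0. Qed.

Lemma wminusD r c u v : wminus r c u -> wminus r c v -> wminus r c (u + v).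
Proof. by move=> hu hv i j h; rewrite !fpsD hu// hv// addr0. Qed.

Lemma wminusN r c u : wminus r c u -> wminus r c (- u).
Proof. by move=> hu i j h; rewrite !fpsN hu// oppr0. Qed.

Lemma star_wplus r c u : wplus r c u -> wminus c r (star u).
Proof. by move=> hu i j h; rewrite /star hu. Qed.

Lemma star_wct r u : star (wct r r u) = wct r r u.
Proof.
apply: ps2P => i j; rewrite /star /wct eq_sym; case: eqP => // /eqP.
by rewrite eqn_add2r => /eqP/double_inj ->.
Qed.

End Bigraded.

Lemma det2 (K : comNzRingType) (M : 'M[K]_2) :
  \det M = M 0 0 * M 1 1 - M 0 1 * M 1 0.
Proof.
rewrite (expand_det_row _ 0) !big_ord_recl big_ord0 addr0 /cofactor/=.
rewrite !det_mx11 !mxE/= expr0 mul1r expr1 mulN1r mulrN.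
by congr (M 0 _ * M _ _ - M 0 _ * M _ _); apply/val_inj.
Qed.

Lemma ord2P (P : 'I_2 -> Prop) : P 0 -> P 1 -> forall i, P i.
Proof.
move=> h0 h1 [[|[|//]] hi].
- by have -> : Ordinal hi = 0 by apply/val_inj.
- by have -> : Ordinal hi = 1 by apply/val_inj.
Qed.

Lemma mx2P (K : Type) (M N : 'M[K]_2) : M 0 0 = N 0 0 -> M 0 1 = N 0 1 ->
  M 1 0 = N 1 0 -> M 1 1 = N 1 1 -> M = N.
Proof. by move=> *; apply/matrixP; apply: ord2P; apply: ord2P. Qed.

Lemma mulmx2 (K : pzRingType) (M N : 'M[K]_2) i j :
  (M *m N) i j = M i 0 * N 0 j + M i 1 * N 1 j.
Proof.
rewrite mxE !big_ord_recl big_ord0 addr0; congr (_ + M i _ * N _ j);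
  exact/val_inj.
Qed.

Lemma mx2E (K : Type) (a b c d : K) :
  (mx2 a b c d 0 0 = a) * (mx2 a b c d 0 1 = b) *
  (mx2 a b c d 1 0 = c) * (mx2 a b c d 1 1 = d).
Proof. by rewrite /mx2 !mxE/=. Qed.

Section Birkhoff.
Variable R : comNzRingType.
Local Notation A := (ps2 R).
Variable S : 'M[A]_2.
Hypothesis S00 : forall r c, S r c 0%N 0%N = 0.

Definition proj_plus (M : 'M[A]_2) : 'M[A]_2 :=
  \matrix_(r, c) fun i j => if (i.*2 + r <= j.*2 + c)%N then M r c i j else 0.

Definition birkhoff_step (q : 'M[A]_2) : 'M[A]_2 := 1%:M - proj_plus (S *m q).

Lemma birkhoff_stepE q r c i j : birkhoff_step q r c i j =
  ((r == c) && (i == 0%N) && (j == 0%N))%:R -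
  (if (i.*2 + r <= j.*2 + c)%N then (S *m q) r c i j else 0).
Proof.
have e (M N : 'M[A]_2) : (M - N) r c i j = M r c i j - N r c i j by rewrite !mxE.
rewrite /birkhoff_step e [1%:M r c]mxE [proj_plus _ r c]mxE.
by congr (_ - _); case: eqP => //= _; rewrite mulr1n ps2_1.
Qed.

Lemma mulmx_ps2 (M N : 'M[A]_2) r c i j :
  (M *m N) r c i j =
  \sum_m \sum_(k < i.+1) \sum_(l < j.+1) M r m k l * N m c (i - k)%N (j - l)%N.
Proof. by rewrite mxE ps2_sum; apply: eq_bigr => m _; rewrite ps2M. Qed.

(** [S] has no constant term, so [S *m _] raises the total degree. *)
Lemma birkhoff_step_agree n (q q' : 'M[A]_2) :
  (forall r c i j, (i + j < n)%N -> q r c i j = q' r c i j) ->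
  forall r c i j, (i + j < n.+1)%N ->
    birkhoff_step q r c i j = birkhoff_step q' r c i j.
Proof.
move=> h r c i j hij; rewrite !birkhoff_stepE; congr (_ - _).
case: ifP => // _; rewrite !mulmx_ps2; apply: eq_bigr => m _.
apply: eq_bigr => -[k /= hk] _; apply: eq_bigr => -[l /= hl] _.
have [/eqP|kl0] := eqVneq (k + l)%N 0%N.
  by rewrite addn_eq0 => /andP[/eqP -> /eqP ->]; rewrite S00 !mul0r.
by rewrite h//; lia.
Qed.

Definition birkhoff_approx n := iter n birkhoff_step 0.

Lemma birkhoff_approx_agree n m r c i j : (i + j < n)%N -> (n <= m)%N ->
  birkhoff_approx n r c i j = birkhoff_approx m r c i j.
Proof.
elim: n m r c i j => // n IH [//|m] r c i j hij nm.
by apply: (birkhoff_step_agree (n := n)) => // *; apply: IH.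
Qed.

Definition birkhoff : 'M[A]_2 :=
  \matrix_(r, c) fun i j => birkhoff_approx (i + j).+1 r c i j.

Lemma birkhoff_coef r c i j :
  birkhoff r c i j = birkhoff_approx (i + j).+1 r c i j.
Proof. by rewrite /birkhoff mxE. Qed.

Lemma birkhoff_fix : birkhoff = birkhoff_step birkhoff.
Proof.
apply/matrixP => r c; apply: ps2P => i j; rewrite birkhoff_coef.
apply: (birkhoff_step_agree (n := i + j)) => // r' c' i' j' h.
by rewrite birkhoff_coef; symmetry; apply: birkhoff_approx_agree.
Qed.

Lemma birkhoffE r c i j : birkhoff r c i j =
  ((r == c) && (i == 0%N) && (j == 0%N))%:R -
  (if (i.*2 + r <= j.*2 + c)%N then
    \sum_m \sum_(k < i.+1) \sum_(l < j.+1)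
      S r m k l * birkhoff m c (i - k)%N (j - l)%N else 0).
Proof.
by rewrite {1}birkhoff_fix birkhoff_stepE mulmx_ps2.
Qed.

Lemma birkhoff_plus (r c : 'I_2) : wplus r c (birkhoff r c).
Proof.
move=> i j h; rewrite birkhoffE leqNgt h/= subr0.
case: eqP => //= rc; case: eqP => //= i0; case: eqP => //= j0.
by move: h; rewrite rc i0 j0 ltnn.
Qed.

Lemma birkhoff_mulE r c i j : ((1%:M + S) *m birkhoff) r c i j =
  ((r == c) && (i == 0%N) && (j == 0%N))%:R +
  (if (i.*2 + r <= j.*2 + c)%N then 0 else (S *m birkhoff) r c i j).
Proof.
have e (M N : 'M[A]_2) : (M + N) r c i j = M r c i j + N r c i j by rewrite !mxE.
rewrite mulmxDl mul1mx e birkhoffE -mulmx_ps2 -addrA.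
by congr (_ + _); case: ifP => _; rewrite ?oppr0 ?add0r// addNr.
Qed.

Lemma birkhoff_mul_minus (r c : 'I_2) : wminus r c (((1%:M + S) *m birkhoff) r c).
Proof.
move=> i j h; rewrite birkhoff_mulE (ltnW h) addr0.
case: eqP => //= rc; case: eqP => //= i0; case: eqP => //= j0.
by move: h; rewrite rc i0 j0 ltnn.
Qed.

Lemma birkhoff_mul_ct (r c : 'I_2) :
  wct r c (((1%:M + S) *m birkhoff) r c) = (1%:M : 'M[A]_2) r c.
Proof.
apply: ps2P => i j; rewrite /wct birkhoff_mulE [1%:M r c]mxE; case: eqP => h.
  rewrite h leqnn addr0; case: eqP => //= rc; by rewrite mulr1n ps2_1.
case: eqP => [rc|]//=; rewrite mulr1n ps2_1.
case: eqP => //= i0; case: eqP => //= j0; by exfalso; apply: h; rewrite rc i0 j0.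
Qed.

End Birkhoff.

Section HermitianFactorization.
Variable R : comNzRingType.
Local Notation A := (ps2 R).

(** The formal conjugate transpose: on the circle [x] and [y] are conjugate. *)
Definition mstar (M : 'M[A]_2) : 'M[A]_2 := (map_mx (@star R) M)^T.

Definition sgn_mx : 'M[A]_2 := mx2 1 0 0 (-1).

Lemma mstarE M r c : mstar M r c = star (M c r). Proof. by rewrite !mxE. Qed.

Lemma mstarM M N : mstar (M *m N) = mstar N *m mstar M.
Proof. by rewrite /mstar map_mxM trmx_mul. Qed.

Lemma mstarK : involutive mstar.
Proof. by move=> M; apply/matrixP => r c; rewrite !mstarE. Qed.

Lemma mstar_congr M N : mstar N = N -> mstar (mstar M *m N *m M) = mstar M *m N *m M.
Proof. by move=> h; rewrite !mstarM mstarK h mulmxA. Qed.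

Lemma mstar_sgnE (M N : 'M[A]_2) r c : (mstar M *m (sgn_mx *m N)) r c =
  star (M 0 r) * N 0 c - star (M 1 r) * N 1 c.
Proof. by rewrite mulmx2 !mstarE !mulmx2 !mx2E; ring. Qed.

Lemma sgn_conjE (M : 'M[A]_2) r c : (sgn_mx *m (mstar M *m sgn_mx *m M)) r c =
  sgn_mx r r * (star (M 0 r) * M 0 c - star (M 1 r) * M 1 c).
Proof.
rewrite mulmx2 !mulmx2 !mstarE.
by move: r; apply: ord2P; rewrite !mx2E; ring.
Qed.

Lemma det_mstar M : \det (mstar M) = star (\det M).
Proof. by rewrite /mstar det_tr det_map_mx. Qed.

Lemma mstar_sgn : mstar sgn_mx = sgn_mx.
Proof.
by apply: mx2P; rewrite mstarE !mx2E ?raddf0 ?rmorphN ?rmorph1.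
Qed.

Lemma sgn_sgn : sgn_mx *m sgn_mx = 1%:M.
Proof. by apply: mx2P; rewrite mulmx2 !mx2E !mxE/=; ring. Qed.

Lemma det_sgn : \det sgn_mx = -1.
Proof. by rewrite det2 !mx2E; ring. Qed.

Lemma star_wminus r c (u : A) : wminus r c u -> wplus c r (star u).
Proof. by move=> hu i j h; rewrite /star hu. Qed.

Lemma wct_star r c (u : A) : wct r c (star u) = star (wct c r u).
Proof. by apply: ps2P => i j; rewrite /wct /star eq_sym. Qed.

Variable G : 'M[A]_2.
Hypothesis G_star : mstar G = G.
Hypothesis G_det : \det G = -1.

Variables P Q : 'M[A]_2.
Hypothesis GQ : G *m P = sgn_mx *m Q.
Hypothesis Pp : forall r c : 'I_2, wplus r c (P r c).
Hypothesis Qm : forall r c : 'I_2, wminus r c (Q r c).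
Hypothesis Qct : forall r c : 'I_2, wct r c (Q r c) = (1%:M : 'M[A]_2) r c.
Arguments Pp : clear implicits.
Arguments Qm : clear implicits.

Let ct0 (u : A) : (wct 0 1 u = 0) * (wct 1 0 u = 0).
Proof. by split; apply: ps2P => i j; rewrite /wct; case: eqP => // h; lia. Qed.

Lemma wct11 (u : A) : wct 1 1 u = wct 0 0 u.
Proof. by apply: ps2P => i j; rewrite /wct !addn0 !addn1 eqSS. Qed.

(** [det P] has no negative powers and [det Q] no positive ones, but they agree
since [Q = D G P] and [det (D G) = 1]. *)
Lemma plus_minus_det : \det P = 1.
Proof.
have dPQ : \det P = \det Q.
  have /(congr1 determinant) := GQ; rewrite !det_mulmx det_sgn G_det !mulN1r.
  exact: oppr_inj.
have Pd : wplus 0 0 (\det P).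
  have P11 : wplus 0 0 (P 1 1) by move=> i j h; apply: (Pp 1 1 i j); move: h => /=; lia.
  rewrite det2; apply: wplusD; first exact: (wplusM (m := 0) (Pp 0 0) P11).
  exact/wplusN/(wplusM (Pp 0 1) (Pp 1 0)).
have Q11 : wminus 0 0 (Q 1 1) by move=> i j h; apply: (Qm 1 1 i j); move: h => /=; lia.
have Qd : wminus 0 0 (\det Q).
  rewrite det2; apply: wminusD; first exact: (wminusM (m := 0) (Qm 0 0) Q11).
  exact/wminusN/(wminusM (Qm 0 1) (Qm 1 0)).
rewrite dPQ -(wctP (r := 0) (c := 0) _ Qd) -?dPQ// dPQ det2 wctD wctN.
rewrite (wctM (m := 0) (Qm 0 0) Q11) (wctM (Qm 0 1) (Qm 1 0)).
rewrite (Qct 0 0) -wct11 (Qct 1 1) ct0 mul0r subr0 !mxE/= mulr1n.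
by rewrite mul1r.
Qed.

(** [mstar P *m G *m P = mstar P *m (D *m Q)] has no positive powers, and is its
own conjugate transpose: it only has the power zero. *)
Lemma plus_minus_diag : mstar P *m G *m P =
  mx2 (wct 0 0 (P 0 0)) 0 0 (- wct 0 0 (P 1 1)).
Proof.
set K := mstar P *m G *m P.
have Kst : mstar K = K.
  exact: mstar_congr.
have KE r c : K r c = star (P 0 r) * Q 0 c - star (P 1 r) * Q 1 c.
  by rewrite /K -mulmxA GQ mstar_sgnE.
have sPm (r m : 'I_2) : wminus r m (star (P m r)) by exact: star_wplus.
have Km (r c : 'I_2) : wminus r c (K r c).
  rewrite KE; apply: wminusD; first exact: wminusM (sPm r 0) (Qm 0 c).
  exact/wminusN/(wminusM (sPm r 1) (Qm 1 c)).
have Kp (r c : 'I_2) : wplus r c (K r c).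
  by rewrite -Kst mstarE; apply: star_wminus.
have {Kst}Kct (r c : 'I_2) : K r c =
    star (wct 0 r (P 0 r)) * (1%:M : 'M[A]_2) 0 c
    - star (wct 1 r (P 1 r)) * (1%:M : 'M[A]_2) 1 c.
  rewrite -(wctP (Kp r c) (Km r c)) KE wctD wctN.
  rewrite (wctM (sPm r 0) (Qm 0 c)) (wctM (sPm r 1) (Qm 1 c)).
  rewrite (wct_star r 0 (P 0 r)) (wct_star r 1 (P 1 r)) (Qct 0 c) (Qct 1 c).
  exact: erefl.
have e0 : (1%:M : 'M[A]_2) 0 0 = 1 by rewrite !mxE.
have e1 : (1%:M : 'M[A]_2) 1 1 = 1 by rewrite !mxE.
have e2 : (1%:M : 'M[A]_2) 0 1 = 0 by rewrite !mxE.
have e3 : (1%:M : 'M[A]_2) 1 0 = 0 by rewrite !mxE.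
apply: mx2P; rewrite Kct ?(e0, e1, e2, e3) !mx2E ?ct0 ?wct11 ?star_wct;
  by rewrite ?raddf0 ?mulr0 ?mulr1 ?subr0 ?sub0r ?mul0r ?oppr0.
Qed.

Lemma plus_minus_diag1 : wct 0 0 (P 0 0) * wct 0 0 (P 1 1) = 1.
Proof.
have := congr1 determinant plus_minus_diag.
rewrite !det_mulmx det_mstar plus_minus_det rmorph1 G_det det2 !mx2E.
rewrite mul1r mulr1 mul0r subr0 mulrN => /eqP; rewrite eqr_opp => /eqP <-.
by [].
Qed.

End HermitianFactorization.

Section HermitianFactor.
Variable R : comNzRingType.
Local Notation A := (ps2 R).
Local Notation sgn_mx := (sgn_mx R).
Variable G : 'M[A]_2.

Definition herm_pert : 'M[A]_2 := sgn_mx *m G - 1%:M.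

Hypothesis G00 : forall r c, G r c 0%N 0%N = sgn_mx r c 0%N 0%N.

Lemma herm_pert00 r c : herm_pert r c 0%N 0%N = 0.
Proof.
have e (M N : 'M[A]_2) : (M - N) r c 0%N 0%N = M r c 0%N 0%N - N r c 0%N 0%N.
  by rewrite !mxE.
rewrite /herm_pert e mulmx_ps2 -(sgn_sgn R) mulmx_ps2 -sumrB big1// => m _.
by rewrite !big_ord1/= G00 subrr.
Qed.

Lemma sgn_herm_pert : sgn_mx *m (1%:M + herm_pert) = G.
Proof. by rewrite /herm_pert addrC subrK mulmxA sgn_sgn mul1mx. Qed.

Definition herm_factor := birkhoff herm_pert.

Lemma herm_factor_plus (r c : 'I_2) : wplus r c (herm_factor r c).
Proof. exact/birkhoff_plus/herm_pert00. Qed.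

Hypothesis G_star : mstar G = G.
Hypothesis G_det : \det G = -1.

Lemma herm_factorP : [/\ \det herm_factor = 1,
  mstar herm_factor *m G *m herm_factor =
    mx2 (wct 0 0 (herm_factor 0 0)) 0 0 (- wct 0 0 (herm_factor 1 1)) &
  wct 0 0 (herm_factor 0 0) * wct 0 0 (herm_factor 1 1) = 1].
Proof.
have Pp := herm_factor_plus.
have Qm (r c : 'I_2) := birkhoff_mul_minus herm_pert00 (r := r) (c := c).
have Qct := birkhoff_mul_ct herm_pert00.
move: Pp Qm Qct; rewrite -/herm_factor.
have : G *m herm_factor = sgn_mx *m ((1%:M + herm_pert) *m herm_factor).
  by rewrite (mulmxA sgn_mx) sgn_herm_pert.
move: ((1%:M + herm_pert) *m herm_factor) => Q; move: herm_factor => P e Pp Qm Qct.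
split; [exact: plus_minus_det e Pp Qm Qct|exact: plus_minus_diag e Pp Qm Qct|].
exact: plus_minus_diag1 e Pp Qm Qct.
Qed.

End HermitianFactor.

(** * The series of the fundamental solution *)

Section FundamentalSolution.
Variable R : realType.
Local Notation A := (ps2 R).

Definition xser (c : nat -> R) : A := fun i j => if j == 0%N then c i else 0.
Definition cst2 (x : R) : A := fun i j => x *+ ((i == 0%N) && (j == 0%N)).

Lemma cst2M x (u : A) i j : (cst2 x * u) i j = x * u i j.
Proof.
rewrite ps2M big_ord_recl big_ord_recl big1 => [|k _].
  rewrite addr0 big1 ?addr0 ?subn0// => k _.
  rewrite big1// => l _; rewrite /cst2/= mulr0n mul0r//.
by rewrite /cst2 /= mulr0n mul0r.
Qed.

Lemma cst2_mul x y : cst2 x * cst2 y = cst2 (x * y).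
Proof. by apply: ps2P => i j; rewrite cst2M /cst2 mulrnAr. Qed.

Lemma cst2_1 : cst2 1 = 1.
Proof. by apply: ps2P => i j; rewrite ps2_1. Qed.

(** [x d/dx] *)
Definition dx (u : A) : A := fun i => u i *+ i.

Lemma fps_mulrn (w : fps R) n j : (w *+ n) j = w j *+ n.
Proof. by elim: n => [|n IH]; rewrite ?mulr0n// !mulrS fpsD IH. Qed.

Lemma dxM u v : dx (u * v) = dx u * v + u * dx v.
Proof.
apply/funext => n; rewrite fpsD !fpsM /dx fpsM -sumrMnl -big_split/=.
apply: eq_bigr => -[i /= hi] _.
by rewrite mulrnAl mulrnAr -mulrnDr subnKC.
Qed.

Lemma dxD u v : dx (u + v) = dx u + dx v.
Proof. by apply/funext => n; rewrite /dx fpsD mulrnDl. Qed.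

Lemma dxN u : dx (- u) = - dx u.
Proof. by apply/funext => n; rewrite /dx fpsN mulNrn. Qed.

Lemma dx_eq0 u : dx u = 0 -> forall i j, (0 < i)%N -> u i j = 0.
Proof.
move=> h i j i0; have /(congr1 (fun w : A => w i j)) := h.
rewrite /dx => /eqP; rewrite (_ : (u i *+ i) j = u i j *+ i); last first.
  exact: fps_mulrn.
by rewrite mulrn_eq0 -[i == _]negbK -lt0n i0 => /eqP.
Qed.

Lemma dx_xser c : dx (xser c) = xser (fun i => c i *+ i).
Proof.
apply: ps2P => i j; rewrite /dx /xser.
by rewrite fps_mulrn; case: eqP => // _; rewrite mul0rn.
Qed.

Definition xvar : A := xser (fun i => (i == 1%N)%:R).

Lemma xvarM c : xvar * xser c = xser (fun i => if i is m.+1 then c m else 0).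
Proof.
apply: ps2P => i j; rewrite ps2M /xvar /xser.
transitivity (\sum_(k < i.+1) (if (val k == 1%N) && (j == 0%N) then c (i - k)%N else 0)).
  apply: eq_bigr => k _; rewrite big_ord_recl big1 => [|l _]; last by rewrite /= mul0r.
  rewrite /= subn0 addr0 mulrC; case: (val k == 1%N); rewrite ?mulr1 ?mulr0//.
case: eqP => [_|_]; last by rewrite big1// => k _; rewrite andbF.
case: i => [|i]; first by rewrite big_ord1.
rewrite big_ord_recl/= add0r big_ord_recl/= subSS subn0 big1 ?addr0//.
Qed.

Lemma eq_xser c d : c =1 d -> xser c = xser d.
Proof. by move=> h; congr xser; apply/funext. Qed.

Lemma xserD c d : xser c + xser d = xser (fun i => c i + d i).
Proof. by apply: ps2P => i j; rewrite !fpsD /xser; case: eqP => // _; rewrite addr0. Qed.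

Lemma xserN c : - xser c = xser (fun i => - c i).
Proof. by apply: ps2P => i j; rewrite !fpsN /xser; case: eqP => // _; rewrite oppr0. Qed.

Definition harm (i : nat) : R := \sum_(1 <= j < i.+1) j%:R^-1.
Definition phic (i : nat) : R := (i`!%:R ^+ 2)^-1.
Definition psic (i : nat) : R := - (2 * harm i * phic i).

Definition phi := xser phic.
Definition psi := xser psic.

Lemma phicS i : phic i.+1 * i.+1%:R ^+ 2 = phic i.
Proof.
rewrite /phic factS natrM exprMn invfM mulrC mulrA divff ?mul1r//.
Qed.

Lemma harmS i : harm i.+1 = harm i + i.+1%:R^-1.
Proof. by rewrite /harm big_nat_recr. Qed.

(** [phi] and [phi * log x + psi] span the solutions of [(x d/dx)^2 f = x f]. *)
Lemma dx_dx_phi : dx (dx phi) = xvar * phi.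
Proof.
rewrite !dx_xser xvarM; apply: eq_xser => -[|i]; first by rewrite !mulr0n.
by rewrite -(phicS i) -mulrnA -[LHS]mulr_natr natrM expr2.
Qed.

Lemma dx_dx_psi : dx (dx psi) = xvar * psi - dx phi - dx phi.
Proof.
rewrite !dx_xser xvarM !xserN !xserD; apply: eq_xser => -[|i].
  by rewrite !mulr0n oppr0 !addr0.
rewrite -mulrnA -[LHS]mulr_natr -[phic _ *+ _]mulr_natr natrM /psic harmS -(phicS i).
by field; rewrite addrC natr1 pnatr_eq0.
Qed.

Definition ell : 'M[A]_2 := mx2 phi (dx phi) psi (phi + dx psi).

Lemma ell00 r c : ell r c 0%N 0%N = (r == c)%:R.
Proof.
have p0 : phic 0 = 1 by rewrite /phic fact0 expr1n invr1.
have h0 : psic 0 = 0 by rewrite /psic /harm big_geq// mulr0 mul0r oppr0.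
move: r c; apply: ord2P; apply: ord2P; rewrite /ell mx2E ?dx_xser ?fpsD /xser/= ?mulr0n//.
by rewrite ?h0 ?p0 ?addr0.
Qed.

(** The Wronskian is constant. *)
Lemma det_ell : \det ell = 1.
Proof.
have d0 : dx (\det ell) = 0.
  rewrite det2 /ell !mx2E dxD dxN !dxM dxD dx_dx_phi dx_dx_psi; ring.
apply: ps2P => -[|i] j; last by rewrite (dx_eq0 d0)// ps2_1.
rewrite ps2_1/= det2 !fpsD !fpsN !ps2M !big_ord1/=.
transitivity ((j == 0%N)%:R : R); last by [].
have e r c l : ell r c 0%N l = if l == 0%N then (r == c)%:R else 0.
  case: l => [|l]; first by rewrite ell00.
  move: r c; apply: ord2P; apply: ord2P;
    by rewrite /ell mx2E ?dx_xser ?fpsD /xser/= ?addr0.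
rewrite big_ord_recl big1 => [|l _]; last by rewrite e mul0r.
rewrite [X in - X]big1 => [|l _]; last by rewrite e/= if_same mul0r.
by rewrite subr0 addr0 !e/= subn0 mul1r; case: eqP.
Qed.

(** [B_1 ell B_1^-1] for [B_1 = ((s, -1), (0, 1))], written out so that it also
makes sense coefficientwise; [s = - a - 2 ln |z|]. *)
Definition aser (s : R) : 'M[A]_2 :=
  mx2 (ell 0 0 - cst2 s^-1 * ell 1 0)
      (ell 0 0 - cst2 s^-1 * ell 1 0 + cst2 s * ell 0 1 - ell 1 1)
      (cst2 s^-1 * ell 1 0)
      (cst2 s^-1 * ell 1 0 + ell 1 1).

Lemma aserE (s : R) : s != 0 -> aser s *m mx2 (cst2 s) (-1) 0 1 =
  mx2 (cst2 s) (-1) 0 1 *m ell.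
Proof.
move=> s0; have e : cst2 s^-1 * cst2 s = 1 by rewrite cst2_mul mulVf// cst2_1.
rewrite /aser; move: (cst2 s) (cst2 s^-1) ell e => u v L e.
apply: mx2P; rewrite !mulmx2 !mx2E.
- apply: subr0_eq; transitivity ((1 - v * u) * L 1 0); first ring.
  by rewrite e subrr mul0r.
- by ring.
- apply: subr0_eq; transitivity ((v * u - 1) * L 1 0); first ring.
  by rewrite e subrr mul0r.
- by ring.
Qed.

Lemma det_aser (s : R) : s != 0 -> \det (aser s) = 1.
Proof.
move=> s0; have e : cst2 s^-1 * cst2 s = 1 by rewrite cst2_mul mulVf// cst2_1.
have := det_ell; rewrite /aser.
move: (cst2 s) (cst2 s^-1) ell e => u v L e <-; rewrite !det2 !mx2E.
transitivity (L 0 0 * L 1 1 - (v * u) * L 0 1 * L 1 0); first ring.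
by rewrite e mul1r.
Qed.

Lemma aser00 (s : R) r c : aser s r c 0%N 0%N = (r == c)%:R.
Proof.
move: r c; apply: ord2P; apply: ord2P; rewrite /aser mx2E ?fpsD ?fpsN ?cst2M !ell00/=;
  by rewrite ?mulr0 ?subr0 ?addr0 ?add0r// subrr.
Qed.

Lemma aser_xser (s : R) r c i j : (0 < j)%N -> aser s r c i j = 0.
Proof.
case: j => // j _; have e r' c' : ell r' c' i j.+1 = 0.
  move: r' c'; apply: ord2P; apply: ord2P;
    by rewrite /ell mx2E ?dx_xser ?fpsD /xser/= ?addr0.
move: r c; apply: ord2P; apply: ord2P; rewrite /aser mx2E ?fpsD ?fpsN ?cst2M !e/=;
  by rewrite ?mulr0 ?subr0 ?addr0 ?add0r// subrr.
Qed.

Definition gser (s : R) : 'M[A]_2 := mstar (aser s) *m sgn_mx R *m aser s.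

Lemma gser_star (s : R) : mstar (gser s) = gser s.
Proof. by rewrite /gser !mstarM mstarK mstar_sgn mulmxA. Qed.

Lemma det_gser (s : R) : s != 0 -> \det (gser s) = -1.
Proof.
by move=> s0; rewrite /gser !det_mulmx det_mstar det_aser// rmorph1 det_sgn mulr1 mul1r.
Qed.

Lemma gser00 (s : R) r c : gser s r c 0%N 0%N = sgn_mx R r c 0%N 0%N.
Proof.
rewrite /gser mulmx2 !mulmx2 !mstarE /sgn_mx !mx2E !mulr0 !addr0 !add0r !fpsD.
rewrite !ps2M !big_ord1/= /star !subn0 !ps2M !big_ord1/= /star !subn0.
rewrite !aser00 !fpsN !ps2_1 /=.
by move: r c; apply: ord2P; apply: ord2P; rewrite !mx2E/=
  ?fpsN ?ps2_1/= ?(mul0r, mulr0, mulr1, mul1r, addr0, add0r).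
Qed.

Definition Sser (s : R) : 'M[A]_2 := herm_pert (gser s).
Definition Pser (s : R) : 'M[A]_2 := herm_factor (gser s).

Lemma SserE (s : R) r c i j : (0 < i + j)%N ->
  Sser s r c i j = (sgn_mx R r r 0%N 0%N) *
   (aser s 0 r j 0%N * aser s 0 c i 0%N - aser s 1 r j 0%N * aser s 1 c i 0%N).
Proof.
move=> ij.
have e (M N : 'M[A]_2) : (M - N) r c i j = M r c i j - N r c i j by rewrite !mxE.
rewrite /Sser /herm_pert e [X in _ - X](_ : _ = 0) ?subr0; last first.
  rewrite mxE; case: eqP => // _; rewrite mulr1n ps2_1.
  by clear e; case: i j ij => [|i] [|j].
have key m m' : (star (aser s m r) * aser s m' c) i j
    = aser s m r j 0%N * aser s m' c i 0%N.
  rewrite ps2M big_ord_recl [X in _ + X]big1 => [|k _].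
    rewrite addr0 big_ord_recr/= big1 => [|l _].
      by rewrite add0r /star subn0 subnn.
    by rewrite aser_xser ?mulr0// subn_gt0.
  by rewrite big1// => l _; rewrite /star aser_xser ?mul0r.
have -> : (sgn_mx R *m gser s) r c = sgn_mx R r r *
    (star (aser s 0 r) * aser s 0 c - star (aser s 1 r) * aser s 1 c).
  exact: sgn_conjE.
move: r key {e}; apply: ord2P => key.
  by rewrite [sgn_mx R 0 0]mx2E mul1r !fpsD !fpsN !key ps2_1 mul1r.
by rewrite [sgn_mx R 1 1]mx2E mulN1r !fpsN !fpsD !fpsN !key ps2_1 mulN1r.
Qed.

End FundamentalSolution.

(** * Dominated real series *)

Section RealSeries.
Variable R : realType.
Implicit Types u v M : nat -> R.

Definition rsum u : R := limn (series u).

Definition dominated u M := (forall n, `|u n| <= M n) /\ cvgn (series M).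

Lemma dominated_cvg u M : dominated u M -> series u @ \oo --> rsum u.
Proof.
move=> [uM cM]; apply: normed_cvg; apply: series_le_cvg cM => // n; first exact: normr_ge0.
exact: le_trans (normr_ge0 _) (uM n).
Qed.

Lemma rsum_eq u l : series u @ \oo --> l -> rsum u = l.
Proof. by move=> h; apply/cvg_lim. Qed.

Lemma dominatedD u v M N : dominated u M -> dominated v N ->
  dominated (fun n => u n + v n) (fun n => M n + N n).
Proof.
move=> [uM cM] [vN cN]; split => [n|].
  exact: le_trans (ler_normD _ _) (lerD (uM n) (vN n)).
exact: is_cvg_seriesD cM cN.
Qed.

Lemma dominatedZ k u M : dominated u M ->
  dominated (fun n => k * u n) (fun n => `|k| * M n).
Proof.
move=> [uM cM]; split => [n|]; first by rewrite normrM ler_wpM2l.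
exact: is_cvg_seriesZ cM.
Qed.

Lemma rsumD u v M N : dominated u M -> dominated v N ->
  rsum (fun n => u n + v n) = rsum u + rsum v.
Proof.
move=> hu hv; apply: rsum_eq.
rewrite (_ : series _ = series u + series v); last exact: seriesD.
exact: cvgD (dominated_cvg hu) (dominated_cvg hv).
Qed.

Lemma rsumZ k u M : dominated u M -> rsum (fun n => k * u n) = k * rsum u.
Proof.
move=> hu; apply: rsum_eq.
rewrite (_ : series _ = k *: series u); last exact: seriesZ.
exact: cvgZr (dominated_cvg hu).
Qed.

Lemma rsumN u M : dominated u M -> rsum (fun n => - u n) = - rsum u.
Proof.
move=> hu; rewrite -mulN1r -(rsumZ (-1) hu); congr rsum.
by apply/funext => n; rewrite mulN1r.
Qed.

Lemma rsum_tail u M N : dominated u M ->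
  `|rsum u - series u N| <= rsum M - series M N.
Proof.
move=> hu; have [uM cM] := hu.
have cu : (fun n => `|series u n - series u N|) @ \oo --> `|rsum u - series u N|.
  by apply: cvg_norm; apply: cvgB; [exact: dominated_cvg hu|exact: cvg_cst].
have cM' : (fun n => series M n - series M N) @ \oo --> rsum M - series M N.
  by apply: cvgB; [exact: cM|exact: cvg_cst].
apply: (ler_cvg_to cu cM'); exists N => // n /= Nn.
rewrite !sub_series_geq//; apply: le_trans (ler_norm_sum _ _ _) _.
by apply: ler_sum => i _.
Qed.

Lemma rsum_le u M : dominated u M -> `|rsum u| <= rsum M.
Proof.
move=> /(rsum_tail 0).
by rewrite /series/= !big_geq// !subr0.
Qed.

(** Dominated convergence for series. *)
Lemma rsum_cvg (T : Type) (F : set_system T) (w : nat -> T -> R) (l M : nat -> R) :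
  Filter F -> (forall n, w n x @[x --> F] --> l n) -> dominated l M ->
  (\forall x \near F, forall n, `|w n x| <= M n) ->
  rsum (w ^~ x) @[x --> F] --> rsum l.
Proof.
move=> FF wl lM wM; have cM := lM.2.
apply/cvgrPdist_lt => e e0.
have e4 : 0 < e / 4 by rewrite divr_gt0.
have [N _ /(_ N (leqnn N))/= hN] : \forall n \near \oo, `|rsum M - series M n| < e / 4.
  by have /cvgrPdist_lt/(_ _ e4) := cM.
have cN : series (w ^~ x) N @[x --> F] --> series l N.
  rewrite /series/=; elim: (N) => [|n IH].
    under eq_fun do rewrite big_geq//.
    by rewrite big_geq//; exact: cvg_cst.
  under eq_fun do rewrite big_nat_recr//=.
  rewrite big_nat_recr//=; exact: cvgD.
have /cvgrPdist_lt/(_ _ e4) cN' := cN.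
near=> x.
have wx : dominated (w ^~ x) M by split => //; near: x.
have h1 := rsum_tail N lM; have h2 := rsum_tail N wx.
have h3 : `|series l N - series (w ^~ x) N| < e / 4 by near: x.
have h4 := ler_norm (rsum M - series M N).
rewrite (_ : _ - _ = (rsum l - series l N) + (series l N - series (w ^~ x) N)
  - (rsum (w ^~ x) - series (w ^~ x) N)); last by ring.
have t := ltW (le_lt_trans h4 hN).
apply: (@le_lt_trans _ _ (e / 4 + e / 4 + e / 4)); last by move: e0; clear; lra.
apply: le_trans (ler_normB _ _) _; apply: lerD; last exact: le_trans h2 t.
apply: le_trans (ler_normD _ _) _; apply: lerD; [exact: le_trans h1 t|exact: ltW].
Unshelve. all: by end_near. Qed.

Section GeometricBounds.
Implicit Type q : R.

Lemma natr_geo_bounded q : 0 <= q < 1 -> exists2 C, 0 <= C &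
  forall n, n.+1%:R * q ^+ n <= C.
Proof.
move=> /andP[q0 q1]; exists (1 - q)^-1; first by rewrite invr_ge0 subr_ge0 ltW.
move=> n; have -> : n.+1%:R * q ^+ n = \sum_(i < n.+1) q ^+ n.
  by rewrite sumr_const card_ord mulr_natl.
have h : \sum_(i < n.+1) q ^+ n <= \sum_(i < n.+1) q ^+ i.
  by apply: ler_sum => -[i /= hi] _; rewrite ler_wiXn2l// ltW.
apply: le_trans h _.
have d0 : 0 < 1 - q by rewrite subr_gt0.
rewrite -[_^-1]mul1r ler_pdivlMr// mulrC -opprB mulNr -subrX1 opprB gerBl.
exact: exprn_ge0.
Qed.

Lemma poly_geo_bounded m q : 0 <= q < 1 -> exists2 C, 0 <= C &
  forall n, n.+1%:R ^+ m * q ^+ n <= C.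
Proof.
elim: m q => [|m IH] q q01; have [q0 q1] := andP q01.
  by exists 1 => // n; rewrite expr0 mul1r exprn_ile1// ltW.
set p := Num.sqrt q; have p01 : 0 <= p < 1.
  by rewrite sqrtr_ge0/= -sqrtr1 ltr_sqrt.
have [C C0 hC] := IH p p01; have [D D0 hD] := natr_geo_bounded p01.
have [p0 _] := andP p01.
exists (C * D); first exact: mulr_ge0.
move=> n; rewrite (_ : _ * _ = (n.+1%:R ^+ m * p ^+ n) * (n.+1%:R * p ^+ n)).
  by apply: ler_pM; rewrite ?mulr_ge0 ?exprn_ge0.
by rewrite -[q in LHS]sqr_sqrtr// -/p exprS -exprM mulnC exprM; ring.
Qed.

Lemma cvg_poly_geo m q : 0 <= q < 1 -> cvgn (series (fun n => n.+1%:R ^+ m * q ^+ n)).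
Proof.
move=> q01; have [q0 q1] := andP q01.
set p := Num.sqrt q; have p01 : 0 <= p < 1.
  by rewrite sqrtr_ge0/= -sqrtr1 ltr_sqrt.
have [p0 p1] := andP p01; have [C C0 hC] := poly_geo_bounded m p01.
apply: (@series_le_cvg _ _ (geometric C p)).
- by move=> n; rewrite mulr_ge0 ?exprn_ge0.
- by move=> n; rewrite /geometric/= mulr_ge0 ?exprn_ge0.
- move=> n; rewrite /geometric/= -[q in leLHS]sqr_sqrtr// -/p -exprM mulnC exprM expr2 mulrA.
  by rewrite ler_wpM2r ?exprn_ge0.
- by apply: is_cvg_geometric_series; rewrite ger0_norm.
Qed.

Lemma cvg_geo C q : 0 <= q < 1 -> cvgn (series (fun n => C * q ^+ n)).
Proof. by move=> /andP[q0 q1]; apply: is_cvg_geometric_series; rewrite ger0_norm. Qed.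

Lemma rsum_geo_tail C q : 0 <= C -> 0 <= q <= 2^-1 ->
  0 <= rsum (fun n => C * q ^+ n) - C <= 2 * C * q.
Proof.
move=> C0 /andP[q0 q2]; have q1 : `|q| < 1 by rewrite ger0_norm//; lra.
have -> : rsum (fun n => C * q ^+ n) = C * (1 - q)^-1.
  by apply: rsum_eq; apply: cvg_geometric_series.
have e : C * (1 - q)^-1 - C = C * q / (1 - q) by field; apply/eqP; lra.
rewrite e; apply/andP; split; first by rewrite mulr_ge0 ?mulr_ge0// invr_ge0; lra.
rewrite ler_pdivrMr; last lra.
by have := mulr_ge0 C0 q0; nra.
Qed.

(** The Cauchy product. *)
Lemma rsum_conv u v C q : 0 <= q < 1 ->
  (forall n, `|u n| <= C * q ^+ n) -> (forall n, `|v n| <= C * q ^+ n) ->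
  rsum (fun n => \sum_(i < n.+1) u i * v (n - i)%N) = rsum u * rsum v.
Proof.
move=> q01 uC vC; have [q0 q1] := andP q01.
have cu : series u @ \oo --> rsum u.
  by apply: (@dominated_cvg _ (fun n => C * q ^+ n)); split => //; exact: cvg_geo.
have cv : series v @ \oo --> rsum v.
  by apply: (@dominated_cvg _ (fun n => C * q ^+ n)); split => //; exact: cvg_geo.
apply: rsum_eq.
have cz : (fun N => C ^+ 2 * (N.+1%:R ^+ 2 * q ^+ N)) @ \oo --> 0.
  rewrite -(mulr0 (C ^+ 2)); apply: cvgM; first exact: cvg_cst.
  exact/cvg_series_cvg_0/cvg_poly_geo.
have d0 : (fun N => series u N * series v N
   - series (fun n => \sum_(i < n.+1) u i * v (n - i)%N) N) @ \oo --> 0.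
  have ncz : (fun N => - (C ^+ 2 * (N.+1%:R ^+ 2 * q ^+ N))) @ \oo --> 0.
    by rewrite -oppr0; apply: cvgN.
  apply: (squeeze_cvgr _ ncz cz); apply: nearW => N.
  rewrite -ler_norml /series/= !big_mkord (big_tri (fun i j => u i * v j)).
  have -> : (\sum_(k < N) u k) * (\sum_(k < N) v k) =
     \sum_(i < N) \sum_(j < N - i) u i * v j +
     \sum_(i < N) \sum_(j < N | (N <= i + j)%N) u i * v j.
    rewrite mulr_suml -big_split; apply: eq_bigr => i _ /=.
    rewrite mulr_sumr (bigID (fun j : 'I_N => (i + j < N)%N))/=; congr (_ + _).
      rewrite (big_ord_widen _ (fun j => u i * v j) (leq_subr i N)).
      by apply: eq_bigl => j; rewrite ltn_subRL.
    by apply: eq_bigl => j; rewrite -leqNgt.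
  rewrite addrC addKr.
  apply: le_trans (ler_norm_sum _ _ _) _.
  apply: (@le_trans _ _ (\sum_(i < N) \sum_(j < N) C ^+ 2 * q ^+ N)).
    apply: ler_sum => i _; apply: le_trans (ler_norm_sum _ _ _) _.
    rewrite big_mkcond/=; apply: ler_sum => j _.
    have C2 : 0 <= C ^+ 2 * q ^+ N by rewrite mulr_ge0 ?sqr_ge0 ?exprn_ge0.
    case: ifP => // Nij; rewrite normrM.
    apply: (@le_trans _ _ ((C * q ^+ i) * (C * q ^+ j))); first exact: ler_pM.
    rewrite mulrACA -exprD -expr2.
    by rewrite ler_wpM2l ?sqr_ge0// ler_wiXn2l// ltW.
  rewrite !sumr_const !card_ord -mulr_natl -[_ *+ N]mulr_natl.
  rewrite (_ : _ * _ = C ^+ 2 * (N%:R ^+ 2 * q ^+ N)); last by ring.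
  rewrite ler_wpM2l ?sqr_ge0// ler_wpM2r ?exprn_ge0//.
  by rewrite mulr1 lerXn2r ?nnegrE ?ler_nat.
rewrite -[rsum u * rsum v]subr0.
set d := (fun N => _) in d0.
rewrite (_ : series _ = (fun N => series u N * series v N - d N)).
  exact: cvgB (cvgM cu cv) d0.
by apply/funext => N; rewrite /d subKr.
Qed.

End GeometricBounds.
End RealSeries.

(** * Calculus of the classes C^k *)

Lemma derive_line (R : realType) (V : normedModType R) (f : V -> R) (x v : V) :
  'D_v f x = 'D_1 (fun h : R => f (h *: v + x)) 0.
Proof.
have E : (fun h : R => h^-1 *: ((f \o shift x) (h *: v) - f x)) =
  (fun h : R => h^-1 *: (((fun h : R => f (h *: v + x)) \o shift 0) (h *: 1)
    - f (0 *: v + x))).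
  by apply/funext => h /=; rewrite addr0 scale0r add0r [_%:A]mulr1.
by rewrite /derive E.
Qed.

Section Derivatives.
Variables (R : realType) (V : normedModType R).
Implicit Types (O : set V) (f g : V -> R).

Lemma near_open O (x : V) (P : V -> Prop) : open O -> O x ->
  (forall y, O y -> P y) -> \forall y \near x, P y.
Proof. by move=> oO Ox OP; apply: filterS (open_nbhs_nbhs (conj oO Ox)). Qed.

Lemma continuous_ext O f g x : open O -> (forall y, O y -> f y = g y) -> O x ->
  {for x, continuous f} -> {for x, continuous g}.
Proof.
move=> oO fg Ox cf; rewrite /prop_for /continuous_at -(fg x Ox).
apply: cvg_trans cf; apply: near_eq_cvg; apply: near_open oO Ox _ => y Oy.
by rewrite fg.
Qed.

Lemma is_derive_cvg f x v d :
  h^-1 * (f (h *: v + x) - f x) @[h --> 0^'] --> d -> is_derive x v f d.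
Proof.
move=> h; apply: DeriveDef; first by apply/cvg_ex; exists d.
exact: cvg_lim h.
Qed.

Lemma is_derive_chain (p : R -> R) f x v a d : is_derive (f x) 1 p a ->
  is_derive x v f d -> is_derive x v (p \o f) (a * d).
Proof.
move=> [dp <-] [df <-].
have dl : derivable (fun h : R => f (h *: v + x)) 0 1 by exact: (derivable1P _ _ _).1.
have e0 : f (0 *: v + x) = f x by rewrite scale0r add0r.
have dp' : derivable p (f (0 *: v + x)) 1 by rewrite e0.
apply: DeriveDef.
  apply: (derivable1P _ _ _).2; apply/derivable1_diffP.
  apply: (@differentiable_comp _ _ _ _ (fun h : R => f (h *: v + x)) p).
    exact/derivable1_diffP.
  exact/derivable1_diffP.
rewrite derive_line -derive1E (derive1_comp dl dp') e0 !derive1E.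
by rewrite -derive_line.
Qed.

(** The mean value inequality along a direction; the range of [h] does not depend
on the function. *)
Lemma derive_lipschitz O x v : open O -> O x ->
  \forall h \near (0 : R), O (h *: v + x) /\ forall f M, 0 <= M ->
    (forall y, O y -> derivable f y v /\ `|'D_v f y| <= M) ->
    `|f (h *: v + x) - f x| <= M * `|h|.
Proof.
move=> oO Ox.
have cl : (fun h : R => h *: v + x) @ (0 : R) --> x.
  rewrite -[X in _ --> X]add0r -[X in X + _](scale0r v).
  by apply: cvgD; [apply: cvgZr_tmp; exact: cvg_id|exact: cvg_cst].
have nO : \forall h \near (0 : R), O (h *: v + x).
  by apply: cl; exact: open_nbhs_nbhs.
have [e e0 he] : exists2 e : R, 0 < e & forall h, `|h| < e -> O (h *: v + x).
  move/nbhs_ballP: nO => [e e0 he]; exists e => // h hh; apply: he.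
  by rewrite /ball/= sub0r normrN.
near=> h.
have hh : `|h| < e.
  near: h; apply/nbhs_ballP; exists e => // k.
  by rewrite /ball/= sub0r normrN.
split => [|f M M0 hf]; first exact: he.
pose g k : R := f (k *: v + x).
have dg k : `|k| < e -> derivable g k 1 /\ 'D_1 g k = 'D_v f (k *: v + x).
  move=> /he /hf [df _].
  have E : (fun l : R => f (l *: v + (k *: v + x))) = (fun l : R => g (l + k)).
    by apply/funext => l; rewrite /g scalerDl addrA.
  split; last first.
    rewrite (derive_line f) E derive_line.
    rewrite [X in derive X](_ : _ = (fun l : R => g (l + k)))//.
    by apply/funext => l; rewrite [_%:A]mulr1.
  apply/derivable1P; rewrite [X in derivable X](_ : _ = (fun l : R => g (l + k))).
    by rewrite -E; exact: (derivable1P _ _ _).1.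
  by apply/funext => l; rewrite [_%:A]mulr1.
have key a b : `|a| < e -> `|b| < e -> a <= b -> `|g b - g a| <= M * (b - a).
  move=> ae be ab.
  have inn c : c \in `[a, b]%R -> `|c| < e.
    rewrite in_itv/= => /andP[ac cb]; move: ae be; rewrite !ltr_norml.
    by move=> /andP[h1 h2] /andP[h3 h4]; apply/andP; split; lra.
  have [c cab ->] : exists2 c, c \in `[a, b]%R & g b - g a = 'D_1 g c * (b - a).
    apply: MVT_segment => // [c cab|].
      apply: DeriveDef => //; apply: (dg c _).1; apply: inn.
      by move: cab; rewrite !in_itv/= => /andP[? ?]; rewrite !ltW.
    apply: derivable_within_continuous => c cab; exact: (dg c (inn c cab)).1.
  have ce := inn _ cab.
  rewrite normrM [`|b - a|]ger0_norm ?subr_ge0// ler_wpM2r ?subr_ge0//.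
  by rewrite (dg c ce).2; apply: (hf _ (he _ ce)).2.
have z : `|0 : R| < e by rewrite normr0.
rewrite -{2}(add0r x) -(scale0r v) -/(g 0) -/(g h).
have [h0|h0] := leP 0 h.
  by have := key _ _ z hh h0; rewrite subr0 [`|h|]ger0_norm.
by have := key _ _ hh z (ltW h0); rewrite sub0r distrC [`|h|]ltr0_norm.
Unshelve. all: by end_near. Qed.

End Derivatives.

Section CkClasses.
Variables (R : realType) (V : normedModType R).
Implicit Types (O : set V) (f g : V -> R).

Lemma Ck_ext k O f g : open O -> (forall x, O x -> f x = g x) ->
  Ck_on k O f -> Ck_on k O g.
Proof.
move=> oO; elim: k f g => [|k IH] f g fg [cf hf].
  by split => // x Ox; apply: continuous_ext fg Ox (cf x Ox).
split => [x Ox|v]; first exact: continuous_ext fg Ox (cf x Ox).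
have [df Df] := hf v; split => [x Ox|].
  by apply: near_eq_derivable (df x Ox); apply: near_open oO Ox _ => y /fg.
apply: IH Df => x Ox; apply: near_eq_derive; exact: near_open oO Ox _.
Qed.

Lemma Ck_intro k O f (d : V -> V -> R) : open O ->
  (forall x, O x -> {for x, continuous f}) ->
  (forall v x, O x -> is_derive x v f (d v x)) ->
  (forall v, Ck_on k O (d v)) -> Ck_on k.+1 O f.
Proof.
move=> oO cf df cd; split => // v; split => [x Ox|].
  exact: (@ex_derive _ _ _ _ _ _ _ (df v x Ox)).
apply: Ck_ext (cd v) => // x Ox; symmetry.
exact: (@derive_val _ _ _ _ _ _ _ (df v x Ox)).
Qed.

Lemma Ck_le k O f : Ck_on k.+1 O f -> Ck_on k O f.
Proof.
elim: k f => [|k IH] f [cf hf]; first by split.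
by split => // v; have [df Df] := hf v; split => //; apply: IH.
Qed.

Lemma Ck_is_derive k O f v x : Ck_on k.+1 O f -> O x -> is_derive x v f ('D_v f x).
Proof. by move=> [_ /(_ v)[df _]] Ox; apply: DeriveDef => //; exact: df. Qed.

Lemma Ck_cst k O (c : R) : open O -> Ck_on k O (fun _ : V => c).
Proof.
move=> oO; elim: k c => [|k IH] c; first by split => // x _; exact: cst_continuous.
apply: (@Ck_intro _ _ _ (fun _ _ => 0)) => // x _.
exact: cst_continuous.
Qed.

Lemma Ck_add k O f g : open O -> Ck_on k O f -> Ck_on k O g ->
  Ck_on k O (fun x => f x + g x).
Proof.
move=> oO; elim: k f g => [|k IH] f g Hf Hg.
  by split => // x Ox; apply: continuousD; [apply: Hf.1|apply: Hg.1].
apply: (@Ck_intro _ _ _ (fun v x => 'D_v f x + 'D_v g x)) => // [x Ox|v x Ox|v].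
- by apply: continuousD; [apply: Hf.1|apply: Hg.1].
- by apply: is_deriveD; [exact: Ck_is_derive Hf Ox|exact: Ck_is_derive Hg Ox].
- by apply: IH; [exact: (Hf.2 v).2|exact: (Hg.2 v).2].
Qed.

Lemma Ck_mul k O f g : open O -> Ck_on k O f -> Ck_on k O g ->
  Ck_on k O (fun x => f x * g x).
Proof.
move=> oO; elim: k f g => [|k IH] f g Hf Hg.
  by split => // x Ox; apply: continuousM; [apply: Hf.1|apply: Hg.1].
apply: (@Ck_intro _ _ _ (fun v x => f x * 'D_v g x + g x * 'D_v f x))
    => // [x Ox|v x Ox|v].
- by apply: continuousM; [apply: Hf.1|apply: Hg.1].
- by apply: is_deriveM; [exact: Ck_is_derive Hf Ox|exact: Ck_is_derive Hg Ox].
- apply: Ck_add => //; apply: IH.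
  + exact: Ck_le.
  + exact: (Hg.2 v).2.
  + exact: Ck_le.
  + exact: (Hf.2 v).2.
Qed.

(** Being C^k is a local property. *)
Lemma Ck_local k O f : (forall x, O x -> exists2 W : set V, open W & W x /\ Ck_on k W f) ->
  Ck_on k O f.
Proof.
elim: k f => [|k IH] f h; split => //.
- by move=> x /h[W _ [Wx [cf _]]]; exact: cf.
- by move=> x /h[W _ [Wx [cf _]]]; exact: cf.
- move=> v; split; first by move=> x /h[W _ [Wx [_ /(_ v)[df _]]]]; exact: df.
  apply: IH => x /h[W oW [Wx [_ /(_ v)[_ cf]]]]; by exists W.
Qed.

Lemma smooth_ext O f g : open O -> (forall x, O x -> f x = g x) ->
  smooth_on O f -> smooth_on O g.
Proof. by move=> oO fg h k; apply: Ck_ext (h k). Qed.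

Lemma smooth_cst O (c : R) : open O -> smooth_on O (fun _ : V => c).
Proof. by move=> oO k; apply: Ck_cst. Qed.

Lemma smooth_add O f g : open O -> smooth_on O f -> smooth_on O g ->
  smooth_on O (fun x => f x + g x).
Proof. by move=> oO hf hg k; apply: Ck_add. Qed.

Lemma smooth_mul O f g : open O -> smooth_on O f -> smooth_on O g ->
  smooth_on O (fun x => f x * g x).
Proof. by move=> oO hf hg k; apply: Ck_mul. Qed.

Lemma smooth_opp O f : open O -> smooth_on O f -> smooth_on O (fun x => - f x).
Proof.
move=> oO hf; apply: (@smooth_ext _ (fun x => -1 * f x)) => // [x _|].
  by rewrite mulN1r.
by apply: smooth_mul => //; exact: smooth_cst.
Qed.

Lemma smooth_intro O f (d : V -> V -> R) : open O ->
  (forall x, O x -> {for x, continuous f}) ->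
  (forall v x, O x -> is_derive x v f (d v x)) ->
  (forall v, smooth_on O (d v)) -> smooth_on O f.
Proof.
move=> oO cf df cd [|k]; first by split.
by apply: Ck_intro df _ => // v; apply: cd.
Qed.

Lemma smooth_inv O f : open O -> (forall x, O x -> f x != 0) ->
  smooth_on O f -> smooth_on O (fun x => (f x)^-1).
Proof.
move=> oO f0 hf; elim=> [|k IH].
  by split => // x Ox; apply: continuousV; [exact: f0|exact: (hf 0%N).1].
apply: (@Ck_intro _ _ _ (fun v x => -1 * ((f x)^-1 * (f x)^-1) * 'D_v f x)) => //.
- by move=> x Ox; apply: continuousV; [exact: f0|exact: (hf 0%N).1].
- move=> v x Ox; have D := Ck_is_derive v (hf 1%N) Ox.
  apply: DeriveDef; first by apply: derivableV; [exact: f0|exact: (@ex_derive _ _ _ _ _ _ _ D)].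
  rewrite deriveV; [|exact: f0|exact: (@ex_derive _ _ _ _ _ _ _ D)].
  by rewrite expr2 invfM mulN1r.
- move=> v; apply: Ck_mul => //; last exact: ((hf k.+1).2 v).2.
  by apply: Ck_mul; [|exact: Ck_cst|exact: Ck_mul].
Qed.

Lemma smooth_sqrt O f : open O -> (forall x, O x -> 0 < f x) ->
  smooth_on O f -> smooth_on O (fun x => Num.sqrt (f x)).
Proof.
move=> oO f0 hf.
have cs x : O x -> {for x, continuous (fun x => Num.sqrt (f x))}.
  move=> Ox; apply: (@continuous_comp _ _ _ f Num.sqrt); first exact: (hf 0%N).1.
  exact: sqrt_continuous.
elim=> [|k IH]; first by split.
have s0 x : O x -> Num.sqrt (f x) != 0 by move=> /f0; rewrite -sqrtr_gt0 lt0r => /andP[].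
apply: (@Ck_intro _ _ _ (fun v x => 2^-1 * (Num.sqrt (f x) * (f x)^-1) * 'D_v f x)) => //.
- move=> v x Ox; have D := Ck_is_derive v (hf 1%N) Ox.
  have := is_derive_chain (is_derive1_sqrt (f0 x Ox)) D.
  rewrite (_ : (2 * _)^-1 = 2^-1 * (Num.sqrt (f x) * (f x)^-1))//.
  have := sqr_sqrtr (ltW (f0 x Ox)); have := s0 x Ox.
  by move: (Num.sqrt (f x)) => r r0 <-; field.
- move=> v; apply: Ck_mul => //; last exact: ((hf k.+1).2 v).2.
  apply: Ck_mul => //; first exact: Ck_cst.
  apply: Ck_mul => //; apply: smooth_inv => // x /f0.
  by rewrite lt0r => /andP[].
Qed.

End CkClasses.

(** * Quantitative classes C^k and series of functions *)

Section CkBounded.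
Variables (R : realType) (V : normedModType R).
Implicit Types (O : set V) (f g : V -> R).

(** On [O], the derivatives of order [j <= k] of [f] are bounded by
[K * L ^ j]; in this form the constants of a product are [K * K'] and
[L + L'], so those of a long product stay under control. *)
Fixpoint CkB (k : nat) O f (K L : R) : Prop :=
  (forall x, O x -> {for x, continuous f} /\ `|f x| <= K) /\
  match k with
  | 0 => True
  | k'.+1 => forall v : V,
      (forall x, O x -> derivable f x v) /\ CkB k' O ('D_v f) (K * L * `|v|) L
  end.

Lemma CkB_Ck k O f K L : CkB k O f K L -> Ck_on k O f.
Proof.
elim: k f K => [|k IH] f K [bf hf]; first by split => // x /bf[].
split => [x /bf[]//|v]; have [df Df] := hf v; split => //; exact: IH Df.
Qed.

Lemma CkB_bound k O f K L x : CkB k O f K L -> O x -> `|f x| <= K.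
Proof. by case: k => [|k] [bf _] /bf[]. Qed.

Lemma CkB_cont k O f K L x : CkB k O f K L -> O x -> {for x, continuous f}.
Proof. by case: k => [|k] [bf _] /bf[]. Qed.

Lemma CkB_ext k O f g K L : open O -> (forall x, O x -> f x = g x) ->
  CkB k O f K L -> CkB k O g K L.
Proof.
move=> oO; elim: k f g K => [|k IH] f g K fg [bf hf].
  split => // x Ox; rewrite -fg//; split; last exact: (bf x Ox).2.
  exact: continuous_ext fg Ox (bf x Ox).1.
split => [x Ox|v].
  rewrite -fg//; split; last exact: (bf x Ox).2.
  exact: continuous_ext fg Ox (bf x Ox).1.
have [df Df] := hf v; split => [x Ox|].
  by apply: near_eq_derivable (df x Ox); apply: near_open oO Ox _ => y /fg.
apply: IH Df => x Ox; apply: near_eq_derive; exact: near_open oO Ox _.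
Qed.

Lemma CkB_intro k O f (d : V -> V -> R) K L : open O ->
  (forall x, O x -> {for x, continuous f}) -> (forall x, O x -> `|f x| <= K) ->
  (forall v x, O x -> is_derive x v f (d v x)) ->
  (forall v, CkB k O (d v) (K * L * `|v|) L) -> CkB k.+1 O f K L.
Proof.
move=> oO cf bf df cd; split => [x Ox|v]; first by split; [exact: cf|exact: bf].
split => [x Ox|].
  exact: (@ex_derive _ _ _ _ _ _ _ (df v x Ox)).
apply: CkB_ext (cd v) => // x Ox; symmetry.
exact: (@derive_val _ _ _ _ _ _ _ (df v x Ox)).
Qed.

Lemma CkB_mono k O f K L K' L' : 0 <= K -> 0 <= L -> K <= K' -> L <= L' ->
  CkB k O f K L -> CkB k O f K' L'.
Proof.
elim: k f K K' => [|k IH] f K K' K0 L0 KK LL [bf hf].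
  by split => // x /bf[cf fK]; split => //; exact: le_trans KK.
split => [x /bf[cf fK]|v]; first by split => //; exact: le_trans KK.
have [df Df] := hf v; split => //; apply: IH Df => //.
  by rewrite !mulr_ge0.
by rewrite ler_wpM2r// ler_pM.
Qed.

Lemma CkB_le k O f K L : CkB k.+1 O f K L -> CkB k O f K L.
Proof.
elim: k f K => [|k IH] f K [bf hf]; first by split.
by split => // v; have [df Df] := hf v; split => //; apply: IH.
Qed.

Lemma CkB_is_derive k O f K L v x : CkB k.+1 O f K L -> O x ->
  is_derive x v f ('D_v f x).
Proof. by move=> [_ /(_ v)[df _]] Ox; apply: DeriveDef => //; exact: df. Qed.

Lemma CkB_cst k O (c : R) K L : open O -> `|c| <= K -> 0 <= L ->
  CkB k O (fun _ : V => c) K L.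
Proof.
move=> oO + L0; elim: k c K => [|k IH] c K cK.
  by split => // x _; split => //; exact: cst_continuous.
apply: (@CkB_intro _ _ _ (fun _ _ => 0)) => // [x _|v].
  exact: cst_continuous.
apply: IH; rewrite normr0 !mulr_ge0//; exact: le_trans (normr_ge0 _) cK.
Qed.

Lemma CkB_add k O f g K K' L : open O -> CkB k O f K L -> CkB k O g K' L ->
  CkB k O (fun x => f x + g x) (K + K') L.
Proof.
move=> oO; elim: k f g K K' => [|k IH] f g K K' Hf Hg.
  split => // x Ox; split.
    by apply: continuousD; [exact: CkB_cont Hf Ox|exact: CkB_cont Hg Ox].
  by apply: le_trans (ler_normD _ _) _; rewrite lerD//;
    [exact: CkB_bound Hf Ox|exact: CkB_bound Hg Ox].
apply: (@CkB_intro _ _ _ (fun v x => 'D_v f x + 'D_v g x)) => // [x Ox|x Ox|v x Ox|v].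
- by apply: continuousD; [exact: CkB_cont Hf Ox|exact: CkB_cont Hg Ox].
- by apply: le_trans (ler_normD _ _) _; rewrite lerD//;
    [exact: CkB_bound Hf Ox|exact: CkB_bound Hg Ox].
- by apply: is_deriveD; [exact: CkB_is_derive Hf Ox|exact: CkB_is_derive Hg Ox].
- rewrite !mulrDl; apply: IH; [exact: (Hf.2 v).2|exact: (Hg.2 v).2].
Qed.

Lemma CkB_mul k O f g K K' L L' : open O -> 0 <= K -> 0 <= K' -> 0 <= L -> 0 <= L' ->
  CkB k O f K L -> CkB k O g K' L' ->
  CkB k O (fun x => f x * g x) (K * K') (L + L').
Proof.
move=> oO; elim: k f g K K' L L' => [|k IH] f g K K' L L' K0 K0' L0 L0' Hf Hg.
  split => // x Ox; split.
    by apply: continuousM; [exact: CkB_cont Hf Ox|exact: CkB_cont Hg Ox].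
  by rewrite normrM ler_pM//; [exact: CkB_bound Hf Ox|exact: CkB_bound Hg Ox].
apply: (@CkB_intro _ _ _ (fun v x => f x * 'D_v g x + 'D_v f x * g x))
    => // [x Ox|x Ox|v x Ox|v].
- by apply: continuousM; [exact: CkB_cont Hf Ox|exact: CkB_cont Hg Ox].
- by rewrite normrM ler_pM//; [exact: CkB_bound Hf Ox|exact: CkB_bound Hg Ox].
- rewrite [X in _ + X]mulrC.
  by apply: is_deriveM; [exact: CkB_is_derive Hf Ox|exact: CkB_is_derive Hg Ox].
- rewrite (_ : _ * `|v| = K * (K' * L' * `|v|) + (K * L * `|v|) * K'); last by ring.
  apply: CkB_add => //; apply: IH; rewrite ?mulr_ge0//.
  + exact: CkB_le.
  + exact: (Hg.2 v).2.
  + exact: (Hf.2 v).2.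
  + exact: CkB_le.
Qed.

Lemma CkB_scale k O f c K L : open O -> 0 <= K -> 0 <= L -> CkB k O f K L ->
  CkB k O (fun x => c * f x) (`|c| * K) L.
Proof.
move=> oO K0 L0 Hf; rewrite -[L]add0r.
by apply: CkB_mul => //; exact: CkB_cst.
Qed.

Lemma CkB_opp k O f K L : open O -> 0 <= K -> 0 <= L -> CkB k O f K L ->
  CkB k O (fun x => - f x) K L.
Proof.
move=> oO K0 L0 Hf; have := CkB_scale (-1) oO K0 L0 Hf.
by rewrite normrN1 mul1r; apply: CkB_ext => // x _; rewrite mulN1r.
Qed.

Lemma CkB_sum k O (I : Type) (r : seq I) (F : I -> V -> R) (K : I -> R) L :
  open O -> 0 <= L -> (forall i, CkB k O (F i) (K i) L) ->
  CkB k O (fun x => \sum_(i <- r) F i x) (\sum_(i <- r) K i) L.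
Proof.
move=> oO L0 hF; elim: r => [|i r IH].
  rewrite big_nil; apply: (@CkB_ext _ _ (fun _ => 0)) => //.
    by move=> x _; rewrite big_nil.
  by apply: CkB_cst => //; rewrite normr0.
rewrite big_cons; apply: (@CkB_ext _ _ (fun x => F i x + \sum_(j <- r) F j x)) => //.
  by move=> x _; rewrite big_cons.
exact: CkB_add.
Qed.

(** Term by term differentiation of a series. *)
Lemma Ck_series k O (f : nat -> V -> R) (K L : nat -> R) : open O ->
  (forall n, 0 <= K n) -> (forall n, 0 <= L n) ->
  (forall n, CkB k O (f n) (K n) (L n)) ->
  (forall m, cvgn (series (fun n => K n * L n ^+ m))) ->
  Ck_on k O (fun x => rsum (f ^~ x)).
Proof.
move=> oO; elim: k f K => [|k IH] f K K0 L0 hf cK.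
all: have dom x : O x -> dominated (f ^~ x) K.
1,3: by move=> Ox; split => [n|]; [exact: CkB_bound (hf n) Ox|];
  rewrite (_ : K = (fun n => K n * L n ^+ 0)) //; apply/funext => n;
  rewrite expr0 mulr1.
all: have cf x : O x -> {for x, continuous (fun x => rsum (f ^~ x))}.
1,3: move=> Ox; apply: (rsum_cvg (M := K)); [by move=> n; exact: CkB_cont (hf n) Ox|
  exact: dom|by apply: near_open oO Ox _ => y Oy n; exact: CkB_bound (hf n) Oy].
  by [].
apply: (@Ck_intro _ _ _ _ _ (fun v x => rsum (fun n => 'D_v (f n) x))) => // [v x Ox|v].
  apply: is_derive_cvg.
  have dD : dominated (fun n => 'D_v (f n) x) (fun n => K n * L n * `|v|).
    split => [n|]; first exact: CkB_bound ((hf n).2 v).2 Ox.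
    rewrite (_ : (fun n => K n * L n * `|v|) = `|v| *: (fun n => K n * L n ^+ 1)).
      exact: is_cvg_seriesZ.
    by apply/funext => n; rewrite mulrC.
  have nl := derive_lipschitz v oO Ox.
  have : rsum (fun n => h^-1 * (f n (h *: v + x) - f n x)) @[h --> 0^'] -->
      rsum (fun n => 'D_v (f n) x).
    apply: (@rsum_cvg _ _ _ (fun n h => h^-1 * (f n (h *: v + x) - f n x)) _
      (fun n => K n * L n * `|v|)) => // [n|].
      exact: ((hf n).2 v).1 x Ox.
    near=> h => n; have h0 : h != 0 by near: h; exact: nbhs_dnbhs_neq.
    have [_ hl] : O (h *: v + x) /\ forall f M, 0 <= M ->
        (forall y, O y -> derivable f y v /\ `|'D_v f y| <= M) ->
        `|f (h *: v + x) - f x| <= M * `|h|.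
      by near: h; exact: nbhs_dnbhs.
    rewrite normrM normfV mulrC ler_pdivrMr ?normr_gt0//.
    apply: hl => [|y Oy]; first by rewrite !mulr_ge0.
    split; [exact: ((hf n).2 v).1|exact: CkB_bound ((hf n).2 v).2 Oy].
  apply: cvg_trans; apply: near_eq_cvg; near=> h.
  have [Oh _] : O (h *: v + x) /\ forall f M, 0 <= M ->
      (forall y, O y -> derivable f y v /\ `|'D_v f y| <= M) ->
      `|f (h *: v + x) - f x| <= M * `|h|.
    by near: h; exact: nbhs_dnbhs.
  have d1 := dom _ Oh; have d2 := dominatedZ (-1) (dom _ Ox).
  rewrite -[- rsum _]mulN1r -(rsumZ (-1) (dom _ Ox)) -(rsumD d1 d2).
  rewrite -(rsumZ h^-1 (dominatedD d1 d2)).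
  by congr rsum; apply/funext => n; rewrite mulN1r.
apply: (IH _ (fun n => K n * L n * `|v|)) => // [n|n|m].
- by rewrite !mulr_ge0.
- exact: ((hf n).2 v).2.
- rewrite (_ : (fun n => _) = `|v| *: (fun n => K n * L n ^+ m.+1)).
    exact: is_cvg_seriesZ.
  apply/funext => n; transitivity (`|v| * (K n * L n ^+ m.+1)) => //.
  by rewrite exprS; ring.
Unshelve. all: by end_near. Qed.

End CkBounded.

Section CkBoundedFamilies.
Variables (R : realType) (V : normedModType R).
Implicit Types (O : set V) (f g : V -> R).

Lemma harm_le (i : nat) : 0 <= harm R i <= i%:R.
Proof.
rewrite /harm; apply/andP; split; first by apply: sumr_ge0 => j _; rewrite invr_ge0.
rewrite -[X in _ <= X%:R]subn0 -subSS -[X in _ <= X]mulr1 mulr_natl -sumr_const_nat.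
rewrite !big_nat; apply: ler_sum => j /andP[j0 _]; rewrite invf_le1 ?ltr0n//.
by rewrite ler1n.
Qed.

Lemma phic_le (i : nat) : (0 < i)%N -> 0 <= phic R i /\ i%:R ^+ 2 * phic R i <= 1.
Proof.
case: i => // i _; have h : 0 <= phic R i by rewrite /phic invr_ge0 sqr_ge0.
split; first by rewrite /phic invr_ge0 sqr_ge0.
rewrite mulrC phicS /phic invf_le1 ?exprn_gt0 ?ltr0n ?fact_gt0//.
by rewrite exprn_ege1// ler1n fact_gt0.
Qed.

Lemma ell_le r c i : (0 < i)%N -> `|ell R r c i 0%N| <= 2.
Proof.
move=> i0; have [p0 p1] := phic_le i0; have /andP[h0 h1] := harm_le i.
have i1 : 1 <= i%:R :> R by rewrite ler1n.
have q1 : phic R i <= 1 by apply: le_trans p1; rewrite ler_peMl// exprn_ege1.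
have q2 : i%:R * phic R i <= 1.
  by apply: le_trans p1; rewrite ler_wpM2r// expr2 ler_peMl//; lra.
have q3 : harm R i * phic R i <= 1.
  by apply: le_trans q2; rewrite ler_wpM2r.
have q4 : i%:R * (harm R i * phic R i) <= 1.
  apply: le_trans p1; rewrite expr2 -mulrA; rewrite ler_wpM2l//.
  by rewrite ler_wpM2r.
have q5 : 0 <= harm R i * phic R i by rewrite mulr_ge0.
have q6 : 0 <= i%:R * (harm R i * phic R i) by rewrite mulr_ge0.
have q7 : 0 <= i%:R * phic R i by rewrite mulr_ge0.
move: r c; apply: ord2P; apply: ord2P; rewrite /ell mx2E ?dx_xser ?fpsD /phi /psi /xser/=.
- by rewrite ger0_norm//; lra.
- by rewrite -mulr_natl ger0_norm//; lra.
- by rewrite /psic normrN -mulrA ger0_norm ?mulr_ge0//; lra.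
- rewrite /psic -mulr_natl (_ : _ + _ = phic R i - 2 * (i%:R * (harm R i * phic R i))).
    by rewrite ler_norml; apply/andP; split; lra.
  ring.
Qed.

Lemma CkB_aser k O (S : V -> R) s1 L r c i : open O -> 1 <= s1 -> 0 <= L ->
  CkB k O S s1 L -> CkB k O (fun x => (S x)^-1) 1 L ->
  CkB k O (fun x => aser (S x) r c i 0%N) (8 * s1) L.
Proof.
move=> oO s11 L0 HS HV; case: i => [|i].
  apply: (@CkB_ext _ _ _ _ (fun _ => (r == c)%:R)) => // [x _|].
    by rewrite aser00.
  by apply: CkB_cst => //; case: (r == c); rewrite ?normr1 ?normr0; lra.
have l2 r' c' : `|ell R r' c' i.+1 0%N| <= 2 by exact: ell_le.
have Cl r' c' : CkB k O (fun _ => ell R r' c' i.+1 0%N) 2 L by exact: CkB_cst.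
have Cv r' c' : CkB k O (fun x => (S x)^-1 * ell R r' c' i.+1 0%N) (1 * 2) L.
  by rewrite -[L]addr0; apply: CkB_mul => //; exact: CkB_cst.
have Cs r' c' : CkB k O (fun x => S x * ell R r' c' i.+1 0%N) (s1 * 2) L.
  by rewrite -[L]addr0; apply: CkB_mul => //; try lra; exact: CkB_cst.
have Co f K : 0 <= K -> CkB k O f K L -> CkB k O (fun x => - f x) K L.
  by move=> *; apply: CkB_opp.
move: r c; apply: ord2P; apply: ord2P.
- apply: (@CkB_ext _ _ _ _ (fun x => ell R 0 0 i.+1 0%N - (S x)^-1 * ell R 1 0 i.+1 0%N)) => //.
    by move=> x _; rewrite [in RHS]/aser [in RHS]mx2E !fpsD !fpsN cst2M.
  apply: (@CkB_mono _ _ _ _ _ (2 + 1 * 2) L) => //; try lra.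
  by apply: CkB_add => //; apply: Co => //; lra.
- apply: (@CkB_ext _ _ _ _ (fun x => ell R 0 0 i.+1 0%N - (S x)^-1 * ell R 1 0 i.+1 0%N
      + S x * ell R 0 1 i.+1 0%N - ell R 1 1 i.+1 0%N)) => //.
    by move=> x _; rewrite [in RHS]/aser [in RHS]mx2E !fpsD !fpsN !cst2M.
  apply: (@CkB_mono _ _ _ _ _ (2 + 1 * 2 + s1 * 2 + 2) L) => //; try lra.
  apply: CkB_add => //; last by apply: Co.
  apply: CkB_add => //; apply: CkB_add => //; apply: Co => //; lra.
- apply: (@CkB_ext _ _ _ _ (fun x => (S x)^-1 * ell R 1 0 i.+1 0%N)) => //.
    by move=> x _; rewrite [in RHS]/aser [in RHS]mx2E cst2M.
  by apply: (@CkB_mono _ _ _ _ _ (1 * 2) L) => //; lra.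
- apply: (@CkB_ext _ _ _ _ (fun x => (S x)^-1 * ell R 1 0 i.+1 0%N + ell R 1 1 i.+1 0%N)) => //.
    by move=> x _; rewrite [in RHS]/aser [in RHS]mx2E !fpsD cst2M.
  apply: (@CkB_mono _ _ _ _ _ (1 * 2 + 2) L) => //; try lra.
  by apply: CkB_add.
Qed.

Lemma CkB_Sser k O (S : V -> R) s1 L r c i j : open O -> 1 <= s1 -> 0 <= L ->
  CkB k O S s1 L -> CkB k O (fun x => (S x)^-1) 1 L -> (0 < i + j)%N ->
  CkB k O (fun x => Sser (S x) r c i j) ((128 * s1 ^+ 2) ^+ (i + j))
    ((i + j)%:R * (2 * L)).
Proof.
move=> oO s11 L0 HS HV ij.
have A r' c' i' := CkB_aser r' c' i' oO s11 L0 HS HV.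
have e0 : `|sgn_mx R r r 0%N 0%N| = 1.
  by move: {A} r; apply: ord2P; rewrite /sgn_mx mx2E ?fpsN ?ps2_1/= ?normrN normr1.
have s8 : 0 <= 8 * s1 by lra.
have k1 : 1 <= 128 * s1 ^+ 2 by nra.
have n1 : 1 <= (i + j)%:R :> R by rewrite ler1n.
apply: (@CkB_ext _ _ _ _ (fun x => sgn_mx R r r 0%N 0%N *
   (aser (S x) 0 r j 0%N * aser (S x) 0 c i 0%N
    + - (aser (S x) 1 r j 0%N * aser (S x) 1 c i 0%N)))) => //.
  by move=> x _; rewrite SserE.
apply: (@CkB_mono _ _ _ _ _ (1 * ((8 * s1) * (8 * s1) + (8 * s1) * (8 * s1))) (L + L)).
- by rewrite mul1r addr_ge0// mulr_ge0.
- by rewrite addr_ge0.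
- apply: (@le_trans _ _ (128 * s1 ^+ 2)); first by rewrite le_eqVlt; apply/orP; left; apply/eqP; ring.
  by rewrite -[leLHS]expr1 ler_weXn2l.
- by nra.
rewrite -[X in CkB _ _ _ (X * _) _]e0; apply: CkB_scale => //.
- by rewrite addr_ge0// mulr_ge0.
- by rewrite addr_ge0.
apply: CkB_add => //; first exact: CkB_mul.
by apply: CkB_opp => //; [rewrite mulr_ge0|rewrite addr_ge0|exact: CkB_mul].
Qed.

Lemma geo8_le N : \sum_(k < N) (8^-1 : R) ^+ k <= 8 / 7.
Proof.
suff : \sum_(k < N) (8^-1 : R) ^+ k = 8 / 7 - 8 / 7 * 8^-1 ^+ N.
  by move=> ->; rewrite gerBl mulr_ge0// exprn_ge0.
elim: N => [|N IH]; first by rewrite big_ord0 expr0 mulr1 subrr.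
by rewrite big_ord_recr/= IH exprS; lra.
Qed.

Lemma birkhoff_majorant (K : R) i j : 0 <= K -> (0 < i + j)%N ->
  2 * (\sum_(k < i.+1) \sum_(l < j.+1)
    (if (k + l == 0)%N then 0 else K ^+ (k + l) * (8 * K) ^+ (i - k + (j - l)))) <=
  (8 * K) ^+ (i + j).
Proof.
move=> K0 ij.
have D : 0 <= (8 * K) ^+ (i + j) by rewrite exprn_ge0// mulr_ge0.
have e : \sum_(k < i.+1) \sum_(l < j.+1)
    (if (k + l == 0)%N then 0 else K ^+ (k + l) * (8 * K) ^+ (i - k + (j - l))) =
  (8 * K) ^+ (i + j) *
  ((\sum_(k < i.+1) (8^-1 : R) ^+ k) * (\sum_(l < j.+1) (8^-1 : R) ^+ l) - 1).
  have t (k : 'I_i.+1) (l : 'I_j.+1) :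
      (if (k + l == 0)%N then 0 else K ^+ (k + l) * (8 * K) ^+ (i - k + (j - l))) =
      (8 * K) ^+ (i + j) * (8^-1 ^+ k * 8^-1 ^+ l) -
      (if (k + l == 0)%N then (8 * K) ^+ (i + j) else 0).
    case: k l => k /= hk [l /= hl]; case: eqP => [/eqP|_].
      rewrite addn_eq0 => /andP[/eqP -> /eqP ->].
      by rewrite !expr0 !mulr1 subrr.
    have -> : (i + j = (k + l) + (i - k + (j - l)))%N by lia.
    have a : (8 * K) ^+ (k + l) * (8^-1 ^+ k * 8^-1 ^+ l) = K ^+ (k + l).
      by rewrite -exprD -exprMn mulrAC divff ?mul1r.
    by rewrite subr0 (exprD (8 * K) (k + l)) mulrAC a.
  under eq_bigr do under eq_bigr do rewrite t.
  under eq_bigr do rewrite sumrB -mulr_sumr -mulr_sumr.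
  rewrite sumrB -mulr_sumr -mulr_suml mulrBr mulr1; congr (_ - _).
  rewrite big_ord_recl [X in _ + X]big1 ?addr0; last by move=> k _; rewrite big1.
  by rewrite big_ord_recl big1 ?addr0.
rewrite e mulrCA -[leRHS]mulr1 ler_wpM2l//.
have h1 := geo8_le i.+1; have h2 := geo8_le j.+1.
have p1 : 0 <= \sum_(k < i.+1) (8^-1 : R) ^+ k.
  by apply: sumr_ge0 => k _; rewrite exprn_ge0.
have p2 : 0 <= \sum_(k < j.+1) (8^-1 : R) ^+ k.
  by apply: sumr_ge0 => k _; rewrite exprn_ge0.
have := ler_pM p1 p2 h1 h2; lra.
Qed.

Lemma PserE (s : R) r c i j : Pser s r c i j =
  ((r == c) && (i == 0%N) && (j == 0%N))%:R -
  (if (i.*2 + r <= j.*2 + c)%N then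
    \sum_m \sum_(k < i.+1) \sum_(l < j.+1)
      Sser s r m k l * Pser s m c (i - k)%N (j - l)%N else 0).
Proof. exact/birkhoffE/herm_pert00/gser00. Qed.

Lemma CkB_Pser k O (S : V -> R) s1 L r c i j : open O -> 1 <= s1 -> 0 <= L ->
  CkB k O S s1 L -> CkB k O (fun x => (S x)^-1) 1 L ->
  CkB k O (fun x => Pser (S x) r c i j) ((8 * (128 * s1 ^+ 2)) ^+ (i + j))
    ((i + j)%:R * (2 * L)).
Proof.
move=> oO s11 L0 HS HV.
have [n] := ubnP (i + j); elim: n => // n IH in r c i j *; rewrite ltnS => ijn.
set K := 128 * s1 ^+ 2; have K0 : 0 <= K by rewrite /K mulr_ge0// sqr_ge0.
have K8 m : 0 <= (8 * K) ^+ m by rewrite exprn_ge0// mulr_ge0.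
have Ln m : 0 <= m%:R * (2 * L) by rewrite !mulr_ge0.
have S00 s r' c' : Sser s r' c' 0%N 0%N = 0 by exact/herm_pert00/gser00.
have [/eqP|ij0] := posnP (i + j)%N.
  rewrite addn_eq0 => /andP[/eqP -> /eqP ->].
  apply: (@CkB_ext _ _ _ _ (fun _ => (r == c)%:R)) => // [x _|].
    rewrite PserE !eqxx !andbT big1 ?if_same ?subr0// => m _.
    by rewrite !big_ord1/= S00 mul0r.
  by apply: CkB_cst => //; case: (r == c); rewrite ?normr1 ?normr0.
apply: (@CkB_ext _ _ _ _ (fun x =>
  - (if (i.*2 + r <= j.*2 + c)%N then
    \sum_m \sum_(k < i.+1) \sum_(l < j.+1)
      Sser (S x) r m k l * Pser (S x) m c (i - k)%N (j - l)%N else 0))) => //.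
  move=> x _; rewrite [RHS]PserE (_ : (r == c) && (i == 0%N) && (j == 0%N) = false).
    by rewrite sub0r.
  by apply/negP => /andP[/andP[_ /eqP i0] /eqP j0]; move: ij0; rewrite i0 j0.
apply: CkB_opp => //; case: (i.*2 + r <= j.*2 + c)%N; last by apply: CkB_cst => //; rewrite normr0.
have M0 (k' l' : nat) : 0 <= (if (k' + l' == 0)%N then 0 else
    K ^+ (k' + l') * (8 * K) ^+ (i - k' + (j - l'))).
  by case: ifP => // _; rewrite mulr_ge0// exprn_ge0.
apply: CkB_mono (birkhoff_majorant K0 ij0) (lexx _) _ => //.
  by rewrite mulr_ge0//; do 2 (apply: sumr_ge0 => ? _).
have -> : 2 * (\sum_(k < i.+1) \sum_(l < j.+1)
    (if (k + l == 0)%N then 0 else K ^+ (k + l) * (8 * K) ^+ (i - k + (j - l)))) =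
  \sum_(m : 'I_2) (\sum_(k < i.+1) \sum_(l < j.+1)
    (if (k + l == 0)%N then 0 else K ^+ (k + l) * (8 * K) ^+ (i - k + (j - l)))).
  by rewrite sumr_const card_ord mulr_natl.
apply: CkB_sum => // m; apply: CkB_sum => // -[k' /= hk]; apply: CkB_sum => // -[l' /= hl].
case: eqP => [/eqP|/eqP]; rewrite -?lt0n => kl.
  move: kl; rewrite addn_eq0 => /andP[/eqP -> /eqP ->].
  apply: (@CkB_ext _ _ _ _ (fun _ => 0)) => // [x _|]; first by rewrite S00 mul0r.
  by apply: CkB_cst => //; rewrite normr0.
rewrite (_ : (i + j)%:R * (2 * L) = (k' + l')%:R * (2 * L)
    + (i - k' + (j - l'))%:R * (2 * L)).
  apply: CkB_mul => //; first exact: exprn_ge0.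
    exact: CkB_Sser.
  by apply: IH; lia.
by rewrite -mulrDl -natrD; congr (_%:R * _); lia.
Qed.

End CkBoundedFamilies.

Section PserBound.
Variable R : realType.

Lemma Pser_le (s : R) r c i j : 1 <= s ->
  `|Pser s r c i j| <= (1024 * s ^+ 2) ^+ (i + j).
Proof.
move=> s1.
have h : CkB 0 [set: R] (fun _ => Pser s r c i j) ((8 * (128 * s ^+ 2)) ^+ (i + j))
    ((i + j)%:R * (2 * 0)).
  apply: (CkB_Pser (S := fun _ => s)) => //; first exact: openT.
    by apply: CkB_cst => //; [exact: openT|rewrite ger0_norm//; lra].
  apply: CkB_cst => //; first exact: openT.
  by rewrite ger0_norm ?invr_ge0 ?invf_le1; lra.
have := CkB_bound h (I : [set: R] 0).
by rewrite mulrA (_ : 8 * 128 = 1024)//; lra.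
Qed.

End PserBound.

(** * Evaluation of power series at conjugate points *)

Import Normc.

Section ComplexSeries.
Variable R : realType.
Local Notation C := R[i].
Implicit Types (u v : nat -> C) (z w : C).
Local Notation Re := (@complex.Re R).
Local Notation Im := (@complex.Im R).

Definition csum u : C := rsum (fun n => Re (u n)) +i* rsum (fun n => Im (u n)).

Lemma Re_mul z w : Re (z * w) = Re z * Re w - Im z * Im w.
Proof. by case: z => a b; case: w => c d. Qed.

Lemma Im_mul z w : Im (z * w) = Re z * Im w + Im z * Re w.
Proof. by case: z => a b; case: w => c d. Qed.

Lemma Re_add z w : Re (z + w) = Re z + Re w.
Proof. by case: z => a b; case: w. Qed.

Lemma Im_add z w : Im (z + w) = Im z + Im w.
Proof. by case: z => a b; case: w. Qed.

Lemma Re_bigsum (I : Type) (r : seq I) (P : pred I) (F : I -> C) :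
  Re (\sum_(i <- r | P i) F i) = \sum_(i <- r | P i) Re (F i).
Proof. by elim/big_rec2: _ => // i x y _ <-; rewrite Re_add. Qed.

Lemma Im_bigsum (I : Type) (r : seq I) (P : pred I) (F : I -> C) :
  Im (\sum_(i <- r | P i) F i) = \sum_(i <- r | P i) Im (F i).
Proof. by elim/big_rec2: _ => // i x y _ <-; rewrite Im_add. Qed.

Lemma Re_le_normc z : `|Re z| <= normc z.
Proof.
case: z => a b; rewrite /normc/= -sqrtr_sqr ler_wsqrtr// lerDl sqr_ge0//.
Qed.

Lemma Im_le_normc z : `|Im z| <= normc z.
Proof.
case: z => a b; rewrite /normc/= -sqrtr_sqr ler_wsqrtr// lerDr sqr_ge0//.
Qed.

Lemma normc_ge0 z : 0 <= normc z.
Proof. by case: z => a b; rewrite /normc sqrtr_ge0. Qed.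

Lemma normcX z n : normc (z ^+ n) = normc z ^+ n.
Proof. by elim: n => [|n IH]; rewrite ?expr0 ?normc1// !exprS normcM IH. Qed.

Lemma normc_real (x : R) : normc (x%:C) = `|x|.
Proof. by rewrite /normc/= expr0n/= addr0 sqrtr_sqr. Qed.

Lemma normc_conj z : normc (conjc z) = normc z.
Proof. by case: z => a b; rewrite /normc/= sqrrN. Qed.

Lemma normcE' z : `|z| = (normc z)%:C. Proof. by []. Qed.

Lemma le_normc_sum (I : Type) (r : seq I) (P : pred I) (F : I -> C) :
  normc (\sum_(i <- r | P i) F i) <= \sum_(i <- r | P i) normc (F i).
Proof.
elim/big_rec2: _ => [|i x y _ h]; first by rewrite normc0.
by apply: le_trans (le_normcD _ _) _; rewrite lerD2l.
Qed.

Lemma normc_le_ReIm z : normc z <= `|Re z| + `|Im z|.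
Proof.
case: z => a b /=; rewrite -[leRHS]ger0_norm ?addr_ge0// -sqrtr_sqr ler_wsqrtr//.
rewrite -(real_normK (num_real a)) -(real_normK (num_real b)).
have := normr_ge0 a; have := normr_ge0 b; nra.
Qed.

Definition cdominated u (M : nat -> R) :=
  (forall n, normc (u n) <= M n) /\ cvgn (series M).

Lemma cdominated_Re u M : cdominated u M -> dominated (fun n => Re (u n)) M.
Proof. by move=> [h c]; split => // n; exact: le_trans (Re_le_normc _) (h n). Qed.

Lemma cdominated_Im u M : cdominated u M -> dominated (fun n => Im (u n)) M.
Proof. by move=> [h c]; split => // n; exact: le_trans (Im_le_normc _) (h n). Qed.

Lemma csumD u v M N : cdominated u M -> cdominated v N ->
  csum (fun n => u n + v n) = csum u + csum v.
Proof.
move=> hu hv; rewrite /csum.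
under [X in rsum X]eq_fun do rewrite Re_add.
under [X in _ +i* rsum X]eq_fun do rewrite Im_add.
rewrite (rsumD (cdominated_Re hu) (cdominated_Re hv)).
by rewrite (rsumD (cdominated_Im hu) (cdominated_Im hv)).
Qed.

Lemma csumZ z u M : cdominated u M -> csum (fun n => z * u n) = z * csum u.
Proof.
move=> hu; have hr := cdominated_Re hu; have hi := cdominated_Im hu.
rewrite /csum; apply/eqP; rewrite eq_complex/= Re_mul Im_mul/=.
under [X in rsum X]eq_fun do rewrite Re_mul -mulNr.
under [X in _ && (rsum X == _)]eq_fun do rewrite Im_mul.
rewrite (rsumD (dominatedZ _ hr) (dominatedZ _ hi)).
rewrite (rsumD (dominatedZ _ hi) (dominatedZ _ hr)).
by rewrite (rsumZ _ hr) (rsumZ _ hi) (rsumZ _ hi) (rsumZ _ hr) mulNr !eqxx.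
Qed.

Lemma csumN u M : cdominated u M -> csum (fun n => - u n) = - csum u.
Proof.
by move=> hu; rewrite -mulN1r -(csumZ _ hu); congr csum; apply/funext => n; rewrite mulN1r.
Qed.

Lemma csum_conj u M : cdominated u M -> csum (fun n => conjc (u n)) = conjc (csum u).
Proof.
move=> hu; rewrite /csum/= -(rsumN (cdominated_Im hu)).
by congr (rsum _ +i* rsum _); apply/funext => n; case: (u n).
Qed.

Lemma csum_conv u v (D q : R) : 0 <= q < 1 ->
  (forall n, normc (u n) <= D * q ^+ n) -> (forall n, normc (v n) <= D * q ^+ n) ->
  csum (fun n => \sum_(i < n.+1) u i * v (n - i)%N) = csum u * csum v.
Proof.
move=> q01 hu hv; have D0 : 0 <= D.
  by have := le_trans (normc_ge0 _) (hu 0%N); rewrite expr0 mulr1.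
have dg := @cvg_geo R D q q01.
have hur n : `|Re (u n)| <= D * q ^+ n by exact: le_trans (Re_le_normc _) (hu n).
have hui n : `|Im (u n)| <= D * q ^+ n by exact: le_trans (Im_le_normc _) (hu n).
have hvr n : `|Re (v n)| <= D * q ^+ n by exact: le_trans (Re_le_normc _) (hv n).
have hvi n : `|Im (v n)| <= D * q ^+ n by exact: le_trans (Im_le_normc _) (hv n).
have dom (a b : nat -> R) : (forall n, `|a n| <= D * q ^+ n) ->
    (forall n, `|b n| <= D * q ^+ n) ->
    dominated (fun n => \sum_(i < n.+1) a i * b (n - i)%N)
      (fun n => D ^+ 2 * (n.+1%:R ^+ 1 * q ^+ n)).
  move=> ha hb; split => [n|]; last first.
    rewrite (_ : (fun n => _) = D ^+ 2 *: (fun n => n.+1%:R ^+ 1 * q ^+ n))//.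
    exact/is_cvg_seriesZ/cvg_poly_geo.
  apply: le_trans (ler_norm_sum _ _ _) _.
  apply: (@le_trans _ _ (\sum_(i < n.+1) D ^+ 2 * q ^+ n)).
    apply: ler_sum => -[i /= hi] _; rewrite normrM.
    apply: le_trans (ler_pM _ _ (ha i) (hb (n - i)%N)) _ => //.
    by rewrite mulrACA -exprD -expr2 subnKC.
  by rewrite sumr_const card_ord -[leLHS]mulr_natl expr1 mulrCA.
apply/eqP; rewrite eq_complex/=.
rewrite -(rsum_conv q01 hur hvr) -(rsum_conv q01 hui hvi).
rewrite -(rsum_conv q01 hur hvi) -(rsum_conv q01 hui hvr).
rewrite -(rsumN (dom _ _ hui hvi)).
rewrite -(rsumD (dom _ _ hur hvr) (N := fun n => D ^+ 2 * (n.+1%:R ^+ 1 * q ^+ n))); last first.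
  have [h c] := dom _ _ hui hvi; split => // n; by rewrite normrN.
rewrite -(rsumD (dom _ _ hur hvi) (dom _ _ hui hvr)).
apply/andP; split; apply/eqP; congr rsum; apply/funext => n.
  rewrite Re_bigsum -sumrB; apply: eq_bigr => i _; exact: Re_mul.
rewrite Im_bigsum -big_split; apply: eq_bigr => i _; exact: Im_mul.
Qed.

End ComplexSeries.

Section Evaluation.
Variable R : realType.
Local Notation C := R[i].
Local Notation A := (ps2 R).
Implicit Types (u v : A) (x y : C).

Definition eterm u x y n : C :=
  \sum_(i < n.+1) (u i (n - i)%N)%:C * (x ^+ i * y ^+ (n - i)).

Definition ev u x y : C := csum (eterm u x y).

(** [ebound x y K]: at the point [(x, y)], series with coefficients of size
[D * K ^ (i + j)] converge. *)
Definition cbounded (K : R) u := exists D : R, forall i j, `|u i j| <= D * K ^+ (i + j).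

Definition ebound (K : R) x y :=
  [/\ 0 <= K, K * normc x < 1 & normc x = normc y].

Section Fixed.
Variables (K : R) (x y : C).
Hypothesis Kxy : ebound K x y.

Let K0 : 0 <= K. Proof. by case: Kxy. Qed.
Let q0 : 0 <= K * normc x. Proof. by rewrite mulr_ge0 ?normc_ge0. Qed.
Let q1 : K * normc x < 1. Proof. by case: Kxy. Qed.
Let p := Num.sqrt (K * normc x).

Let pp : p * p = K * normc x.
Proof. by rewrite -expr2 sqr_sqrtr. Qed.
Let p01 : 0 <= p < 1.
Proof. by rewrite sqrtr_ge0/= -sqrtr1 ltr_sqrt. Qed.

Lemma eterm_le u (D : R) n : (forall i j, `|u i j| <= D * K ^+ (i + j)) ->
  normc (eterm u x y n) <= D * (n.+1%:R * (K * normc x) ^+ n).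
Proof.
move=> uD; apply: le_trans (le_normc_sum _ _ _) _.
apply: (@le_trans _ _ (\sum_(i < n.+1) D * (K * normc x) ^+ n)).
  apply: ler_sum => -[i /= hi] _; rewrite !normcM normc_real !normcX.
  have [_ _ <-] := Kxy; rewrite -exprD subnKC// exprMn mulrA.
  apply: ler_wpM2r; first by rewrite exprn_ge0 ?normc_ge0.
  by apply: le_trans (uD _ _) _; rewrite subnKC.
by rewrite sumr_const card_ord -[leLHS]mulr_natl mulrCA.
Qed.

Lemma eterm_geo u : cbounded K u ->
  exists2 D, 0 <= D & forall n, normc (eterm u x y n) <= D * p ^+ n.
Proof.
move=> [D uD]; have D0 : 0 <= D.
  by have := le_trans (normr_ge0 _) (uD 0%N 0%N); rewrite expr0 mulr1.
have [E E0 hE] := natr_geo_bounded p01; have [p0 _] := andP p01.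
exists (D * E); first exact: mulr_ge0.
move=> n; apply: le_trans (eterm_le _ uD) _.
rewrite -pp exprMn mulrA -mulrA; rewrite -mulrA ler_wpM2l// mulrA.
by rewrite ler_wpM2r ?exprn_ge0.
Qed.

Lemma eterm_dominated u : cbounded K u -> exists M, cdominated (eterm u x y) M.
Proof.
by move=> /eterm_geo[D D0 hD]; exists (fun n => D * p ^+ n); split => //; exact: cvg_geo.
Qed.

Lemma etermM u v n : eterm (u * v) x y n =
  \sum_(i < n.+1) eterm u x y i * eterm v x y (n - i)%N.
Proof.
pose G k l j m : C := (u k l)%:C * (v j m)%:C * (x ^+ (k + j) * y ^+ (l + m)).
transitivity (\sum_(k < n.+1) \sum_(j < (n - k).+1) \sum_(l < (n - k - j).+1)
    G k l j (n - k - j - l)%N).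
  rewrite /eterm; transitivity (\sum_(i < n.+1) \sum_(k < i.+1)
      (fun k j => \sum_(l < (n - k - j).+1) G k l j (n - k - j - l)%N) k (i - k)%N).
    apply: eq_bigr => -[i /= hi] _.
    rewrite ps2M raddf_sum mulr_suml; apply: eq_bigr => -[k /= hk] _.
    have -> : (n - k - (i - k) = n - i)%N by lia.
    rewrite raddf_sum mulr_suml; apply: eq_bigr => -[l /= hl] _.
    by rewrite /G rmorphM/= subnKC// subnKC.
  rewrite (big_tri (fun k j => \sum_(l < (n - k - j).+1) G k l j (n - k - j - l)%N)).
  by apply: eq_bigr => -[k /= hk] _; rewrite subSn.
transitivity (\sum_(k < n.+1) \sum_(l < (n - k).+1) \sum_(j < (n - k - l).+1)
    G k l j (n - k - l - j)%N).
  apply: eq_bigr => k _.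
  rewrite (big_tri_exch (fun j l => G k l j (n - k - j - l)%N)).
  by do 2 (apply: eq_bigr => ? _); congr G; rewrite subnAC.
symmetry.
transitivity (\sum_(i < n.+1) \sum_(k < i.+1)
  (fun k l => \sum_(j < (n - k - l).+1) G k l j (n - k - l - j)%N) k (i - k)%N).
  apply: eq_bigr => -[i /= hi] _; rewrite /eterm mulr_suml.
  apply: eq_bigr => -[k /= hk] _; have -> : (n - k - (i - k) = n - i)%N by lia.
  rewrite mulr_sumr; apply: eq_bigr => j _.
  by rewrite /G !exprD; ring.
rewrite (big_tri (fun k l => \sum_(j < (n - k - l).+1) G k l j (n - k - l - j)%N)).
by apply: eq_bigr => -[k /= hk] _; rewrite subSn.
Qed.

Lemma evM u v : cbounded K u -> cbounded K v ->
  ev (u * v) x y = ev u x y * ev v x y.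
Proof.
move=> /eterm_geo[D D0 hD] /eterm_geo[E E0 hE]; have [p0 _] := andP p01.
rewrite /ev -(@csum_conv _ _ _ (D + E) _ p01).
- by congr csum; apply/funext => n; exact: etermM.
- move=> n; apply: le_trans (hD n) _; rewrite ler_wpM2r ?exprn_ge0//.
  by rewrite lerDl.
- move=> n; apply: le_trans (hE n) _; rewrite ler_wpM2r ?exprn_ge0//.
  by rewrite lerDr.
Qed.

Lemma etermD u v n : eterm (u + v) x y n = eterm u x y n + eterm v x y n.
Proof.
rewrite /eterm -big_split; apply: eq_bigr => i _ /=.
by rewrite !fpsD rmorphD mulrDl.
Qed.

Lemma etermN u n : eterm (- u) x y n = - eterm u x y n.
Proof.
rewrite /eterm -sumrN; apply: eq_bigr => i _ /=.
by rewrite !fpsN rmorphN mulNr.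
Qed.

Lemma evD u v : cbounded K u -> cbounded K v -> ev (u + v) x y = ev u x y + ev v x y.
Proof.
move=> /eterm_dominated[M hM] /eterm_dominated[N hN].
by rewrite /ev -(csumD hM hN); congr csum; apply/funext => n; exact: etermD.
Qed.

Lemma evN u : cbounded K u -> ev (- u) x y = - ev u x y.
Proof.
move=> /eterm_dominated[M hM].
by rewrite /ev -(csumN hM); congr csum; apply/funext => n; exact: etermN.
Qed.

End Fixed.

Lemma csum_delta0 (z : C) : csum (fun n => if n == 0%N then z else 0) = z.
Proof.
have h (a : R) : rsum (fun n => if n == 0%N then a else 0) = a.
  apply: rsum_eq; apply/cvgrPdist_lt => e e0; exists 1%N => // n /= n0.
  rewrite /series/= big_mkord; case: n n0 => // n _.
  by rewrite big_ord_recl/= big1 ?addr0 ?subrr ?normr0.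
rewrite /csum -[RHS](_ : complex.Re z +i* complex.Im z = z); last by case: z.
rewrite -[in RHS](h (complex.Re z)) -[in RHS](h (complex.Im z)).
by congr (rsum _ +i* rsum _); apply/funext => -[|n].
Qed.

Lemma ev_cst2 (a : R) x y : ev (cst2 a) x y = a%:C.
Proof.
rewrite -[RHS]csum_delta0 /ev; congr csum; apply/funext => n; rewrite /eterm.
case: n => [|n]; first by rewrite big_ord1 /cst2/= !expr0 !mulr1.
rewrite big1// => -[[|i] hi] _; rewrite /cst2/= ?andbF ?mulr0n ?mul0r//.
Qed.

Lemma ev1 x y : ev 1 x y = 1.
Proof. by rewrite -cst2_1 ev_cst2. Qed.

Lemma ev0 x y : ev 0 x y = 0.
Proof.
rewrite (_ : 0 = cst2 0); first by rewrite ev_cst2.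
by apply: ps2P => i j; rewrite /cst2 mul0rn.
Qed.

Lemma ev_star K u x : ebound K x (conjc x) -> cbounded K u ->
  ev (star u) x (conjc x) = conjc (ev u x (conjc x)).
Proof.
move=> Kx uK; have [M hM] := eterm_dominated Kx uK.
rewrite /ev -(csum_conj hM); congr csum; apply/funext => n.
rewrite /eterm rmorph_sum [LHS](reindex_inj rev_ord_inj)/=.
apply: eq_bigr => -[i /= hi] _; rewrite /star !rmorphM !rmorphXn/= conjcK.
rewrite subSS subKn//; congr (_ * _); last by rewrite mulrC.
by apply/eqP; rewrite eq_complex/= oppr0 !eqxx.
Qed.

Lemma cboundedD K u v : 0 <= K -> cbounded K u -> cbounded K v -> cbounded K (u + v).
Proof.
move=> K0 [D uD] [E vE]; exists (D + E) => i j; rewrite !fpsD mulrDl.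
exact: le_trans (ler_normD _ _) (lerD (uD i j) (vE i j)).
Qed.

Lemma cboundedN K u : cbounded K u -> cbounded K (- u).
Proof. by move=> [D uD]; exists D => i j; rewrite !fpsN normrN. Qed.

Lemma cbounded_star K u : cbounded K u -> cbounded K (star u).
Proof. by move=> [D uD]; exists D => i j; rewrite addnC; exact: uD. Qed.

Lemma cbounded_wct K r c u : 0 <= K -> cbounded K u -> cbounded K (wct r c u).
Proof.
move=> K0 [D uD]; exists D => i j; rewrite /wct; case: ifP => // _; rewrite normr0.
exact: le_trans (normr_ge0 _) (uD i j).
Qed.

Lemma cbounded_cst2 K a : 0 <= K -> cbounded K (cst2 a).
Proof.
move=> K0; exists `|a| => -[|i] [|j]; rewrite /cst2/= ?mulr0n ?normr0 ?mulr1n ?expr0 ?mulr1//;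
  by rewrite mulr_ge0// exprn_ge0.
Qed.

(** A larger constant absorbs the number of terms in a Cauchy product. *)
Lemma cboundedM K u v : 0 <= K -> cbounded K u -> cbounded K v -> cbounded (2 * K) (u * v).
Proof.
move=> K0 [D uD] [E vE].
have D0 : 0 <= D by have := le_trans (normr_ge0 _) (uD 0%N 0%N); rewrite expr0 mulr1.
have E0 : 0 <= E by have := le_trans (normr_ge0 _) (vE 0%N 0%N); rewrite expr0 mulr1.
have n2 n : n.+1%:R <= 2 ^+ n :> R.
  by elim: n => [|n IH]; rewrite ?expr0// exprS -natr1; have := exprn_ege1 n (ler1n R 2); lra.
exists (D * E) => i j; rewrite ps2M; apply: le_trans (ler_norm_sum _ _ _) _.
apply: (@le_trans _ _ (\sum_(k < i.+1) \sum_(l < j.+1) D * E * K ^+ (i + j))).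
  apply: ler_sum => -[k /= hk] _; apply: le_trans (ler_norm_sum _ _ _) _.
  apply: ler_sum => -[l /= hl] _; rewrite normrM.
  apply: le_trans (ler_pM _ _ (uD k l) (vE (i - k)%N (j - l)%N)) _ => //.
  by rewrite mulrACA -exprD; have -> : (k + l + (i - k + (j - l)) = i + j)%N by lia.
rewrite !sumr_const !card_ord -mulrnA -[leLHS]mulr_natl natrM exprMn mulrCA.
rewrite ler_wpM2l ?mulr_ge0// ler_wpM2r ?mulr_ge0 ?exprn_ge0//.
by rewrite exprD mulrC ler_pM.
Qed.

End Evaluation.

(** * The factorization at a point of the circle *)


Section EvaluateMatrices.
Variable R : realType.
Local Notation C := R[i].
Local Notation A := (ps2 R).

Definition evmx (M : 'M[A]_2) (x y : C) : 'M[C]_2 := \matrix_(r, c) ev (M r c) x y.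
Definition mbounded (K : R) (M : 'M[A]_2) := forall r c, cbounded K (M r c).

Lemma cbounded_mono K K' (u : A) : 0 <= K -> K <= K' -> cbounded K u -> cbounded K' u.
Proof.
move=> K0 KK [D uD]; exists D => i j; apply: le_trans (uD i j) _.
have D0 : 0 <= D by have := le_trans (normr_ge0 _) (uD 0%N 0%N); rewrite expr0 mulr1.
by rewrite ler_wpM2l// lerXn2r// nnegrE; exact: le_trans KK.
Qed.

Lemma mbounded_mono K K' M : 0 <= K -> K <= K' -> mbounded K M -> mbounded K' M.
Proof. by move=> K0 KK h r c; exact: cbounded_mono (h r c). Qed.

Lemma mboundedM K M N : 0 <= K -> mbounded K M -> mbounded K N -> mbounded (2 * K) (M *m N).
Proof.
move=> K0 hM hN r c; rewrite mulmx2; apply: cboundedD; first by rewrite mulr_ge0.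
  exact: cboundedM.
exact: cboundedM.
Qed.

Lemma mbounded_mstar K M : mbounded K M -> mbounded K (mstar M).
Proof. by move=> h r c; rewrite mstarE; exact: cbounded_star. Qed.

Lemma ebound_mono K K' (x y : C) : 0 <= K -> K <= K' -> ebound K' x y -> ebound K x y.
Proof.
move=> K0 KK [K'0 h e]; split => //; apply: le_lt_trans h.
by rewrite ler_wpM2r ?normc_ge0.
Qed.

Lemma evmxE M x y r c : evmx M x y r c = ev (M r c) x y.
Proof. by rewrite mxE. Qed.

Lemma evmxM K x y M N : ebound (2 * K) x y -> 0 <= K -> mbounded K M -> mbounded K N ->
  evmx (M *m N) x y = evmx M x y *m evmx N x y.
Proof.
move=> E2 K0 hM hN; have K2 : K <= 2 * K by lra.
have E := ebound_mono K0 K2 E2.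
apply/matrixP => r c; rewrite evmxE [RHS]mulmx2 !evmxE mulmx2.
by rewrite (evD E2) ?(evM E)//; exact: cboundedM.
Qed.

Lemma det_evmx K x y M : ebound (2 * K) x y -> 0 <= K -> mbounded K M ->
  \det (evmx M x y) = ev (\det M) x y.
Proof.
move=> E2 K0 hM; have K2 : K <= 2 * K by lra.
have E1 := ebound_mono K0 K2 E2.
rewrite !det2 !evmxE (evD E2) ?(evN E2) ?(evM E1)//.
- exact: cboundedM.
- exact: cboundedM.
- exact/cboundedN/cboundedM.
Qed.

(** The conjugate transpose. *)
Definition cadj (M : 'M[C]_2) : 'M[C]_2 := (map_mx (@conjc R) M)^T.

Lemma cadjE M r c : cadj M r c = conjc (M c r).
Proof. by rewrite !mxE. Qed.

Lemma cadjM M N : cadj (M *m N) = cadj N *m cadj M.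
Proof. by rewrite /cadj map_mxM trmx_mul. Qed.

Lemma cadj1 : cadj 1%:M = 1%:M.
Proof. by rewrite /cadj map_mx1 trmx1. Qed.

Lemma evmx_mstar K x M : ebound K x (conjc x) -> mbounded K M ->
  evmx (mstar M) x (conjc x) = cadj (evmx M x (conjc x)).
Proof.
move=> E h; apply/matrixP => r c; rewrite evmxE mstarE cadjE evmxE.
exact: ev_star E _.
Qed.

Definition adj2 (K : pzRingType) (M : 'M[K]_2) : 'M[K]_2 :=
  mx2 (M 1 1) (- M 0 1) (- M 1 0) (M 0 0).

Lemma mul_adj2 (K : comNzRingType) (M : 'M[K]_2) : \det M = 1 -> M *m adj2 M = 1%:M.
Proof.
rewrite det2 => d; apply: mx2P; rewrite mulmx2 /adj2 !mx2E !mxE/= -?d; ring.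
Qed.

Lemma adj2_mul (K : comNzRingType) (M : 'M[K]_2) : \det M = 1 -> adj2 M *m M = 1%:M.
Proof.
rewrite det2 => d; apply: mx2P; rewrite mulmx2 /adj2 !mx2E !mxE/= -?d; ring.
Qed.

Lemma det_adj2 (K : comNzRingType) (M : 'M[K]_2) : \det (adj2 M) = \det M.
Proof. by rewrite !det2 /adj2 !mx2E; ring. Qed.

Lemma invmx_adj2 (K : comUnitRingType) (M : 'M[K]_2) : \det M = 1 -> invmx M = adj2 M.
Proof.
move=> d; have u : M \in unitmx by rewrite unitmxE d unitr1.
by rewrite -[LHS]mulmx1 -(mul_adj2 d) mulKmx.
Qed.

Lemma det_mx2 (K : comNzRingType) (a b c d : K) : \det (mx2 a b c d) = a * d - b * c.
Proof. by rewrite det2 !mx2E. Qed.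

End EvaluateMatrices.

Section AtPoint.
Variable R : realType.
Local Notation C := R[i].
Local Notation A := (ps2 R).
Variables (s : R) (x : C).
Hypothesis s1 : 1 <= s.

(** The radius of convergence: the coefficients of the factor are at most
[(1024 * s ^ 2) ^ (i + j)], and the products below cost a factor [2] each. *)
Definition Kser := 1024 * s ^+ 2.
Hypothesis hx : 64 * Kser * normc x < 1.

Local Notation y := (conjc x).
Local Notation D := (Dmx R).

Let K0 : 0 <= Kser. Proof. by apply: mulr_ge0; [exact: ler0n|exact: sqr_ge0]. Qed.
Let s0 : s != 0. Proof. by apply/eqP => e; move: s1; rewrite e ler10. Qed.
Let K1 : 1 <= Kser. Proof. by have := exprn_ege1 2 s1; rewrite /Kser; lra. Qed.

Let ebx (n : nat) : (n <= 64)%N -> ebound (n%:R * Kser) x y.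
Proof.
move=> n64; split; [exact: mulr_ge0| |by rewrite normc_conj].
apply: le_lt_trans hx; rewrite ler_wpM2r ?normc_ge0// ler_wpM2r//.
by rewrite ler_nat.
Qed.

Lemma mbounded_P : mbounded Kser (Pser s).
Proof. by move=> r c; exists 1 => i j; rewrite mul1r; exact: Pser_le. Qed.

Lemma aser_le r c i j : `|aser s r c i j| <= 8 * s.
Proof.
have o : open [set: R] by exact: openT.
case: j => [|j]; last by rewrite aser_xser// normr0; have := s1; lra.
have h : CkB 0 [set: R] (fun _ => aser s r c i 0%N) (8 * s) 0.
  apply: (CkB_aser (S := fun _ => s)) => //.
    by apply: CkB_cst => //; rewrite ger0_norm//; have := s1; lra.
  by apply: CkB_cst => //; rewrite ger0_norm ?invr_ge0 ?invf_le1; have := s1; lra.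
exact: (CkB_bound h (I : [set: R] 0)).
Qed.

Lemma mbounded_a : mbounded Kser (aser s).
Proof.
move=> r c; exists (8 * s) => i j; apply: le_trans (aser_le r c i j) _.
rewrite ler_peMr//; first by have := s1; lra.
exact: exprn_ege1.
Qed.

Lemma mbounded_sgn (K : R) : 0 <= K -> mbounded K (sgn_mx R).
Proof.
move=> h; have o : cbounded K (1 : A) by rewrite -cst2_1; exact: cbounded_cst2.
have z : cbounded K (0 : A) by exists 0 => i j; rewrite mul0r normr0.
by apply: ord2P; apply: ord2P; rewrite /sgn_mx mx2E//; exact: cboundedN.
Qed.

Lemma mbounded_b1 : mbounded Kser (mx2 (cst2 s) (-1) 0 1).
Proof.
have o : cbounded Kser (1 : A) by rewrite -cst2_1; exact: cbounded_cst2.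
have z : cbounded Kser (0 : A) by exists 0 => i j; rewrite mul0r normr0.
by apply: ord2P; apply: ord2P; rewrite mx2E//; [exact: cbounded_cst2|exact: cboundedN].
Qed.

Lemma mbounded_ell : mbounded Kser (ell R).
Proof.
move=> r c; exists 2 => -[|i] [|j].
- by rewrite ell00 expr0 mulr1; case: (r == c); rewrite ?normr0 ?normr1; lra.
- rewrite (_ : ell R r c 0%N j.+1 = 0) ?normr0 ?mulr_ge0 ?exprn_ge0//.
  by move: r c; apply: ord2P; apply: ord2P;
    rewrite /ell mx2E ?dx_xser ?fpsD /phi /psi /xser/= ?addr0.
- by apply: le_trans (ell_le R r c (ltn0Sn i)) _; rewrite ler_peMr// exprn_ege1.
- rewrite (_ : ell R r c i.+1 j.+1 = 0) ?normr0 ?mulr_ge0 ?exprn_ge0//.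
  by move: r c; apply: ord2P; apply: ord2P;
    rewrite /ell mx2E ?dx_xser ?fpsD /phi /psi /xser/= ?addr0.
Qed.

Definition Phat := evmx (Pser s) x y.
Definition ahat := evmx (aser s) x y.
Definition ellhat := evmx (ell R) x y.

Definition p1c : C := ev (wct 0 0 (Pser s 0 0)) x y.
Definition p2c : C := ev (wct 0 0 (Pser s 1 1)) x y.

Lemma det_Phat : \det Phat = 1.
Proof.
have [h _ _] := herm_factorP (@gser00 R s) (gser_star s) (det_gser s0).
have E2 := ebx (isT : (2 <= 64)%N).
by rewrite /Phat (det_evmx E2 K0 mbounded_P) h ev1.
Qed.

Lemma det_ellhat : \det ellhat = 1.
Proof.
have E2 := ebx (isT : (2 <= 64)%N).
by rewrite /ellhat (det_evmx E2 K0 mbounded_ell) det_ell ev1.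
Qed.

Lemma p1p2 : p1c * p2c = 1.
Proof.
have [_ _ h] := herm_factorP (@gser00 R s) (gser_star s) (det_gser s0).
have E1 := ebx (isT : (1 <= 64)%N); rewrite mul1r in E1.
rewrite /p1c /p2c -(evM E1) ?h ?ev1//; apply: cbounded_wct => //; exact: mbounded_P.
Qed.

Lemma p1_real : conjc p1c = p1c.
Proof.
have E1 := ebx (isT : (1 <= 64)%N); rewrite mul1r in E1.
rewrite /p1c -(ev_star E1) ?star_wct//; apply: cbounded_wct => //; exact: mbounded_P.
Qed.

Lemma evmx_sgn : evmx (sgn_mx R) x y = D.
Proof.
have E1 := ebx (isT : (1 <= 64)%N); rewrite mul1r in E1.
apply: mx2P; rewrite evmxE /sgn_mx /Dmx !mx2E ?ev1 ?ev0//.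
rewrite (evN E1) ?ev1// -cst2_1; exact: cbounded_cst2.
Qed.

Lemma Phat_unitary :
  cadj Phat *m (cadj ahat *m D *m ahat) *m Phat = mx2 p1c 0 0 (- p2c).
Proof.
have [_ h _] := herm_factorP (@gser00 R s) (gser_star s) (det_gser s0).
have E1 := ebx (isT : (1 <= 64)%N); rewrite mul1r in E1.
have E2 := ebx (isT : (2 <= 64)%N).
have E4 : ebound (2 * (2 * Kser)) x y.
  by rewrite (_ : 2 * (2 * Kser) = 4%:R * Kser); [exact: ebx|ring].
have E8 : ebound (2 * (2 * (2 * Kser))) x y.
  by rewrite (_ : 2 * (2 * (2 * Kser)) = 8%:R * Kser); [exact: ebx|ring].
have E16 : ebound (2 * (2 * (2 * (2 * Kser)))) x y.
  by rewrite (_ : 2 * (2 * (2 * (2 * Kser))) = 16%:R * Kser); [exact: ebx|ring].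
have l2 (k : R) : 0 <= k -> k <= 2 * k by move=> ?; lra.
have k2 : 0 <= 2 * Kser by rewrite mulr_ge0.
have k4 : 0 <= 2 * (2 * Kser) by rewrite mulr_ge0.
have k8 : 0 <= 2 * (2 * (2 * Kser)) by rewrite mulr_ge0.
have aB := mbounded_a; have PB := mbounded_P.
have up (M : 'M[A]_2) (k : R) : 0 <= k -> mbounded k M -> mbounded (2 * k) M.
  by move=> k0 h'; exact: mbounded_mono k0 (l2 _ k0) h'.
have B1 := mboundedM K0 (mbounded_mstar aB) (mbounded_sgn K0).
have B2 : mbounded (2 * (2 * Kser)) (gser s) := mboundedM k2 B1 (up _ _ K0 aB).
have PB4 : mbounded (2 * (2 * Kser)) (Pser s) by apply: (up) => //; exact: up.
have B3 := mboundedM k4 (mbounded_mstar PB4) B2.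
have e1 : cadj ahat *m D *m ahat = evmx (gser s) x y.
  rewrite /gser (evmxM E4 k2 B1 (up _ _ K0 aB)).
  rewrite (evmxM E2 K0 (mbounded_mstar aB) (mbounded_sgn K0)).
  by rewrite evmx_sgn (evmx_mstar E1 aB).
have e2 : cadj Phat *m (cadj ahat *m D *m ahat) *m Phat =
    evmx (mstar (Pser s) *m gser s *m Pser s) x y.
  rewrite (evmxM E16 k8 B3 (up _ _ k4 PB4)).
  by rewrite (evmxM E8 k4 (mbounded_mstar PB4) B2) (evmx_mstar E1 PB) e1.
rewrite e2 {e1 e2} /Pser h.
have z : cbounded Kser (wct 0 0 (Pser s 1 1)) by apply: cbounded_wct => //; exact: PB.
by apply: mx2P; rewrite evmxE !mx2E ?ev0// (evN E1).
Qed.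

Lemma ahat_b1 : ahat *m mx2 s%:C (-1) 0 1 = mx2 s%:C (-1) 0 1 *m ellhat.
Proof.
have E1 := ebx (isT : (1 <= 64)%N); rewrite mul1r in E1.
have E2 := ebx (isT : (2 <= 64)%N).
have e : evmx (mx2 (cst2 s) (-1) 0 1) x y = mx2 s%:C (-1) 0 1.
  apply: mx2P; rewrite evmxE !mx2E ?ev_cst2 ?ev0 ?ev1// (evN E1) ?ev1//.
  by rewrite -cst2_1; exact: cbounded_cst2.
rewrite -e /ahat /ellhat -(evmxM E2 K0 mbounded_a mbounded_b1).
by rewrite (aserE s0) (evmxM E2 K0 mbounded_b1 mbounded_ell).
Qed.

End AtPoint.

(** * Conjugation by the diagonal loop, and the unitary frame *)


Section Frames.
Variable R : realType.
Local Notation C := R[i].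
Local Notation D := (Dmx R).
Implicit Types (M N : 'M[C]_2) (l e z : C).

Lemma conjcR (x : R) : conjc x%:C = x%:C.
Proof. by apply/eqP; rewrite eq_complex/= oppr0 !eqxx. Qed.

Lemma conjcNR (x : R) : conjc (- x%:C) = - x%:C.
Proof. by apply/eqP; rewrite eq_complex/= ?oppr0 !eqxx. Qed.

Lemma realcV (x : R) : (x^-1)%:C = (x%:C)^-1 :> C.
Proof. exact: fmorphV. Qed.

(** [T(l)^-1 M T(l)] for [T(l) = diag(1, l)]. *)
Definition tconj l M : 'M[C]_2 := mx2 (M 0 0) (l * M 0 1) (l^-1 * M 1 0) (M 1 1).

Lemma tconjM l M N : l != 0 -> tconj l (M *m N) = tconj l M *m tconj l N.
Proof.
by move=> l0; apply: mx2P; rewrite mulmx2 /tconj !mx2E !mulmx2; field.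
Qed.

Lemma tconj_adj2 l M : adj2 (tconj l M) = tconj l (adj2 M).
Proof. by apply: mx2P; rewrite /adj2 /tconj !mx2E// mulrN. Qed.

Lemma det_tconj l M : l != 0 -> \det (tconj l M) = \det M.
Proof. by move=> l0; rewrite !det2 /tconj !mx2E; field. Qed.

Lemma tconj_comp e l M : tconj (e * l) M = tconj e (tconj l M).
Proof. by apply: mx2P; rewrite /tconj !mx2E// ?invfM mulrA. Qed.

Lemma unit_neq0 l : `|l| = 1 -> l != 0.
Proof. by move=> h; rewrite -normr_eq0 h oner_neq0. Qed.

Lemma unit_conj l : `|l| = 1 -> conjc l = l^-1.
Proof.
move=> h; apply: (mulfI (unit_neq0 h)).
by rewrite -sqr_normc h expr1n mulfV// unit_neq0.
Qed.

Lemma unit_normc l : `|l| = 1 -> normc l = 1.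
Proof. by move=> h; apply: (@complexI R); rewrite -[LHS]/(`|l|) h. Qed.

Lemma tconjE e M : e != 0 -> tconj e M = invmx (Tmx e) *m M *m Tmx e.
Proof.
move=> e0; have u : Tmx e \in unitmx.
  by rewrite unitmxE /Tmx det_mx2 mul1r mulr0 subr0 unitfE.
apply: (can_inj (mulKmx u)); rewrite -mulmxA mulKVmx//.
by apply: mx2P; rewrite !mulmx2 /Tmx /tconj !mx2E; field.
Qed.

Lemma cadj_tconj l M : `|l| = 1 -> cadj (tconj l M) = tconj l (cadj M).
Proof.
move=> h; have e := unit_conj h; have l0 := unit_neq0 h.
apply: mx2P; rewrite cadjE /tconj !mx2E ?cadjE//.
- by rewrite rmorphM/= fmorphV/= e invrK.
- by rewrite rmorphM/= e.
Qed.

Lemma tconj_D l : tconj l D = D.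
Proof. by apply: mx2P; rewrite /tconj /Dmx !mx2E ?mulr0. Qed.

Lemma tconj1 l : tconj l 1%:M = 1%:M.
Proof. by apply: mx2P; rewrite /tconj !mx2E !mxE/= ?mulr0. Qed.

Lemma D_D : D *m D = 1%:M.
Proof. by apply: mx2P; rewrite mulmx2 /Dmx !mx2E !mxE/=; ring. Qed.

Lemma det_D : \det D = -1.
Proof. by rewrite /Dmx det_mx2; ring. Qed.

Lemma cadj_mx2 (a b c d : C) :
  cadj (mx2 a b c d) = mx2 (conjc a) (conjc c) (conjc b) (conjc d).
Proof. by apply: mx2P; rewrite cadjE !mx2E. Qed.

Lemma sqrtC_mul (x : R) : 0 <= x -> (Num.sqrt x)%:C * (Num.sqrt x)%:C = x%:C.
Proof. by move=> x0; rewrite -rmorphM -expr2 sqr_sqrtr. Qed.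

Section UnitaryFactor.
Variables (s p : R) (P a L : 'M[C]_2).
Hypothesis s0 : 0 < s.
Hypothesis p0 : 0 < p.
Hypothesis detP : \det P = 1.
Hypothesis hP : cadj P *m (cadj a *m D *m a) *m P = mx2 p%:C 0 0 (- (p^-1)%:C).
Hypothesis ha : a *m mx2 s%:C (-1) 0 1 = mx2 s%:C (-1) 0 1 *m L.
Hypothesis detL : \det L = 1.

Let rs := Num.sqrt s.
Let rp := Num.sqrt p.
Let rs0 : rs%:C != 0 :> C.
Proof. by apply/eqP => /complexI; apply/eqP; rewrite gt_eqF// sqrtr_gt0. Qed.
Let rp0 : rp%:C != 0 :> C.
Proof. by apply/eqP => /complexI; apply/eqP; rewrite gt_eqF// sqrtr_gt0. Qed.

Definition b0mx (q : R) : 'M[C]_2 := mx2 q%:C (- (q^-1)%:C) 0 (q^-1)%:C.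
Definition bmx : 'M[C]_2 := mx2 rp%:C 0 0 (rp^-1)%:C *m adj2 P *m b0mx rs.

Lemma det_bmx : \det bmx = 1.
Proof.
rewrite /bmx !det_mulmx det_adj2 detP !det_mx2 !realcV.
by field; rewrite rs0 rp0.
Qed.

Lemma bmx_unitary : cadj bmx *m D *m bmx =
  cadj L *m mx2 s%:C (-1) (-1) 0 *m L.
Proof.
have rsE := sqrtC_mul (ltW s0); have rpE := sqrtC_mul (ltW p0).
have e1 : cadj (mx2 rp%:C 0 0 (rp^-1)%:C) *m D *m mx2 rp%:C 0 0 (rp^-1)%:C =
    mx2 p%:C 0 0 (- (p^-1)%:C).
  rewrite cadj_mx2 ?conjc0 !conjcR.
  apply: mx2P; rewrite !mulmx2 /Dmx !mx2E; rewrite ?realcV -?rpE -/rp; field => //.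
have e2 : P *m adj2 P = 1%:M := mul_adj2 detP.
have e3 : a *m b0mx rs = b0mx rs *m L.
  have E : b0mx rs = (rs^-1)%:C *: mx2 s%:C (-1) 0 1.
    apply: mx2P; rewrite [RHS]mxE /b0mx !mx2E ?mulr0 ?mulr1 ?mulrN1//.
    by rewrite realcV -rsE -/rs mulrA mulVf// mul1r.
  by rewrite E -scalemxAr ha scalemxAl.
have e4 : cadj (b0mx rs) *m D *m b0mx rs = mx2 s%:C (-1) (-1) 0.
  rewrite /b0mx cadj_mx2 conjcNR conjc0 !conjcR.
  by apply: mx2P; rewrite !mulmx2 /Dmx !mx2E; rewrite ?realcV -?rsE -/rs; field.
set b0 := b0mx rs in e3 e4 *; set Q := adj2 P in e2 *.
rewrite /bmx -/Q -/b0 !cadjM.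
set d := mx2 rp%:C 0 0 _ in e1 *.
transitivity (cadj b0 *m (cadj Q *m (cadj d *m D *m d) *m Q) *m b0).
  by rewrite !mulmxA.
rewrite e1 -hP.
transitivity (cadj b0 *m (cadj (P *m Q) *m (cadj a *m D *m a) *m (P *m Q)) *m b0).
  by rewrite cadjM !mulmxA.
rewrite e2 cadj1 mul1mx mulmx1.
transitivity (cadj (a *m b0) *m D *m (a *m b0)); first by rewrite cadjM !mulmxA.
by rewrite e3 cadjM -e4 !mulmxA.
Qed.

End UnitaryFactor.

Definition Jmx : 'M[C]_2 := mx2 0 1 (-1) 0.

Lemma det_J : \det Jmx = 1. Proof. by rewrite /Jmx det_mx2; ring. Qed.

(** [J] exchanges the two eigenspaces of [D], which turns the sign of the
hermitian form. *)
Lemma frame_unitary X b : cadj X *m D *m X = - (cadj b *m D *m b) -> \det b = 1 ->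
  let f := X *m adj2 b *m adj2 Jmx in cadj f *m D *m f = D.
Proof.
move=> hX db f; have e2 := mul_adj2 db.
have e3 : cadj (adj2 Jmx) *m (- D) *m adj2 Jmx = D.
  have -> : - D = mx2 (-1) 0 0 1.
    by apply: mx2P; rewrite [LHS]mxE /Dmx !mx2E ?oppr0 ?opprK.
  have -> : adj2 Jmx = mx2 0 (-1) 1 0.
    by apply: mx2P; rewrite /adj2 /Jmx !mx2E ?opprK.
  have n1 : conjc (-1 : C) = -1 by rewrite -[1 in LHS]/(1%:C) conjcNR.
  rewrite cadj_mx2 conjc0 conjc1 n1.
  by apply: mx2P; rewrite !mulmx2 /Dmx !mx2E; ring.
rewrite /f !cadjM.
transitivity (cadj (adj2 Jmx) *m (cadj (adj2 b) *m (cadj X *m D *m X) *m adj2 b) *m adj2 Jmx).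
  by rewrite !mulmxA.
rewrite hX mulmxN mulNmx.
transitivity (cadj (adj2 Jmx) *m (- (cadj (b *m adj2 b) *m D *m (b *m adj2 b))) *m adj2 Jmx).
  by rewrite cadjM !mulmxA.
by rewrite e2 cadj1 mul1mx mulmx1.
Qed.

(** The Gram matrix of [gamma_0^-1 exp(t N)] for the form [D]. *)
Lemma gram_gamma0 (a : R) (t : C) L : 0 < a ->
  let g := mx2 (Num.sqrt a)%:C ((Num.sqrt a)^-1)%:C 0 ((Num.sqrt a)^-1)%:C in
  let X := g *m (mx2 1 0 t 1 *m L) in
  cadj X *m D *m X = cadj L *m mx2 (a%:C + t + conjc t) 1 1 0 *m L.
Proof.
move=> a0 g X; have rE := sqrtC_mul (ltW a0).
have r0 : (Num.sqrt a)%:C != 0 :> C.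
  by apply/eqP => /complexI; apply/eqP; rewrite gt_eqF// sqrtr_gt0.
have e1 : cadj g *m D *m g = mx2 a%:C 1 1 0.
  rewrite /g cadj_mx2 ?conjc0 !conjcR !realcV.
  by apply: mx2P; rewrite !mulmx2 /Dmx !mx2E -?rE; field.
have e2 : cadj (mx2 1 0 t 1) *m mx2 a%:C 1 1 0 *m mx2 1 0 t 1 =
    mx2 (a%:C + t + conjc t) 1 1 0.
  rewrite cadj_mx2 ?conjc0 ?conjc1.
  by apply: mx2P; rewrite !mulmx2 !mx2E; ring.
rewrite /X !cadjM -e2 -e1 !mulmxA//.
Qed.

End Frames.

(** * Limits and complex derivatives of series *)


Section ComplexLimits.
Variable R : realType.
Local Notation C := R[i].

Lemma cvgC_normc (T : Type) (F : set_system T) (f : T -> C) (l : C) : Filter F ->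
  normc (f x - l) @[x --> F] --> (0 : R) -> f x @[x --> F] --> l.
Proof.
move=> FF /cvgrPdist_lt h; apply/cvgrPdist_lt => e e0.
have [r re] : exists r : R, e = r%:C by apply/complex_realP/gtr0_real.
have r0 : 0 < r by move: e0; rewrite re ltcR.
apply: filterS (h r r0) => x; rewrite sub0r normrN ger0_norm ?normc_ge0//.
by rewrite distrC re normcE' ltcR.
Qed.

Lemma cvgC_normc_inv (T : Type) (F : set_system T) (f : T -> C) (l : C) : Filter F ->
  f x @[x --> F] --> l -> normc (f x - l) @[x --> F] --> (0 : R).
Proof.
move=> FF /cvgrPdist_lt h; apply/cvgrPdist_lt => e e0.
have e0' : 0 < e%:C :> C by rewrite ltcR.
apply: filterS (h _ e0') => x hx; rewrite sub0r normrN ger0_norm ?normc_ge0//.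
by move: hx; rewrite distrC normcE' ltcR.
Qed.

Lemma cvgC_ReIm (T : Type) (F : set_system T) (f : T -> C) (l : C) : Filter F ->
  complex.Re (f x) @[x --> F] --> complex.Re l ->
  complex.Im (f x) @[x --> F] --> complex.Im l -> f x @[x --> F] --> l.
Proof.
move=> FF hr hi; apply: cvgC_normc.
have h0 : (fun x => `|complex.Re (f x) - complex.Re l| + `|complex.Im (f x) - complex.Im l|)
    @ F --> (0 : R).
  have c0 (g : T -> R) (m : R) : g @ F --> m -> `|g x - m| @[x --> F] --> (0 : R).
    move=> hg; rewrite -[X in _ --> X](@normr0 _ R); apply: cvg_norm.
    by rewrite -[X in _ --> X](subrr m); apply: cvgB => //; exact: cvg_cst.
  by rewrite -[X in _ --> X]addr0; apply: cvgD; exact: c0.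
apply: (squeeze_cvgr _ (cvg_cst 0) h0); apply: nearW => x.
rewrite normc_ge0/=; apply: le_trans (normc_le_ReIm _) _.
by case: (f x) => a b; case: (l).
Qed.

Lemma cvgC_Re (T : Type) (F : set_system T) (f : T -> C) (l : C) : Filter F ->
  f x @[x --> F] --> l -> complex.Re (f x) @[x --> F] --> complex.Re l.
Proof.
move=> FF /cvgC_normc_inv/cvgrPdist_lt h; apply/cvgrPdist_lt => e /h.
apply: filterS => x; rewrite sub0r normrN ger0_norm ?normc_ge0// => hl.
apply: le_lt_trans hl; rewrite distrC; have := Re_le_normc (f x - l).
by case: (f x) => a b; case: (l).
Qed.

Lemma cvgC_Im (T : Type) (F : set_system T) (f : T -> C) (l : C) : Filter F ->
  f x @[x --> F] --> l -> complex.Im (f x) @[x --> F] --> complex.Im l.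
Proof.
move=> FF /cvgC_normc_inv/cvgrPdist_lt h; apply/cvgrPdist_lt => e /h.
apply: filterS => x; rewrite sub0r normrN ger0_norm ?normc_ge0// => hl.
apply: le_lt_trans hl; rewrite distrC; have := Im_le_normc (f x - l).
by case: (f x) => a b; case: (l).
Qed.

Lemma csum_cvg (T : Type) (F : set_system T) (w : nat -> T -> C) (l : nat -> C)
    (M : nat -> R) : Filter F -> (forall n, w n x @[x --> F] --> l n) ->
  cdominated l M -> (\forall x \near F, forall n, normc (w n x) <= M n) ->
  csum (w ^~ x) @[x --> F] --> csum l.
Proof.
move=> FF wl lM wM; apply: cvgC_ReIm => /=.
- apply: (@rsum_cvg _ _ _ (fun n x => complex.Re (w n x)) _ M) => [n||].
  + exact: cvgC_Re.
  + exact: cdominated_Re.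
  + by apply: filterS wM => x h n; exact: le_trans (Re_le_normc _) (h n).
- apply: (@rsum_cvg _ _ _ (fun n x => complex.Im (w n x)) _ M) => [n||].
  + exact: cvgC_Im.
  + exact: cdominated_Im.
  + by apply: filterS wM => x h n; exact: le_trans (Im_le_normc _) (h n).
Qed.

Lemma csum_lim (u : nat -> C) M : cdominated u M ->
  \big[+%R/0]_(0 <= i <oo) u i = csum u.
Proof.
move=> h; apply: cvg_lim => //; apply: cvgC_ReIm => /=.
- under eq_fun do rewrite Re_bigsum; exact: dominated_cvg (cdominated_Re h).
- under eq_fun do rewrite Im_bigsum; exact: dominated_cvg (cdominated_Im h).
Qed.

Lemma is_deriveC_cvg (f : C -> C) (x d : C) :
  h^-1 * (f (h + x) - f x) @[h --> 0^'] --> d -> is_derive x (1 : C) f d.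
Proof.
move=> h; have e : (fun h : C => h^-1 *: ((f \o shift x) (h *: 1) - f x)) =
    (fun h => h^-1 * (f (h + x) - f x)).
  by apply/funext => k /=; rewrite [_%:A]mulr1.
apply: DeriveDef; first by apply/cvg_ex; exists d; rewrite e.
by rewrite /derive e; exact: cvg_lim h.
Qed.

Lemma deriveC_cvg (f : C -> C) (x d : C) : is_derive x (1 : C) f d ->
  h^-1 * (f (h + x) - f x) @[h --> 0^'] --> d.
Proof.
move=> [df <-]; have e : (fun h : C => h^-1 *: ((f \o shift x) (h *: 1) - f x)) =
    (fun h => h^-1 * (f (h + x) - f x)).
  by apply/funext => k /=; rewrite [_%:A]mulr1.
by rewrite -e; exact: df.
Qed.

(** Term by term complex differentiation; the Lipschitz bounds replace bounds on
the derivatives. *)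
Lemma csum_is_derive (f : nat -> C -> C) (d : nat -> C) (x : C) (N M : nat -> R) :
  (forall n, is_derive x (1 : C) (f n) (d n)) ->
  cdominated (fun n => f n x) N -> cvgn (series M) ->
  (\forall h \near (0 : C)^', forall n,
     normc (f n (h + x) - f n x) <= M n * normc h) ->
  cdominated d M ->
  is_derive x (1 : C) (fun y => csum (f ^~ y)) (csum d).
Proof.
move=> df fN cM hM dM; apply: is_deriveC_cvg.
have : csum (fun n => h^-1 * (f n (h + x) - f n x)) @[h --> (0 : C)^'] --> csum d.
  apply: (@csum_cvg _ _ (fun n h => h^-1 * (f n (h + x) - f n x)) _ M) => // [n|].
    exact: deriveC_cvg.
  have h0 : \forall h \near (0 : C)^', h != 0 by exact: nbhs_dnbhs_neq.
  apply: filterS2 h0 hM => h h0 hM n; rewrite normcM normcV mulrC.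
  have nh : 0 < normc h.
    rewrite lt0r normc_ge0 andbT; apply/eqP => /eq0_normc; exact/eqP.
  by rewrite ler_pdivrMr.
apply: cvg_trans; apply: near_eq_cvg.
apply: filterS hM => h hM.
have d1 : cdominated (fun n => f n (h + x) - f n x) (fun n => M n * normc h).
  split => //; rewrite (_ : (fun n => _) = normc h *: M); first exact: is_cvg_seriesZ.
  by apply/funext => n; rewrite mulrC.
rewrite (csumZ _ d1); congr (_ * _).
have -> : (fun n => f n (h + x)) = (fun n => (f n (h + x) - f n x) + f n x).
  by apply/funext => n; rewrite subrK.
by rewrite (csumD d1 fN) addrK.
Qed.

Lemma is_deriveC_exp (n : nat) (x : C) :
  is_derive x (1 : C) (fun z : C => z ^+ n) (n%:R * x ^+ n.-1).
Proof.
apply: DeriveDef; first exact: exprn_derivable.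
by rewrite exp_derive [_%:A]mulr1.
Qed.

Lemma is_deriveC_scale (c : C) (f : C -> C) (x d : C) : is_derive x (1 : C) f d ->
  is_derive x (1 : C) (fun z => c * f z) (c * d).
Proof. by move=> h; exact: is_deriveZ. Qed.

Lemma expr_lipschitz n (x y : C) (r : R) : normc x <= r -> normc y <= r ->
  normc (x ^+ n - y ^+ n) <= n%:R * r ^+ n.-1 * normc (x - y).
Proof.
move=> xr yr; have r0 : 0 <= r by exact: le_trans (normc_ge0 _) xr.
rewrite subrXX normcM mulrC ler_wpM2r ?normc_ge0//.
apply: le_trans (le_normc_sum _ _ _) _.
rewrite mulr_natl -[X in _ *+ X](card_ord n) -sumr_const; apply: ler_sum => -[i /= hi] _.
have -> : r ^+ n.-1 = r ^+ (n.-1 - i) * r ^+ i by rewrite -exprD subnK//; lia.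
rewrite normcM !normcX; apply: ler_pM; rewrite ?exprn_ge0 ?normc_ge0//.
  by apply: lerXn2r; rewrite // nnegrE ?normc_ge0.
by apply: lerXn2r; rewrite // nnegrE ?normc_ge0.
Qed.

End ComplexLimits.

(** * The fundamental solution on the circle *)


Section LoopOfSolution.
Variable R : realType.
Local Notation C := R[i].
Implicit Types (l z x y : C).

Lemma eterm_xser (c : nat -> R) x y n : eterm (xser c) x y n = (c n)%:C * x ^+ n.
Proof.
rewrite /eterm big_ord_recr/= big1 ?add0r => [|i _].
  by rewrite subnn /xser/= expr0 mulr1.
by rewrite /xser subn_eq0 leqNgt ltn_ord/= mul0r.
Qed.

Lemma half_normc_ball z : normc z < 2^-1 ->
  \forall y \near z, normc y < 2^-1.
Proof.
move=> hz; apply/nbhs_ballP; exists (2^-1 - normc z)%:C.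
  by rewrite /= ltcR subr_gt0.
move=> y; rewrite /ball/= normcE' ltcR => h.
have := le_normcD (y - z) z; rewrite subrK -[y - z]opprB normcN => h'.
by apply: le_lt_trans h' _; rewrite -ltrBrDr.
Qed.

Section PowerSeries.
Variable c : nat -> C.
Hypothesis c2 : forall n, normc (c n) <= 2.

Lemma power_cdominated z : normc z < 2^-1 ->
  cdominated (fun n => c n * z ^+ n) (fun n => 2 * 2^-1 ^+ n).
Proof.
move=> hz; split => [n|]; last by apply: cvg_geo; lra.
rewrite normcM normcX ler_pM ?normc_ge0 ?exprn_ge0 ?normc_ge0//.
by rewrite lerXn2r ?nnegrE ?normc_ge0 ?ltW.
Qed.

Lemma power_is_derive z : normc z < 2^-1 ->
  is_derive z (1 : C) (fun y => csum (fun n => c n * y ^+ n))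
    (csum (fun n => c n * (n%:R * z ^+ n.-1))).
Proof.
move=> hz.
have b n : n%:R * (2^-1 : R) ^+ n.-1 <= 2 * (n.+1%:R ^+ 1 * 2^-1 ^+ n).
  case: n => [|n]; first by rewrite mul0r mulr_ge0// mulr_ge0.
  rewrite expr1 exprS -[n.+2%:R]natr1/=; have : (0 : R) <= 2^-1 ^+ n by rewrite exprn_ge0.
  move: (2^-1 ^+ n) => H H0; rewrite (_ : 2 * _ = n.+1%:R * H + H) ?lerDl//.
  by field.
have cM : cvgn (series (fun n => 4 * (n.+1%:R ^+ 1 * (2^-1 : R) ^+ n))).
  rewrite (_ : (fun n => _) = 4 *: (fun n => n.+1%:R ^+ 1 * (2^-1 : R) ^+ n))//.
  by apply/is_cvg_seriesZ/cvg_poly_geo; lra.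
apply: (csum_is_derive (N := fun n => 2 * 2^-1 ^+ n) (M := fun n => 4 * (n.+1%:R ^+ 1 * 2^-1 ^+ n))) => //.
- by move=> n; apply: is_deriveC_scale; exact: is_deriveC_exp.
- exact: power_cdominated.
- have nz : \forall h \near (0 : C)^', normc (h + z) < 2^-1.
    apply/nbhs_dnbhs/nbhs_ballP; exists (2^-1 - normc z)%:C.
      by rewrite /= ltcR subr_gt0.
    move=> h; rewrite /ball/= sub0r normrN normcE' ltcR => hh.
    by apply: le_lt_trans (le_normcD h z) _; rewrite -ltrBrDr.
  apply: filterS nz => h hh n; rewrite -mulrBr normcM.
  apply: le_trans (ler_pM _ _ (c2 n) (expr_lipschitz n (ltW hh) (ltW hz))) _;
    rewrite ?normc_ge0// addrK mulrA [leLHS]mulrA ler_wpM2r ?normc_ge0//.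
  by have := b n; lra.
- split => // n; rewrite normcM.
  apply: le_trans (_ : 2 * (n%:R * 2^-1 ^+ n.-1) <= _); last by have := b n; lra.
  rewrite ler_pM ?normc_ge0// normcM normcX.
  have -> : normc (n%:R : C) = n%:R.
    by rewrite -(rmorph_nat (real_complex R)) normc_real ger0_norm.
  by rewrite ler_wpM2l// lerXn2r ?nnegrE ?normc_ge0 ?ltW.
Qed.

Lemma euler_power (f : C -> C) z : normc z < 2^-1 ->
  (forall y, normc y < 2^-1 -> f y = csum (fun n => c n * y ^+ n)) ->
  euler f z = csum (fun n => n%:R * (c n * z ^+ n)).
Proof.
move=> hz hf; have D := power_is_derive hz.
have e : 'D_1 f z = csum (fun n => c n * (n%:R * z ^+ n.-1)).
  rewrite -(@derive_val _ _ _ _ _ _ _ D); apply: near_eq_derive.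
  apply: filterS (half_normc_ball hz) => y; exact: hf.
rewrite /euler derive1E e.
have dM : cdominated (fun n => c n * (n%:R * z ^+ n.-1))
    (fun n => 4 * (n.+1%:R ^+ 1 * 2^-1 ^+ n)).
  split => [n|]; last first.
    rewrite (_ : (fun n => _) = 4 *: (fun n => n.+1%:R ^+ 1 * (2^-1 : R) ^+ n))//.
    by apply/is_cvg_seriesZ/cvg_poly_geo; lra.
  rewrite normcM normcM normcX.
  have -> : normc (n%:R : C) = n%:R.
    by rewrite -(rmorph_nat (real_complex R)) normc_real ger0_norm.
  apply: (@le_trans _ _ (2 * (n%:R * 2^-1 ^+ n.-1))).
    by rewrite ler_pM ?normc_ge0 ?mulr_ge0 ?exprn_ge0 ?normc_ge0// ler_wpM2l//
      lerXn2r ?nnegrE ?normc_ge0 ?ltW.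
  case: n => [|n]; first by rewrite mul0r mulr0 !mulr_ge0.
  rewrite expr1 exprS/=; have : (0 : R) <= 2^-1 ^+ n by rewrite exprn_ge0.
  rewrite -[n.+2%:R]natr1; move: (2^-1 ^+ n) => H H0.
  rewrite (_ : 4 * _ = 2 * (n.+1%:R * H) + 2 * H); last by field.
  by rewrite lerDl mulr_ge0.
rewrite -(csumZ _ dM); congr csum; apply/funext => -[|n]; rewrite ?mul0r ?mulr0//.
by rewrite exprS/=; ring.
Qed.

End PowerSeries.

Lemma csum_lim1 (u : nat -> C) M : u 0%N = 0 -> cdominated u M ->
  \big[+%R/0]_(1 <= i <oo) u i = csum u.
Proof.
move=> u0 h; rewrite -(csum_lim h).
rewrite (_ : (fun n => \sum_(1 <= i < n) u i) = (fun n => \sum_(0 <= i < n) u i))//.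
apply/funext => -[|n]; first by rewrite !big_geq.
by rewrite [RHS]big_ltn// u0 add0r.
Qed.

Section OnCircle.
Variables (l z : C).
Hypothesis l1 : `|l| = 1.
Hypothesis hz : normc z < 2^-1.

Local Notation x := (z / l ^+ 2).

Let l0 : l != 0. Proof. exact: unit_neq0. Qed.

Let nl n : normc (l ^+ n) = 1.
Proof. by rewrite normcX unit_normc// expr1n. Qed.

Lemma normc_x : normc x = normc z.
Proof. by rewrite normcM normcV nl invr1 mulr1. Qed.

Lemma xX n : x ^+ n = l ^- (2 * n) * z ^+ n.
Proof. by rewrite exprMn exprVn exprM mulrC. Qed.

Let cb (c : nat -> R) : (forall n, `|c n| <= 2) ->
  forall n, normc ((c n)%:C * l ^- (2 * n)) <= 2.
Proof. by move=> h n; rewrite normcM normc_real normcV nl invr1 mulr1. Qed.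

Lemma phic_le2 n : `|phic R n| <= 2.
Proof.
case: n => [|n]; first by rewrite /phic fact0 expr1n invr1 normr1 ler1n.
have h := ell_le R 0 0 (ltn0Sn n); move: h.
by rewrite /ell mx2E /phi /xser.
Qed.

Lemma psic_le2 n : `|psic R n| <= 2.
Proof.
case: n => [|n]; first by rewrite /psic /harm big_geq// mulr0 mul0r oppr0 normr0.
have h := ell_le R 1 0 (ltn0Sn n); move: h.
by rewrite /ell mx2E /psi /xser.
Qed.

Lemma ev_xser (c : nat -> R) y : ev (xser c) x y =
  csum (fun n => (c n)%:C * l ^- (2 * n) * z ^+ n).
Proof.
by rewrite /ev; congr csum; apply/funext => n; rewrite eterm_xser xX mulrA.
Qed.

Lemma f0E y : normc y < 2^-1 ->
  f0 l y = csum (fun n => (phic R n)%:C * l ^- (2 * n) * y ^+ n).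
Proof.
move=> hy; rewrite -(csum_lim (power_cdominated (cb phic_le2) hy)) /f0.
congr (limn _); apply/funext => n; apply: eq_bigr => i _.
by rewrite /phic realcV rmorphXn rmorph_nat invfM; ring.
Qed.

Lemma f1E y : normc y < 2^-1 ->
  f1 l y = l^-1 * csum (fun n => (psic R n)%:C * l ^- (2 * n) * y ^+ n).
Proof.
move=> hy; pose c n : R := harm R n * phic R n.
have cE n : psic R n = -2 * c n by rewrite /psic /c; ring.
have c2 n : `|c n| <= 2.
  have := psic_le2 n; rewrite cE normrM [`|-2|]normrN [`|2|]ger0_norm//.
  by have := normr_ge0 (c n); lra.
have dom := power_cdominated (cb c2) hy.
have -> : (fun n => (psic R n)%:C * l ^- (2 * n) * y ^+ n) =
    (fun n => (-2) * ((c n)%:C * l ^- (2 * n) * y ^+ n)).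
  apply/funext => n; rewrite cE rmorphM rmorphN rmorph_nat; ring.
rewrite (csumZ _ dom) /f1 -(csum_lim1 _ dom); last first.
  by rewrite /c /harm big_geq// mul0r !mul0r.
rewrite -(_ : limn (fun n => \sum_(1 <= i < n) (c i)%:C * l ^- (2 * i) * y ^+ i) =
  limn (fun n => \sum_(1 <= i < n) ((\sum_(1 <= j < i.+1) (j%:R)^-1) *
     (y ^+ i / ((i`!%:R) ^+ 2 * l ^+ (2 * i)))))).
  by ring.
congr (limn _); apply/funext => n; apply: eq_bigr => i _.
have pE : (phic R i)%:C = (i`!%:R ^+ 2)^-1 :> C.
  by rewrite /phic realcV rmorphXn rmorph_nat.
have hE : (harm R i)%:C = \sum_(1 <= j < i.+1) (j%:R)^-1 :> C.
  rewrite /harm rmorph_sum; apply: eq_bigr => j _.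
  by rewrite -(rmorph_nat (real_complex R)); exact: realcV.
have cE' : (c i)%:C = (harm R i)%:C * (phic R i)%:C :> C by rewrite /c rmorphM.
by rewrite -hE cE' pE [in RHS]invfM; ring.
Qed.

Lemma ev_ell : evmx (ell R) x (conjc x) =
  mx2 (f0 l z) (euler (f0 l) z) (l * f1 l z) (f0 l z + l * euler (f1 l) z).
Proof.
have nat_c (u : R) n : (u *+ n)%:C = n%:R * u%:C :> C.
  by rewrite rmorphMn mulr_natl.
have e00 : ev (phi R) x (conjc x) = f0 l z by rewrite /phi ev_xser f0E.
have e01 : ev (dx (phi R)) x (conjc x) = euler (f0 l) z.
  rewrite (euler_power (cb phic_le2) hz f0E) /phi dx_xser ev_xser.
  by congr csum; apply/funext => n; rewrite nat_c !mulrA.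
have e10 : ev (psi R) x (conjc x) = l * f1 l z.
  by rewrite /psi ev_xser (f1E hz) mulrA mulfV// mul1r.
have e11 : ev (dx (psi R)) x (conjc x) = l * euler (f1 l) z.
  have c2 n : normc (l^-1 * ((psic R n)%:C * l ^- (2 * n))) <= 2.
    by rewrite normcM normcV unit_normc// invr1 mul1r; exact: cb psic_le2 n.
  have h y : normc y < 2^-1 ->
      f1 l y = csum (fun n => l^-1 * ((psic R n)%:C * l ^- (2 * n)) * y ^+ n).
    move=> hy; rewrite (f1E hy) -(csumZ _ (power_cdominated (cb psic_le2) hy)).
    by congr csum; apply/funext => n; rewrite mulrA.
  have nd : normc z < 2^-1 := hz.
  have dM : cdominated (fun n => n%:R * (psic R n)%:C * l ^- (2 * n) * z ^+ n)
      (fun n => 2 * (n.+1%:R ^+ 1 * 2^-1 ^+ n)).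
    split => [n|]; last first.
      rewrite (_ : (fun n => _) = 2 *: (fun n => n.+1%:R ^+ 1 * (2^-1 : R) ^+ n))//.
      by apply/is_cvg_seriesZ/cvg_poly_geo; lra.
    rewrite -!mulrA normcM mulrA normcM.
    have -> : normc (n%:R : C) = n%:R.
      by rewrite -(rmorph_nat (real_complex R)) normc_real ger0_norm.
    rewrite [leRHS]mulrCA expr1; apply: ler_pM; rewrite ?mulr_ge0 ?normc_ge0//.
      by rewrite ler_nat.
    apply: ler_pM; rewrite ?normc_ge0//; first exact: cb psic_le2 n.
    by rewrite normcX lerXn2r ?nnegrE ?normc_ge0 ?ltW.
  rewrite (euler_power c2 hz h) /psi dx_xser ev_xser.
  have -> : (fun n => n%:R * (l^-1 * ((psic R n)%:C * l ^- (2 * n)) * z ^+ n)) =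
      (fun n => l^-1 * (n%:R * (psic R n)%:C * l ^- (2 * n) * z ^+ n)).
    by apply/funext => n; ring.
  rewrite (csumZ _ dM) mulrA mulfV// mul1r.
  by congr csum; apply/funext => n; rewrite nat_c.
have Eb : ebound 1 x (conjc x).
  split => //; last by rewrite normc_conj.
  by rewrite mul1r normc_x//; apply: lt_trans hz _; lra.
have xb (c : nat -> R) (K : R) : (forall n, `|c n| <= K) -> cbounded 1 (xser c).
  move=> h; exists K => i j; rewrite expr1n mulr1 /xser; case: eqP => // _.
  by rewrite normr0; exact: le_trans (normr_ge0 _) (h 0%N).
apply: mx2P; rewrite evmxE /ell !mx2E//.
rewrite (evD Eb) ?e00 ?e11//; first exact: xb phic_le2.
rewrite /psi dx_xser; apply: (@xb _ 4) => -[|n]; first by rewrite mulr0n normr0.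
have := ell_le R 1 1 (ltn0Sn n); have := ell_le R 0 0 (ltn0Sn n).
rewrite /ell !mx2E /psi dx_xser fpsD /phi /xser/= => h1 h2.
rewrite -[X in `|X|](addKr (phic R n.+1)) addrC.
by apply: le_trans (ler_normB _ _) _; lra.
Qed.

Lemma L0E : L0 z l = tconj l (evmx (ell R) x (conjc x)).
Proof.
by rewrite ev_ell /L0; apply: mx2P; rewrite /tconj !mx2E// mulKf.
Qed.

End OnCircle.
End LoopOfSolution.

(** * Smoothness of evaluated series *)

Section SmoothAtoms.
Variables (R : realType) (V : normedModType R).
Implicit Types (O : set V) (f g : V -> R).

Lemma CkB_promote k O f (d : V -> V -> R) K C L : open O -> 0 < K -> 0 <= C -> 0 <= L ->
  (forall x, O x -> {for x, continuous f}) -> (forall x, O x -> `|f x| <= K) ->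
  (forall v x, O x -> is_derive x v f (d v x)) ->
  (forall v, CkB k O (d v) (C * `|v|) L) ->
  exists2 L', 0 <= L' & CkB k.+1 O f K L'.
Proof.
move=> oO K0 C0 L0 cf bf df hd; exists (Num.max L (C / K)).
  by rewrite le_max L0.
apply: (CkB_intro oO cf bf df) => v.
apply: CkB_mono (hd v); rewrite ?mulr_ge0//; last by rewrite le_max lexx.
by rewrite ler_wpM2r// mulrC -ler_pdivrMr// le_max lexx orbT.
Qed.

Lemma CkB_inv k O f K L m : open O -> 0 < m -> 0 <= K -> 0 <= L ->
  (forall x, O x -> m <= f x) -> CkB k O f K L ->
  exists2 L', 0 <= L' & CkB k O (fun x => (f x)^-1) m^-1 L'.
Proof.
move=> oO m0 K0 L0 mf.
have f0 x : O x -> f x != 0 by move=> /mf h; rewrite gt_eqF//; exact: lt_le_trans h.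
have bf x : O x -> `|(f x)^-1| <= m^-1.
  move=> Ox; have h := mf x Ox; have p := lt_le_trans m0 h.
  by rewrite ger0_norm; [rewrite lef_pV2|rewrite invr_ge0 ltW].
have cf x : {for x, continuous f} -> O x -> {for x, continuous (fun x => (f x)^-1)}.
  by move=> c Ox; apply: continuousV => //; exact: f0.
have im0 : 0 <= m^-1 by rewrite invr_ge0 ltW.
elim: k => [|k IH] Hf.
  exists 0 => //; split => // x Ox; split; last exact: bf.
  by apply: cf => //; exact: CkB_cont Hf Ox.
have [L' L'0 h] := IH (CkB_le Hf).
apply: (@CkB_promote _ _ _ (fun v x => - ('D_v f x * ((f x)^-1 * (f x)^-1)))
    _ (K * L * (m^-1 * m^-1)) (L + (L' + L'))) => //.
- by rewrite invr_gt0.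
- by rewrite !mulr_ge0.
- by rewrite !addr_ge0.
- by move=> x Ox; apply: cf => //; exact: CkB_cont Hf Ox.
- move=> v x Ox; have D := CkB_is_derive v Hf Ox.
  apply: DeriveDef; first by apply: derivableV; [exact: f0|exact: (@ex_derive _ _ _ _ _ _ _ D)].
  rewrite deriveV; [|exact: f0|exact: (@ex_derive _ _ _ _ _ _ _ D)].
  by rewrite expr2 invfM scaleNr; congr (- _); exact: mulrC.
- move=> v; apply: CkB_opp; rewrite ?addr_ge0 ?mulr_ge0//.
  rewrite (_ : _ * `|v| = K * L * `|v| * (m^-1 * m^-1)); last by ring.
  apply: CkB_mul; rewrite ?addr_ge0 ?mulr_ge0//; first exact: (Hf.2 v).2.
  exact: CkB_mul.
Qed.

(** [c - ln f] *)
Lemma CkB_ln k O f K L m c K' : open O -> 0 < m -> 0 <= K -> 0 <= L -> 0 < K' ->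
  (forall x, O x -> m <= f x) -> (forall x, O x -> `|c - ln (f x)| <= K') ->
  CkB k O f K L ->
  exists2 L', 0 <= L' & CkB k O (fun x => c - ln (f x)) K' L'.
Proof.
move=> oO m0 K0 L0 K'0 mf bf Hf.
have f0 x : O x -> 0 < f x by move=> /mf h; exact: lt_le_trans h.
have cf x : O x -> {for x, continuous (fun x => c - ln (f x))}.
  move=> Ox; apply: continuousB; first exact: cst_continuous.
  apply: (@continuous_comp _ _ _ f (@ln R)); first exact: CkB_cont Hf Ox.
  exact/continuous_ln/f0.
case: k Hf => [|k] Hf; first by exists 0 => //; split => // x Ox; split; [exact: cf|exact: bf].
have [L' L'0 h] := CkB_inv oO m0 K0 L0 mf (CkB_le Hf).
have im0 : 0 <= m^-1 by rewrite invr_ge0 ltW.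
apply: (@CkB_promote _ _ _ (fun v x => - ('D_v f x * (f x)^-1))
    _ (K * L * m^-1) (L + L')) => //.
- by rewrite !mulr_ge0.
- by rewrite addr_ge0.
- move=> v x Ox; rewrite -[X in is_derive _ _ _ X]add0r.
  have h1 := is_derive_chain (is_derive1_ln (f0 x Ox)) (CkB_is_derive v Hf Ox).
  by rewrite mulrC; exact: is_deriveB (is_derive_cst c x v) h1.
- move=> v; apply: CkB_opp; rewrite ?addr_ge0 ?mulr_ge0//.
  rewrite (_ : _ * `|v| = K * L * `|v| * m^-1); last by ring.
  by apply: CkB_mul; rewrite ?mulr_ge0//; exact: (Hf.2 v).2.
Qed.

Lemma is_derive_linear f v x (a : R) :
  (forall h : R, f (h *: v + x) - f x = h * a) -> is_derive x v f a.
Proof.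
move=> hf; apply: is_derive_cvg.
have : (fun _ : R => a) @ (0 : R)^' --> a by exact: cvg_cst.
apply: cvg_trans; apply: near_eq_cvg.
have h0 : \forall h \near (0 : R)^', h != 0 by exact: nbhs_dnbhs_neq.
by apply: filterS h0 => h h0; rewrite hf mulKf.
Qed.

Lemma CkB_linear k O f (a : V -> R) K : open O -> 0 < K ->
  continuous f -> (forall x, O x -> `|f x| <= K) ->
  (forall v x (h : R), f (h *: v + x) - f x = h * a v) -> (forall v, `|a v| <= `|v|) ->
  exists2 L, 0 <= L & CkB k O f K L.
Proof.
move=> oO K0 cf bf hf ha; case: k => [|k].
  by exists 0 => //; split => // x Ox; split; [exact: cf|exact: bf].
apply: (@CkB_promote _ _ _ (fun v _ => a v) _ 1 0) => //.
- by move=> x _; exact: cf.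
- by move=> v x _; apply: is_derive_linear => h; exact: hf.
- by move=> v; apply: CkB_cst; rewrite ?mul1r.
Qed.

Lemma CkB_cos_sin k O f (a : V -> R) : open O -> continuous f ->
  (forall v x (h : R), f (h *: v + x) - f x = h * a v) -> (forall v, `|a v| <= `|v|) ->
  CkB k O (fun x => cos (f x)) 1 1 /\ CkB k O (fun x => sin (f x)) 1 1.
Proof.
move=> oO cf hf ha.
have cc : continuous (fun x => cos (f x)).
  by move=> x; apply: (@continuous_comp _ _ _ f (@cos R)); [exact: cf|exact: continuous_cos].
have cs : continuous (fun x => sin (f x)).
  by move=> x; apply: (@continuous_comp _ _ _ f (@sin R)); [exact: cf|exact: continuous_sin].
have b (y : R) : `|cos y| <= 1 /\ `|sin y| <= 1.
  by rewrite !ler_norml cos_geN1 cos_le1 sin_geN1 sin_le1.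
elim: k => [|k [IHc IHs]].
  by split; split => // x _; split; [exact: cc|exact: (b _).1|exact: cs|exact: (b _).2].
have df v x : is_derive x v f (a v) by apply: is_derive_linear => h; exact: hf.
split.
- apply: (@CkB_intro _ _ _ _ _ (fun v x => (- a v) * sin (f x))) => //.
  + by move=> x _; exact: cc.
  + by move=> x _; exact: (b _).1.
  + move=> v x _; rewrite mulNr mulrC -mulNr.
    exact: (is_derive_chain (is_derive_cos (f x)) (df v x)).
  + move=> v; rewrite !mul1r; apply: CkB_mono (CkB_scale (- a v) oO ler01 ler01 IHs) => //;
      rewrite mulr1 ?normrN//.
- apply: (@CkB_intro _ _ _ _ _ (fun v x => a v * cos (f x))) => //.
  + by move=> x _; exact: cs.
  + by move=> x _; exact: (b _).2.
  + move=> v x _; rewrite mulrC.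
    exact: (is_derive_chain (is_derive_sin (f x)) (df v x)).
  + move=> v; rewrite !mul1r; apply: CkB_mono (CkB_scale (a v) oO ler01 ler01 IHc) => //;
      rewrite mulr1//.
Qed.

End SmoothAtoms.

Section SmoothComplex.
Variables (R : realType) (V : normedModType R).
Local Notation C := R[i].
Local Notation Re := (@complex.Re R).
Local Notation Im := (@complex.Im R).
Implicit Types (O : set V) (f g : V -> C).

Definition csmooth O f := smooth_on O (fun x => Re (f x)) /\ smooth_on O (fun x => Im (f x)).

Lemma Re_mulR (x : R) (w : C) : Re (x%:C * w) = x * Re w.
Proof. by case: w => a b /=; rewrite mul0r subr0. Qed.

Lemma Im_mulR (x : R) (w : C) : Im (x%:C * w) = x * Im w.
Proof. by case: w => a b /=; rewrite mul0r addr0. Qed.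

Lemma csmooth_ext O f g : open O -> (forall x, O x -> f x = g x) ->
  csmooth O f -> csmooth O g.
Proof.
by move=> oO fg [h1 h2]; split; [apply: smooth_ext h1|apply: smooth_ext h2] => // x Ox; rewrite fg.
Qed.

Lemma csmooth_cst O (c : C) : open O -> csmooth O (fun _ => c).
Proof. by move=> oO; split; exact: smooth_cst. Qed.

Lemma csmooth_real O (f : V -> R) : open O -> smooth_on O f -> csmooth O (fun x => (f x)%:C).
Proof. by move=> oO h; split => //=; exact: smooth_cst. Qed.

Lemma csmooth_add O f g : open O -> csmooth O f -> csmooth O g ->
  csmooth O (fun x => f x + g x).
Proof.
move=> oO [f1 f2] [g1 g2]; split.
- by apply: smooth_ext (smooth_add oO f1 g1) => // x _; rewrite Re_add.
- by apply: smooth_ext (smooth_add oO f2 g2) => // x _; rewrite Im_add.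
Qed.

Lemma csmooth_mul O f g : open O -> csmooth O f -> csmooth O g ->
  csmooth O (fun x => f x * g x).
Proof.
move=> oO [f1 f2] [g1 g2]; split.
- apply: smooth_ext (smooth_add oO (smooth_mul oO f1 g1)
    (smooth_opp oO (smooth_mul oO f2 g2))) => // x _; by rewrite Re_mul.
- apply: smooth_ext (smooth_add oO (smooth_mul oO f1 g2) (smooth_mul oO f2 g1)) => // x _.
  by rewrite Im_mul.
Qed.

Lemma csmooth_opp O f : open O -> csmooth O f -> csmooth O (fun x => - f x).
Proof.
move=> oO h; apply: csmooth_ext (csmooth_mul oO (csmooth_cst (-1) oO) h) => // x _.
by rewrite mulN1r.
Qed.

Lemma csmooth_conj O f : open O -> csmooth O f -> csmooth O (fun x => conjc (f x)).
Proof.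
move=> oO [h1 h2]; split; first by apply: smooth_ext h1 => // x _; case: (f x).
by apply: smooth_ext (smooth_opp oO h2) => // x _; case: (f x).
Qed.

Lemma smooth_mxI O (M : V -> 'M[C]_2) :
  (forall i j, csmooth O (fun x => M x i j)) -> smooth_mx_on O M.
Proof. by []. Qed.

Lemma smooth_mxE O (M : V -> 'M[C]_2) i j :
  smooth_mx_on O M -> csmooth O (fun x => M x i j).
Proof. by move=> h; exact: h. Qed.

Lemma smooth_mx2 O a b c d : csmooth O a -> csmooth O b -> csmooth O c ->
  csmooth O d -> smooth_mx_on O (fun x => mx2 (a x) (b x) (c x) (d x)).
Proof.
move=> ha hb hc hd; apply: smooth_mxI; apply: ord2P; apply: ord2P.
- by rewrite [X in csmooth O X](_ : _ = a)//; apply/funext => x; rewrite mx2E.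
- by rewrite [X in csmooth O X](_ : _ = b)//; apply/funext => x; rewrite mx2E.
- by rewrite [X in csmooth O X](_ : _ = c)//; apply/funext => x; rewrite mx2E.
- by rewrite [X in csmooth O X](_ : _ = d)//; apply/funext => x; rewrite mx2E.
Qed.

Lemma smooth_mulmx O (M N : V -> 'M[C]_2) : open O -> smooth_mx_on O M ->
  smooth_mx_on O N -> smooth_mx_on O (fun x => M x *m N x).
Proof.
move=> oO hM hN; apply: smooth_mxI => i j.
apply: csmooth_ext (csmooth_add oO
  (csmooth_mul oO (smooth_mxE i 0 hM) (smooth_mxE 0 j hN))
  (csmooth_mul oO (smooth_mxE i 1 hM) (smooth_mxE 1 j hN))) => // x _.
by rewrite mulmx2.
Qed.

Lemma smooth_adj2 O (M : V -> 'M[C]_2) : open O -> smooth_mx_on O M ->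
  smooth_mx_on O (fun x => adj2 (M x)).
Proof.
move=> oO hM; rewrite /adj2; apply: smooth_mx2; try exact: smooth_mxE.
  by apply: csmooth_opp => //; exact: smooth_mxE.
by apply: csmooth_opp => //; exact: smooth_mxE.
Qed.

Lemma smooth_mx_ext O (M N : V -> 'M[C]_2) : open O -> (forall x, O x -> M x = N x) ->
  smooth_mx_on O M -> smooth_mx_on O N.
Proof.
move=> oO MN h; apply: smooth_mxI => i j.
by apply: csmooth_ext (smooth_mxE i j h) => // x Ox; rewrite MN.
Qed.

Lemma smooth_tconj O (l l' : V -> C) (M : V -> 'M[C]_2) : open O ->
  csmooth O l -> csmooth O l' -> (forall x, O x -> l' x = (l x)^-1) ->
  smooth_mx_on O M -> smooth_mx_on O (fun x => tconj (l x) (M x)).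
Proof.
move=> oO hl hl' e hM.
apply: (@smooth_mx_ext _ (fun x => mx2 (M x 0 0) (l x * M x 0 1) (l' x * M x 1 0) (M x 1 1))) => //.
  by move=> x Ox; rewrite /tconj e.
apply: smooth_mx2; try exact: smooth_mxE.
  by apply: csmooth_mul => //; exact: smooth_mxE.
by apply: csmooth_mul => //; exact: smooth_mxE.
Qed.

Definition cCkB k O f K L := CkB k O (fun x => Re (f x)) K L /\ CkB k O (fun x => Im (f x)) K L.

Lemma cCkB_mul k O f g K K' L L' : open O -> 0 <= K -> 0 <= K' -> 0 <= L -> 0 <= L' ->
  cCkB k O f K L -> cCkB k O g K' L' -> cCkB k O (fun x => f x * g x) (2 * (K * K')) (L + L').
Proof.
move=> oO K0 K'0 L0 L'0 [f1 f2] [g1 g2].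
have e : 2 * (K * K') = K * K' + K * K' by ring.
have KK : 0 <= K * K' by rewrite mulr_ge0.
have LL : 0 <= L + L' by rewrite addr_ge0.
split; rewrite e.
- apply: (@CkB_ext _ _ _ _ (fun x => Re (f x) * Re (g x) + - (Im (f x) * Im (g x)))) => //.
    by move=> x _; rewrite Re_mul.
  by apply: CkB_add => //; [exact: CkB_mul|apply: CkB_opp => //; exact: CkB_mul].
- apply: (@CkB_ext _ _ _ _ (fun x => Re (f x) * Im (g x) + Im (f x) * Re (g x))) => //.
    by move=> x _; rewrite Im_mul.
  by apply: CkB_add => //; exact: CkB_mul.
Qed.

Lemma cCkB_conj k O f K L : open O -> 0 <= K -> 0 <= L ->
  cCkB k O f K L -> cCkB k O (fun x => conjc (f x)) K L.
Proof.
move=> oO K0 L0 [h1 h2]; split.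
  by apply: CkB_ext h1 => // x _; case: (f x).
by apply: CkB_ext (CkB_opp oO K0 L0 h2) => // x _; case: (f x).
Qed.

Lemma cCkB_exp k O f K L n : open O -> 0 <= K -> 0 <= L -> cCkB k O f K L ->
  cCkB k O (fun x => f x ^+ n) ((2 * K) ^+ n) (n%:R * L).
Proof.
move=> oO K0 L0 hf; elim: n => [|n IH].
  rewrite expr0 mul0r; split.
    by apply: (@CkB_ext _ _ _ _ (fun _ => 1)) => //; apply: CkB_cst; rewrite ?normr1.
  by apply: (@CkB_ext _ _ _ _ (fun _ => 0)) => //; apply: CkB_cst; rewrite ?normr0.
rewrite (_ : (2 * K) ^+ n.+1 = 2 * (K * (2 * K) ^+ n)); last by rewrite exprS mulrA.
rewrite (_ : n.+1%:R * L = L + n%:R * L); last by rewrite -natr1; ring.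
have h : cCkB k O (fun x => f x * f x ^+ n) (2 * (K * (2 * K) ^+ n)) (L + n%:R * L).
  by apply: cCkB_mul => //; rewrite ?exprn_ge0 ?mulr_ge0.
case: h => h1 h2; split; [apply: CkB_ext h1|apply: CkB_ext h2] => // x _; by rewrite exprS.
Qed.

(** The series [ev (u p) (x p) (y p)] is smooth in [p] as soon as it converges
geometrically, uniformly in [p], and its ingredients have bounded derivatives. *)
Lemma csmooth_ev O (u : V -> ps2 R) (x y : V -> C) (B K M : R) : open O ->
  0 <= B -> 0 <= K -> 0 <= M -> 2 * M * K < 1 ->
  (forall k, exists L, [/\ 0 <= L,
    forall i j, CkB k O (fun p => u p i j) (B * K ^+ (i + j)) ((i + j)%:R * L),
    cCkB k O x M L & cCkB k O y M L]) ->
  csmooth O (fun p => ev (u p) (x p) (y p)).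
Proof.
move=> oO B0 K0 M0 q1 H.
set q := 2 * M * K in q1; have q0 : 0 <= q by rewrite !mulr_ge0.
have term k L : 0 <= L ->
    (forall i j, CkB k O (fun p => u p i j) (B * K ^+ (i + j)) ((i + j)%:R * L)) ->
    cCkB k O x M L -> cCkB k O y M L -> forall n,
    cCkB k O (fun p => eterm (u p) (x p) (y p) n) (2 * B * (n.+1%:R * q ^+ n)) (n.+1%:R * (2 * L)).
  move=> L0 hu hx hy n.
  have M2 m : 0 <= (2 * M) ^+ m by rewrite exprn_ge0// mulr_ge0.
  have hm i : (i < n.+1)%N -> cCkB k O (fun p => x p ^+ i * y p ^+ (n - i)) (2 * (2 * M) ^+ n) (n%:R * L).
    rewrite ltnS => hi.
    rewrite (_ : (2 * M) ^+ n = (2 * M) ^+ i * (2 * M) ^+ (n - i)); last by rewrite -exprD subnKC.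
    rewrite (_ : n%:R * L = i%:R * L + (n - i)%:R * L); last by rewrite -mulrDl -natrD subnKC.
    by apply: cCkB_mul; rewrite ?mulr_ge0//; exact: cCkB_exp.
  have hi (P : C -> R) (i : 'I_n.+1) :
      CkB k O (fun p => P (x p ^+ i * y p ^+ (n - i))) (2 * (2 * M) ^+ n) (n%:R * L) ->
      CkB k O (fun p => u p i (n - i)%N * P (x p ^+ i * y p ^+ (n - i)))
        (2 * B * q ^+ n) (n.+1%:R * (2 * L)).
    move=> h; have hin : (i <= n)%N by rewrite -ltnS.
    have hu' := hu i (n - i)%N; rewrite subnKC// in hu'.
    have h' := CkB_mul oO (mulr_ge0 B0 (exprn_ge0 n K0)) (mulr_ge0 (ler0n R 2) (M2 n))
      (mulr_ge0 (ler0n R n) L0) (mulr_ge0 (ler0n R n) L0) hu' h.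
    apply: CkB_mono h'.
    - by rewrite !mulr_ge0// exprn_ge0.
    - by rewrite addr_ge0 ?mulr_ge0.
    - by rewrite le_eqVlt; apply/orP; left; apply/eqP; rewrite /q !exprMn; ring.
    - by rewrite -natr1; nra.
  have e : 2 * B * (n.+1%:R * q ^+ n) = \sum_(i < n.+1) 2 * B * q ^+ n.
    by rewrite sumr_const card_ord -[RHS]mulr_natl; ring.
  have L2 : 0 <= n.+1%:R * (2 * L) by rewrite !mulr_ge0.
  rewrite e; split.
  - apply: (@CkB_ext _ _ _ _ (fun p => \sum_(i < n.+1) u p i (n - i)%N * Re (x p ^+ i * y p ^+ (n - i)))) => //.
      by move=> p _; rewrite /eterm Re_bigsum; apply: eq_bigr => i _; rewrite Re_mulR.
    by apply: CkB_sum => // i; apply: hi; exact: (hm i (ltn_ord i)).1.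
  - apply: (@CkB_ext _ _ _ _ (fun p => \sum_(i < n.+1) u p i (n - i)%N * Im (x p ^+ i * y p ^+ (n - i)))) => //.
      by move=> p _; rewrite /eterm Im_bigsum; apply: eq_bigr => i _; rewrite Im_mulR.
    by apply: CkB_sum => // i; apply: hi; exact: (hm i (ltn_ord i)).2.
have cs (L : R) m : cvgn (series (fun n => 2 * B * (n.+1%:R * q ^+ n) * (n.+1%:R * (2 * L)) ^+ m)).
  rewrite (_ : (fun n => _) = (2 * B * (2 * L) ^+ m) *: (fun n => n.+1%:R ^+ m.+1 * q ^+ n)).
    by apply/is_cvg_seriesZ/cvg_poly_geo; rewrite q0.
  apply/funext => n; transitivity ((2 * B * (2 * L) ^+ m) * (n.+1%:R ^+ m.+1 * q ^+ n)) => //.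
  by rewrite [X in _ * X = _]exprMn [n.+1%:R ^+ m.+1]exprS; ring.
split => k; have [L [L0 hu hx hy]] := H k.
- apply: (@Ck_series _ _ _ _ (fun n p => Re (eterm (u p) (x p) (y p) n))
    (fun n => 2 * B * (n.+1%:R * q ^+ n)) (fun n => n.+1%:R * (2 * L))) => //.
  + by move=> n; rewrite !mulr_ge0// exprn_ge0.
  + by move=> n; rewrite !mulr_ge0.
  + by move=> n; exact: (term k L L0 hu hx hy n).1.
- apply: (@Ck_series _ _ _ _ (fun n p => Im (eterm (u p) (x p) (y p) n))
    (fun n => 2 * B * (n.+1%:R * q ^+ n)) (fun n => n.+1%:R * (2 * L))) => //.
  + by move=> n; rewrite !mulr_ge0// exprn_ge0.
  + by move=> n; rewrite !mulr_ge0.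
  + by move=> n; exact: (term k L L0 hu hx hy n).2.
Qed.

End SmoothComplex.

(** * The domain *)


Section Domain.
Variable R : realType.
Local Notation C := R[i].
Local Notation V3 := (R * R * R)%type.
Variable a : R.
Implicit Types (z : C) (p : V3).

(** This is [- a - t - conj t] for [t = log z]. *)
Definition sfun z : R := - a - ln (complex.Re z ^+ 2 + complex.Im z ^+ 2).

Definition S0 : R := 216 * 10 ^+ 6.
Definition rad : R := expR (- (a + S0) / 2).
Definition Vdom : set C := [set z | normc z < rad].
Definition Udom : set C := Vdom `&` @slit_plane R.

Lemma normc_sq z : complex.Re z ^+ 2 + complex.Im z ^+ 2 = normc z ^+ 2.
Proof. by case: z => x y /=; rewrite sqr_sqrtr// addr_ge0// sqr_ge0. Qed.

Lemma slit_neq0 z : slit_plane z -> z != 0.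
Proof. by move=> h; apply/eqP => z0; apply: h; rewrite z0 lexx. Qed.

Lemma normc_gt0 z : z != 0 -> 0 < normc z.
Proof. by move=> z0; rewrite lt0r normc_ge0 andbT; apply: contra z0 => /eqP/eq0_normc ->. Qed.

Lemma sfunE z : z != 0 -> sfun z = - a - 2 * ln (normc z).
Proof.
by move=> /normc_gt0 z0; rewrite /sfun normc_sq lnXn// mulr_natl.
Qed.

Lemma normc_sfun z : z != 0 -> normc z = expR (- (a + sfun z) / 2).
Proof.
move=> z0; rewrite sfunE// (_ : - _ / 2 = ln (normc z)); last by field.
by rewrite lnK// posrE normc_gt0.
Qed.

Lemma Vdom_sfun z : z != 0 -> Vdom z -> S0 < sfun z.
Proof.
move=> z0; rewrite /Vdom/= (normc_sfun z0) /rad ltr_expR ltr_pM2r// ltrN2.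
by rewrite ltrD2l.
Qed.

Lemma S0_gt3 : 3 < S0.
Proof. by rewrite /S0; have := exprn_ege1 6 (ler1n R 10); lra. Qed.

Lemma cube_le_expR (u : R) : 0 <= u -> u ^+ 3 <= 27 * expR u.
Proof.
move=> u0; have -> : expR u = expR (u / 3) ^+ 3.
  by rewrite -expRM_natl; congr expR; field.
have h : 1 + u / 3 <= expR (u / 3) by exact: expR_ge1Dx.
have h3 : (u / 3) ^+ 3 <= expR (u / 3) ^+ 3.
  by apply: lerXn2r; rewrite ?nnegrE ?expR_ge0//; lra.
by move: h3; rewrite expr_div_n; lra.
Qed.

Lemma sq_sfun_normc z : 0 < a -> z != 0 -> 0 < sfun z ->
  sfun z ^+ 2 * normc z <= 216 / sfun z.
Proof.
move=> a0 z0 s0; set s := sfun z in s0 *.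
have e : normc z <= expR (- (s / 2)).
  by rewrite normc_sfun// ler_expR -/s; lra.
have h := @cube_le_expR (s / 2) ltac:(lra).
rewrite ler_pdivlMr//; apply: (@le_trans _ _ (s ^+ 3 * expR (- (s / 2)))).
  by rewrite mulrAC -exprSr ler_wpM2l// exprn_ge0// ltW.
rewrite expRN ler_pdivrMr ?expR_gt0//.
by move: h; rewrite expr_div_n; lra.
Qed.

Lemma Udom_small z : 0 < a -> z != 0 -> Vdom z ->
  10 ^+ 6 * (sfun z ^+ 2 * normc z) <= 1.
Proof.
move=> a0 z0 Vz; have h := Vdom_sfun z0 Vz; have S3 := S0_gt3.
have s0 : 0 < sfun z by lra.
have k : 216 / sfun z <= 216 / S0 by rewrite ler_wpM2l// lef_pV2 ?posrE//; lra.
have := le_trans (sq_sfun_normc a0 z0 s0) k.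
have -> : 216 / S0 = (10 ^+ 6)^-1 :> R by rewrite /S0; field.
rewrite -[X in _ -> _ <= X](@divff _ (10 ^+ 6 : R)) ?expf_neq0//.
by move=> h'; rewrite ler_wpM2l// exprn_ge0.
Qed.

Lemma open_Vdom : open Vdom.
Proof.
rewrite openE => z Vz; apply/nbhs_ballP; exists (rad - normc z)%:C.
  by rewrite /= ltcR subr_gt0.
move=> y; rewrite /ball/= normcE' ltcR => h.
have := le_normcD (y - z) z; rewrite subrK -[y - z]opprB normcN => h'.
by apply: le_lt_trans h' _; rewrite -ltrBrDr.
Qed.

Lemma slitP z : slit_plane z <-> (complex.Im z != 0 \/ 0 < complex.Re z).
Proof.
rewrite /slit_plane/=; case: z => x y /=; rewrite lecE/=; split.
  move=> /negP; rewrite negb_and -ltNge eq_sym => /orP[]; by [left|right].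
by move=> h /andP[/eqP y0 x0]; case: h; [rewrite -y0 eqxx|rewrite ltNge x0].
Qed.

Definition zp p : C := p.1.1 +i* p.1.2.

Lemma continuous_fst3 : continuous (fun p : V3 => p.1.1).
Proof. by move=> [[x y] w]; apply: (@continuous_comp _ _ _ fst fst) => /=; exact: cvg_fst. Qed.

Lemma continuous_snd3 : continuous (fun p : V3 => p.1.2).
Proof. by move=> [[x y] w]; apply: (@continuous_comp _ _ _ fst snd) => /=; [exact: cvg_fst|exact: cvg_snd]. Qed.

Lemma continuous_thd3 : continuous (fun p : V3 => p.2).
Proof. by move=> [q w]; exact: cvg_snd. Qed.

Lemma norm_fst3 p : `|p.1.1| <= `|p|.
Proof. by rewrite !prod_normE !le_max lexx. Qed.
Lemma norm_snd3 p : `|p.1.2| <= `|p|.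
Proof. by rewrite !prod_normE !le_max lexx orbT. Qed.
Lemma norm_thd3 p : `|p.2| <= `|p|.
Proof. by rewrite !prod_normE !le_max lexx !orbT. Qed.

Lemma continuous_zp : continuous zp.
Proof.
move=> p; apply: cvgC_ReIm => /=; [exact: continuous_fst3|exact: continuous_snd3].
Qed.

Definition rho p : R := p.1.1 ^+ 2 + p.1.2 ^+ 2.

Lemma continuous_rho : continuous rho.
Proof.
move=> p; rewrite /rho; apply: cvgD; rewrite expr2; under eq_fun do rewrite expr2.
  by apply: cvgM; exact: continuous_fst3.
by apply: cvgM; exact: continuous_snd3.
Qed.

Lemma open_slit : open (@slit_plane R).
Proof.
have -> : @slit_plane R = [set z | complex.Im z != 0] `|` [set z | 0 < complex.Re z].
  by apply/seteqP; split => z /slitP.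
have cR : continuous (@complex.Re R : C -> R) by move=> z; apply: (@cvgC_Re R C (nbhs z) id z); apply: cvg_id.
have cI : continuous (@complex.Im R : C -> R) by move=> z; apply: (@cvgC_Im R C (nbhs z) id z); apply: cvg_id.
apply: openU.
- apply: (@open_comp _ _ (@complex.Im R) [set y : R | y != 0]); first by move=> z _; exact: cI.
  exact: open_neq.
- apply: (@open_comp _ _ (@complex.Re R) [set y : R | 0 < y]); first by move=> z _; exact: cR.
  exact: open_gt.
Qed.

Lemma open_Udom : open Udom.
Proof. exact: openI open_Vdom open_slit. Qed.

Definition U3 : set V3 := [set p | Udom (zp p)].

Lemma open_U3 : open U3.
Proof.
by apply: (@open_comp _ _ zp Udom); [move=> p _; exact: continuous_zp|exact: open_Udom].
Qed.

End Domain.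

(** * Smoothness on the domain *)


Lemma is_derive_inv (R : realType) (V : normedModType R) (f : V -> R) (x v : V) (d : R) :
  f x != 0 -> is_derive x v f d ->
  is_derive x v (fun y => (f y)^-1) (- (f x) ^- 2 *: d).
Proof.
move=> f0 [ed vd]; apply: DeriveDef; first exact: derivableV.
by rewrite deriveV// vd.
Qed.

Lemma is_derive_mulf (R : realType) (V : normedModType R) (f g : V -> R) (x v : V)
    (df dg : R) : is_derive x v f df -> is_derive x v g dg ->
  is_derive x v (fun y => f y * g y) (f x * dg + g x * df).
Proof. by move=> hf hg; exact: is_deriveM. Qed.

Section Logarithm.
Variable R : realType.
Local Notation C := R[i].
Local Notation V3 := (R * R * R)%type.
Local Notation Re := (@complex.Re R).
Local Notation Im := (@complex.Im R).
Variable t : C -> C.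
Hypothesis ht : log_branch t.

Lemma log_branch_eq z : slit_plane z ->
  Re z = expR (Re (t z)) * cos (Im (t z)) /\ Im z = expR (Re (t z)) * sin (Im (t z)).
Proof.
move=> /ht[_]; rewrite /cexp /cis; case: (t z) => u v /= e; rewrite -e /=.
by rewrite !mul0r subr0 addr0.
Qed.

Lemma log_branch_Re z : slit_plane z -> ln (Re z ^+ 2 + Im z ^+ 2) = 2 * Re (t z).
Proof.
move=> /log_branch_eq[-> ->]; rewrite !exprMn -mulrDr cos2Dsin2 mulr1.
by rewrite -expRM_natl expRK mulr_natl.
Qed.

Definition cross (z w : C) : R := Re z * Im w - Im z * Re w.
Definition dotp (z w : C) : R := Re z * Re w + Im z * Im w.

(** Near [z0], the argument is measured from [z0] by the arctangent. *)
Lemma log_branch_Im z0 : slit_plane z0 -> \forall z \near z0,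
  slit_plane z -> Im (t z) = Im (t z0) + atan (cross z0 z / dotp z0 z).
Proof.
move=> s0; have [ct _] := ht s0.
have cI : Im (t z) @[z --> z0] --> Im (t z0) by exact: (@cvgC_Im R C (nbhs z0) t _ _ ct).
have /cvgrPdist_lt/(_ 1 ltr01) := cI; apply: filterS => z hz sz.
have [e1 e2] := log_branch_eq s0; have [e3 e4] := log_branch_eq sz.
rewrite /cross /dotp e1 e2 e3 e4.
move: hz (expR_gt0 (Re (t z0))) (expR_gt0 (Re (t z))).
move: (expR (Re (t z0))) (expR (Re (t z))) (Im (t z0)) (Im (t z)) => r0 r b0 b hz r00 r0'.
rewrite distrC in hz.
rewrite (_ : _ / _ = tan (b - b0)).
  rewrite tanK; first by rewrite addrC subrK.
  rewrite in_itv/=; have := @pihalf_ge1 R; move: hz; rewrite ltr_norml => /andP[h1 h2] h3.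
  by apply/andP; split; lra.
rewrite /tan sinB cosB.
have -> : r0 * cos b0 * (r * sin b) - r0 * sin b0 * (r * cos b) =
  (r0 * r) * (sin b * cos b0 - cos b * sin b0) by ring.
have -> : r0 * cos b0 * (r * cos b) + r0 * sin b0 * (r * sin b) =
  (r0 * r) * (cos b * cos b0 + sin b * sin b0) by ring.
by rewrite -mulf_div divff ?mul1r// mulf_neq0 ?gt_eqF.
Qed.

Variable O : set V3.
Hypothesis oO : open O.
Hypothesis Os : forall p, O p -> slit_plane (zp p).

Lemma smooth_coord1 (W : set V3) : open W -> smooth_on W (fun p : V3 => p.1.1).
Proof.
move=> oW; apply: (@smooth_intro R _ W _ (fun v _ : V3 => v.1.1)) => //.
- by move=> p _; exact: continuous_fst3.
- by move=> v p _; apply: is_derive_linear => h /=; rewrite addrK.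
- by move=> v; exact: smooth_cst.
Qed.

Lemma smooth_coord2 (W : set V3) : open W -> smooth_on W (fun p : V3 => p.1.2).
Proof.
move=> oW; apply: (@smooth_intro R _ W _ (fun v _ : V3 => v.1.2)) => //.
- by move=> p _; exact: continuous_snd3.
- by move=> v p _; apply: is_derive_linear => h /=; rewrite addrK.
- by move=> v; exact: smooth_cst.
Qed.

Lemma rho_neq0 p : O p -> rho p != 0.
Proof.
move=> /Os/slit_neq0 z0; rewrite /rho -[p.1.1]/(Re (zp p)) -[p.1.2]/(Im (zp p)).
by rewrite normc_sq expf_neq0// gt_eqF// normc_gt0.
Qed.

Lemma smooth_rho (W : set V3) : open W -> smooth_on W (@rho R).
Proof.
move=> oW; apply: (@smooth_ext R _ W (fun p : V3 => p.1.1 * p.1.1 + p.1.2 * p.1.2)) => //.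
by apply: smooth_add => //; apply: smooth_mul => //;
  by [exact: smooth_coord1|exact: smooth_coord2].
Qed.

Lemma smooth_log_Im : smooth_on O (fun p => Im (t (zp p))).
Proof.
have sV := smooth_inv oO rho_neq0 (smooth_rho oO).
apply: (@smooth_intro R _ O _ (fun v p : V3 =>
  (p.1.1 * v.1.2 + - (p.1.2 * v.1.1)) * (rho p)^-1)) => //.
- move=> p Op; have [ct _] := ht (Os Op).
  apply: (@cvgC_Im R V3 (nbhs p) (fun p => t (zp p)) (t (zp p))).
  by apply: (@continuous_comp _ _ _ (@zp R) t); [exact: continuous_zp|exact: ct].
- move=> v p Op.
  have n1 : \forall q \near p, Im (t (zp p)) + atan (cross (zp p) (zp q) / dotp (zp p) (zp q))
      = Im (t (zp q)).
    have nO : \forall q \near p, O q by exact: open_nbhs_nbhs.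
    have := continuous_zp (log_branch_Im (Os Op)).
    apply: filterS2 nO => q Oq; move=> /(_ (Os Oq)) e; exact: esym.
  apply: near_eq_is_derive n1 _.
  have dc : is_derive p v (fun q : V3 => cross (zp p) (zp q)) (p.1.1 * v.1.2 + - (p.1.2 * v.1.1)).
    by apply: is_derive_linear => h; rewrite /cross /zp/= /GRing.scale/=; ring.
  have dd : is_derive p v (fun q : V3 => dotp (zp p) (zp q)) (p.1.1 * v.1.1 + p.1.2 * v.1.2).
    by apply: is_derive_linear => h; rewrite /dotp /zp/= /GRing.scale/=; ring.
  have rE : dotp (zp p) (zp p) = rho p by rewrite /dotp /rho/=; ring.
  have cE : cross (zp p) (zp p) = 0 by rewrite /cross/=; ring.
  have di : is_derive p v (fun q : V3 => (dotp (zp p) (zp q))^-1)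
      (- (dotp (zp p) (zp p)) ^- 2 *: (p.1.1 * v.1.1 + p.1.2 * v.1.2)).
    have d0 : dotp (zp p) (zp p) != 0 by rewrite rE rho_neq0.
    exact: is_derive_inv.
  have dq := is_derive_mulf dc di.
  pose q (w : V3) : R := cross (zp p) (zp w) / dotp (zp p) (zp w).
  have e0 : q p = 0 by rewrite /q cE mul0r.
  have da : is_derive (q p) 1 (@atan R) 1.
    by rewrite e0; have := is_derive1_atan (0 : R); rewrite expr0n/= addr0 invr1.
  have dt := @is_derive_chain R V3 (@atan R) q p v 1 _ da dq.
  have := is_deriveD (is_derive_cst (Im (t (zp p))) p v) dt.
  by rewrite add0r mul1r cE mul0r add0r rE mulrC.
- move=> v; apply: smooth_mul => //; apply: smooth_add => //.
    by apply: smooth_mul => //; [exact: smooth_coord1|exact: smooth_cst].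
  apply: smooth_opp => //; apply: smooth_mul => //; [exact: smooth_coord2|exact: smooth_cst].
Qed.

End Logarithm.

Section SmoothFactors.
Variable R : realType.
Local Notation C := R[i].
Local Notation V3 := (R * R * R)%type.
Variable a : R.
Hypothesis a0 : 0 < a.
Local Notation U3 := (@U3 R a).
Local Notation sfun := (sfun a).

Definition lp (p : V3) : C := cis p.2.
Definition xp (p : V3) : C := zp p * conjc (lp p) * conjc (lp p).
Definition yp (p : V3) : C := conjc (xp p).
Definition sp (p : V3) : R := sfun (zp p).

Lemma cis_norm (theta : R) : `|cis theta| = 1.
Proof. by rewrite normcE' /cis/= cos2Dsin2 sqrtr1. Qed.

Lemma xpE (p : V3) : xp p = zp p / lp p ^+ 2.
Proof. by rewrite /xp (unit_conj (cis_norm _)) expr2 invfM mulrA. Qed.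

Lemma xp_norm (p : V3) : normc (xp p) = normc (zp p).
Proof. by rewrite xpE normc_x// cis_norm. Qed.

Lemma spE (p : V3) : sp p = - a - ln (rho p). Proof. by []. Qed.

Lemma rho_normc (p : V3) : rho p = normc (zp p) ^+ 2.
Proof. by rewrite -normc_sq. Qed.

(** Around each point, everything the series are made of has bounded derivatives,
and the series converge with a fixed margin. *)
Lemma local_bounds (p0 : V3) : U3 p0 -> exists2 W : set V3, open W & W p0 /\
  exists M s1 : R, [/\ 0 <= M, 1 <= s1, 2 * M * (1024 * s1 ^+ 2) < 1 &
  forall k, exists L, [/\ 0 <= L, CkB k W sp s1 L, CkB k W (fun p => (sp p)^-1) 1 L,
    cCkB k W xp M L & cCkB k W yp M L]].
Proof.
move=> U0; have [V0 sl0] := U0; have z0 := slit_neq0 sl0.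
have n0 := normc_gt0 z0; have S3 := @S0_gt3 R.
have sS := Vdom_sfun z0 V0; have small := Udom_small a0 z0 V0.
set r0 := normc (zp p0) in n0 small.
have s0S : 10 ^+ 6 < sfun (zp p0).
  by apply: le_lt_trans sS; rewrite /S0 ler_peMl ?exprn_ge0//; lra.
have s0big : 100 < sfun (zp p0).
  by apply: le_lt_trans s0S; rewrite !exprS expr0; lra.
set s0 := sfun (zp p0) in s0big small.
have rho0 : rho p0 = r0 ^+ 2 by exact: rho_normc.
have rp0 : 0 < rho p0 by rewrite rho0 exprn_gt0.
pose W : set V3 := [set p | rho p0 / 4 < rho p] `&` [set p | rho p < 4 * rho p0].
have oW : open W.
  apply: openI.
    apply: (@open_comp _ _ (@rho R) [set y : R | rho p0 / 4 < y]); last exact: open_gt.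
    by move=> p _; exact: continuous_rho.
  apply: (@open_comp _ _ (@rho R) [set y : R | y < 4 * rho p0]); last exact: open_lt.
  by move=> p _; exact: continuous_rho.
exists W => //; split; first by split => /=; lra.
have Wrho p : W p -> rho p0 / 4 <= rho p by move=> [/ltW].
have Wr p : W p -> normc (zp p) <= 2 * r0.
  move=> [_ /=]; rewrite rho_normc rho0 => h.
  have r20 : 0 <= 2 * r0 by rewrite mulr_ge0// ltW.
  rewrite -(@ler_pXn2r _ 2) ?nnegrE ?normc_ge0//.
  by rewrite exprMn (_ : 2 ^+ 2 = 4 :> R); [exact: ltW|ring].
have W1 p : W p -> `|p.1.1| <= 2 * r0.
  by move=> /Wr; apply: le_trans; exact: (Re_le_normc (zp p)).
have W2 p : W p -> `|p.1.2| <= 2 * r0.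
  by move=> /Wr; apply: le_trans; exact: (Im_le_normc (zp p)).
have Ws p : W p -> s0 - 4 <= sp p <= s0 + 4.
  move=> [/= h1 h2]; have rpos : 0 < rho p by lra.
  have l4 : ln (4 : R) < 4 by exact: ln_sublinear.
  have e1 : ln (rho p) <= ln (4 * rho p0) by rewrite ler_ln ?posrE ?mulr_gt0// ltW.
  have e2 : ln (rho p0 / 4) <= ln (rho p) by rewrite ler_ln ?posrE ?divr_gt0// ltW.
  move: e1 e2; rewrite lnM ?posrE// ln_div ?posrE// spE.
  have -> : s0 = - a - ln (rho p0) by [].
  by move=> e1 e2; apply/andP; split; lra.
exists (8 * r0), (s0 + 4); split; first by rewrite mulr_ge0 ?ltW.
- by lra.
- have h : (s0 + 4) ^+ 2 <= 4 * s0 ^+ 2 by nra.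
  have h' : 16 * r0 * (1024 * (s0 + 4) ^+ 2) <= 16 * r0 * (1024 * (4 * s0 ^+ 2)).
    have r160 : 0 <= 16 * r0 by rewrite mulr_ge0// ltW.
    exact: (ler_wpM2l r160 (ler_wpM2l (ler0n _ 1024) h)).
  have h6 : (2 : R) ^+ 16 < 10 ^+ 6 by rewrite !exprS expr0; lra.
  have p1 : 0 < s0 ^+ 2 * r0 by rewrite mulr_gt0// exprn_gt0//; lra.
  rewrite (_ : 2 * (8 * r0) = 16 * r0); last by ring.
  apply: le_lt_trans h' _.
  rewrite [ltLHS](_ : _ = 2 ^+ 16 * (s0 ^+ 2 * r0)); last by ring.
  by apply: lt_le_trans small; rewrite ltr_pM2r.
move=> k.
have r2 : 0 < 2 * r0 by rewrite mulr_gt0.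
have [L1 L10 h1] := @CkB_linear _ _ k W (fun p => p.1.1) (fun v => v.1.1) _ oW r2
  (@continuous_fst3 R) W1 (fun v x h => ltac:(by rewrite /= addrK)) (@norm_fst3 R).
have [L2 L20 h2] := @CkB_linear _ _ k W (fun p => p.1.2) (fun v => v.1.2) _ oW r2
  (@continuous_snd3 R) W2 (fun v x h => ltac:(by rewrite /= addrK)) (@norm_snd3 R).
have [hc hs] := @CkB_cos_sin _ _ k W (fun p => p.2) (fun v => v.2) oW
  (@continuous_thd3 R) (fun v x h => ltac:(by rewrite /= addrK)) (@norm_thd3 R).
have r20 := ltW r2.
have r22 : 0 <= 2 * r0 * (2 * r0) by exact: mulr_ge0.
have hr : CkB k W (@rho R) (2 * r0 * (2 * r0) + 2 * r0 * (2 * r0)) (Num.max (L1 + L1) (L2 + L2)).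
  apply: (@CkB_ext R _ k W (fun p : V3 => p.1.1 * p.1.1 + p.1.2 * p.1.2)) => //.
  apply: CkB_add => //.
    apply: CkB_mono r22 (addr_ge0 L10 L10) (lexx _) _ (CkB_mul oW r20 r20 L10 L10 h1 h1).
    by rewrite le_max lexx.
  apply: CkB_mono r22 (addr_ge0 L20 L20) (lexx _) _ (CkB_mul oW r20 r20 L20 L20 h2 h2).
  by rewrite le_max lexx orbT.
have m0 : 0 < rho p0 / 4 by rewrite divr_gt0.
have K0 : 0 <= 2 * r0 * (2 * r0) + 2 * r0 * (2 * r0) by exact: addr_ge0.
have L0 : 0 <= Num.max (L1 + L1) (L2 + L2) by rewrite le_max addr_ge0.
have s10 : 0 < s0 + 4 by lra.
have sb p : W p -> `|- a - ln (rho p)| <= s0 + 4.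
  by move=> /Ws; rewrite spE => /andP[? ?]; rewrite ler_norml; apply/andP; split; lra.
have [L3 L30 h3] := CkB_ln oW m0 K0 L0 s10 Wrho sb hr.
have s1' p : W p -> 1 <= sp p by move=> /Ws/andP[? _]; lra.
have [L4 L40 h4] := CkB_inv oW ltr01 (ltW s10) L30 s1' h3.
rewrite invr1 in h4.
pose L := Num.max (Num.max L1 L2) 1 + 1 + 1 + L3 + L4.
have Lm : 0 <= Num.max (Num.max L1 L2) 1 by rewrite le_max ler01 orbT.
have L12 : L1 <= Num.max (Num.max L1 L2) 1 by rewrite !le_max lexx.
have L22 : L2 <= Num.max (Num.max L1 L2) 1 by rewrite !le_max lexx orbT.
have Lge : 0 <= L by rewrite /L !addr_ge0.
have hz : cCkB k W (@zp R) (2 * r0) (Num.max (Num.max L1 L2) 1).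
  by split; [exact: CkB_mono r20 L10 (lexx _) L12 h1|exact: CkB_mono r20 L20 (lexx _) L22 h2].
have hl : cCkB k W (fun p => conjc (lp p)) 1 1.
  by apply: cCkB_conj => //; split.
have hx : cCkB k W xp (8 * r0) (Num.max (Num.max L1 L2) 1 + 1 + 1).
  have r2p : 0 <= 2 * (2 * r0 * 1) by rewrite mulr1 mulr_ge0.
  have zl := cCkB_mul oW r20 (@ler01 R) Lm (@ler01 R) hz hl.
  have e8 : 2 * (2 * (2 * r0 * 1) * 1) = 8 * r0 by ring.
  by rewrite -e8; exact: (cCkB_mul oW r2p (@ler01 R)
    (addr_ge0 Lm (@ler01 R)) (@ler01 R) zl hl).
have r80 : 0 <= 8 * r0 by rewrite mulr_ge0 ?ltW.
have L50 : 0 <= Num.max (Num.max L1 L2) 1 + 1 + 1 by rewrite !addr_ge0.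
have LL : Num.max (Num.max L1 L2) 1 + 1 + 1 <= L by rewrite /L; move: (Num.max _ _) L30 L40 => m ? ?; lra.
have up f K L' : 0 <= K -> 0 <= L' -> L' <= L -> CkB k W f K L' -> CkB k W f K L.
  by move=> K0' L0' LL' h'; exact: CkB_mono K0' L0' (lexx _) LL' h'.
exists L; split => //.
- by apply: (up _ _ _ (ltW s10) L30 _ h3); rewrite /L; move: (Num.max _ _) Lm L40 => m ? ?; lra.
- by apply: (up _ _ _ (@ler01 R) L40 _ h4); rewrite /L; move: (Num.max _ _) Lm L30 => m ? ?; lra.
- by case: hx => u1 u2; split; [exact: up r80 L50 LL u1|exact: up r80 L50 LL u2].
- by case: (cCkB_conj oW r80 L50 hx) => u1 u2; split; [exact: up r80 L50 LL u1|exact: up r80 L50 LL u2].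
Qed.

Lemma csmooth_local (f : V3 -> C) :
  (forall p, U3 p -> exists2 W : set V3, open W & W p /\ csmooth W f) -> csmooth U3 f.
Proof.
move=> h; split => k; apply: Ck_local => p /h[W oW [Wp [h1 h2]]]; exists W => //; split => //.
Qed.

Lemma smooth_sp : smooth_on U3 sp.
Proof.
move=> k; apply: Ck_local => p /local_bounds[W oW [Wp [M [s1 [_ _ _ /(_ k)[L [_ hs _ _ _]]]]]]].
by exists W => //; split => //; exact: CkB_Ck hs.
Qed.

Lemma csmooth_P r c : csmooth U3 (fun p => ev (Pser (sp p) r c) (xp p) (yp p)).
Proof.
apply: csmooth_local => p /local_bounds[W oW [Wp [M [s1 [M0 s11 q1 H]]]]].
exists W => //; split => //.
apply: (@csmooth_ev _ _ W (fun p => Pser (sp p) r c) xp yp 1 (8 * (128 * s1 ^+ 2)) M) => //.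
- by apply: mulr_ge0 (ler0n _ _) (mulr_ge0 (ler0n _ _) (sqr_ge0 _)).
- by rewrite (_ : 8 * (128 * s1 ^+ 2) = 1024 * s1 ^+ 2); [|ring].
move=> k; have [L [L0 hs hv hx hy]] := H k; exists (L + L); split.
- exact: addr_ge0.
- move=> i j; rewrite mul1r (_ : L + L = 2 * L); last by ring.
  exact: (CkB_Pser r c i j oW s11 L0 hs hv).
- by case: hx => u1 u2; split; [apply: CkB_mono u1|apply: CkB_mono u2] => //; rewrite lerDl.
- by case: hy => u1 u2; split; [apply: CkB_mono u1|apply: CkB_mono u2] => //; rewrite lerDl.
Qed.

Lemma csmooth_p1 : csmooth U3 (fun p => ev (wct 0 0 (Pser (sp p) 0 0)) (xp p) (yp p)).
Proof.
apply: csmooth_local => p /local_bounds[W oW [Wp [M [s1 [M0 s11 q1 H]]]]].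
exists W => //; split => //.
have K0 : 0 <= 8 * (128 * s1 ^+ 2) := mulr_ge0 (ler0n _ _) (mulr_ge0 (ler0n _ _) (sqr_ge0 _)).
apply: (@csmooth_ev _ _ W (fun p => wct 0 0 (Pser (sp p) 0 0)) xp yp 1 (8 * (128 * s1 ^+ 2)) M) => //.
- by rewrite (_ : 8 * (128 * s1 ^+ 2) = 1024 * s1 ^+ 2); [|ring].
move=> k; have [L [L0 hs hv hx hy]] := H k; exists (L + L); split.
- exact: addr_ge0.
- move=> i j; rewrite mul1r (_ : L + L = 2 * L); last by ring.
  rewrite /wct; case: (i.*2 + 0 == j.*2 + 0)%N.
    exact: (CkB_Pser 0 0 i j oW s11 L0 hs hv).
  by apply: CkB_cst => //; rewrite ?normr0 ?exprn_ge0// !mulr_ge0.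
- by case: hx => u1 u2; split; [apply: CkB_mono u1|apply: CkB_mono u2] => //; rewrite lerDl.
- by case: hy => u1 u2; split; [apply: CkB_mono u1|apply: CkB_mono u2] => //; rewrite lerDl.
Qed.

Lemma csmooth_ell r c : csmooth U3 (fun p => ev (ell R r c) (xp p) (yp p)).
Proof.
have [D hD] := mbounded_ell (lexx (1 : R)) r c.
apply: csmooth_local => p /local_bounds[W oW [Wp [M [s1 [M0 s11 q1 H]]]]].
exists W => //; split => //.
have D0 : 0 <= D by have := le_trans (normr_ge0 _) (hD 0%N 0%N); rewrite expr0 mulr1.
have s12 : 1 <= s1 ^+ 2 by exact: exprn_ege1.
have K0 : 0 <= 1024 * s1 ^+ 2 := mulr_ge0 (ler0n _ _) (sqr_ge0 _).
apply: (@csmooth_ev _ _ W (fun p => ell R r c) xp yp D (1024 * s1 ^+ 2) M) => //.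
move=> k; have [L [L0 hs hv hx hy]] := H k; exists L; split => //.
move=> i j; apply: CkB_cst => //; last exact: mulr_ge0.
apply: le_trans (hD i j) _; apply: ler_wpM2l => //.
have e : Kser (1 : R) = 1024 by rewrite /Kser expr1n mulr1.
have e0 : (1024 : R) \is Num.nneg by rewrite nnegrE; exact: ler0n.
have e1 : 1024 * s1 ^+ 2 \is Num.nneg by rewrite nnegrE; exact: K0.
rewrite e; apply: (lerXn2r _ e0 e1).
by rewrite -[leLHS]mulr1; exact: (ler_wpM2l (ler0n _ _) s12).
Qed.

End SmoothFactors.

Section LeadingCoefficient.
Variable R : realType.
Local Notation C := R[i].
Variable a : R.
Hypothesis a0 : 0 < a.
Local Notation sfun := (sfun a).
Implicit Types (z x : C).

Lemma Pser00 (s : R) (r c : 'I_2) : Pser s r c 0 0 = (r == c)%:R.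
Proof.
rewrite PserE !andbT; case: ifP => _; rewrite ?subr0//.
rewrite big1 ?subr0// => m _; rewrite !big_ord_recl !big_ord0 /= !addr0.
by rewrite /Sser herm_pert00 ?mul0r//; exact: gser00.
Qed.

(** The diagonal coefficients only see the product [x * conj x]. *)
Lemma ev_wct_normc (u : ps2 R) r x z : normc x = normc z ->
  ev (wct r r u) x (conjc x) = ev (wct r r u) z (conjc z).
Proof.
move=> h; rewrite /ev; congr csum; apply/funext => n; apply: eq_bigr => i _.
rewrite /wct eqn_add2r; case: eqP => [/double_inj e|_]; last by rewrite !mul0r.
have sq w : w * conjc w = (normc w ^+ 2)%:C.
  case: w => b d; rewrite /normc/= sqr_sqrtr ?addr_ge0 ?sqr_ge0//.
  by apply/eqP; rewrite eq_complex/=; apply/andP; split; apply/eqP; ring.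
by rewrite -e -!exprMn !sq h.
Qed.

Section Point.
Variable z : C.
Hypothesis Uz : Udom a z.

Lemma Udom_neq0 : z != 0. Proof. by case: Uz => _ /slit_neq0. Qed.
Let z0 := Udom_neq0.

Lemma sfun_gt : S0 R < sfun z. Proof. by case: Uz => Vz _; exact: Vdom_sfun. Qed.

Lemma sfun_ge1 : 1 <= sfun z.
Proof. by have := sfun_gt; have := @S0_gt3 R; lra. Qed.

Lemma sfun_gt0 : 0 < sfun z.
Proof. exact: lt_le_trans ltr01 sfun_ge1. Qed.

Let q : R := Kser (sfun z) * normc z.

Let q0 : 0 <= q.
Proof. exact: mulr_ge0 (mulr_ge0 (ler0n _ _) (sqr_ge0 _)) (normc_ge0 _). Qed.

Let qE : q = 2 ^+ 10 * (sfun z ^+ 2 * normc z).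
Proof. by rewrite /q /Kser (_ : 1024 = 2 ^+ 10 :> R); ring. Qed.

Lemma Kser_small : 64 * Kser (sfun z) * normc z < 1.
Proof.
have [Vz _] := Uz; have := Udom_small a0 z0 Vz.
rewrite -mulrA -/q qE; have : 0 < sfun z ^+ 2 * normc z.
  by rewrite mulr_gt0 ?normc_gt0// exprn_gt0// sfun_gt0.
by move: (_ * normc z) => u; rewrite !exprS expr0; lra.
Qed.

Lemma Kser_smallx x : normc x = normc z -> 64 * Kser (sfun z) * normc x < 1.
Proof. by move=> ->; exact: Kser_small. Qed.

Let q4 : 64 * q < 1. Proof. by rewrite /q mulrA; exact: Kser_small. Qed.

Definition p1 : R := complex.Re (p1c (sfun z) z).

Lemma p1cE x : normc x = normc z -> p1c (sfun z) x = p1%:C.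
Proof.
move=> h; rewrite /p1c (ev_wct_normc _ _ h) -/(p1c _ _) /p1.
have := p1_real sfun_ge1 Kser_small; case: (p1c _ _) => b c /= [e].
by congr (_ +i* _); lra.
Qed.

Lemma p1_near1 : `|p1 - 1| <= 4 * q.
Proof.
set u := wct 0 0 (Pser (sfun z) 0 0).
have b i j : `|u i j| <= 1 * Kser (sfun z) ^+ (i + j).
  rewrite mul1r /u /wct; case: ifP => _; first exact: (Pser_le _ _ _ _ sfun_ge1).
  rewrite normr0; apply: exprn_ge0; exact: mulr_ge0 (ler0n _ _) (sqr_ge0 _).
have eb : ebound (Kser (sfun z)) z (conjc z).
  split; [exact: mulr_ge0 (ler0n _ _) (sqr_ge0 _)| |by rewrite normc_conj].
  by move: q4 q0; rewrite -/q; lra.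
have dom : dominated (fun n => complex.Re (eterm u z (conjc z) n)) (fun n => 1 * (2 * q) ^+ n).
  split; last by apply: cvg_geo; apply/andP; split; move: q4 q0; lra.
  move=> n; apply: le_trans (Re_le_normc _) _.
  have h := eterm_le eb n b; rewrite mul1r in h; apply: le_trans h _.
  rewrite mul1r [(2 * q) ^+ n]exprMn.
  rewrite -/q; apply: ler_wpM2r; first exact: exprn_ge0.
  by rewrite -natrX ler_nat; exact: ltn_expl.
have := rsum_tail 1 dom; rewrite /series/= !big_nat1 expr0 mulr1.
have -> : complex.Re (eterm u z (conjc z) 0) = 1.
  by rewrite /eterm big_ord1 subnn !expr0 !mulr1 /u /wct/= Pser00.
move=> h; apply: le_trans h _.
have q2 : 0 <= 2 * q <= 2^-1 by apply/andP; split; move: q4 q0; lra.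
have /andP[_] := @rsum_geo_tail _ 1 (2 * q) ler01 q2.
by rewrite (_ : 2 * 1 * (2 * q) = 4 * q); [|ring].
Qed.

Lemma p1_near1_sfun : `|p1 - 1| <= 2 ^+ 20 / sfun z.
Proof.
apply: le_trans p1_near1 _; rewrite qE.
have h := sq_sfun_normc a0 z0 sfun_gt0.
have i0 : 0 <= (sfun z)^-1 by rewrite invr_ge0 ltW// sfun_gt0.
have e : (2 : R) ^+ 10 * 864 <= 2 ^+ 20 by rewrite !exprS expr0; lra.
have -> : 4 * (2 ^+ 10 * (sfun z ^+ 2 * normc z)) = 2 ^+ 10 * 4 * (sfun z ^+ 2 * normc z) by ring.
apply: (@le_trans _ _ (2 ^+ 10 * 4 * (216 / sfun z))).
  by apply: ler_wpM2l => //; rewrite mulr_ge0// exprn_ge0.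
have -> : 2 ^+ 10 * 4 * (216 / sfun z) = 2 ^+ 10 * 864 / sfun z by ring.
exact: ler_wpM2r.
Qed.

Lemma p1_gt0 : 0 < p1.
Proof. by have := p1_near1; rewrite ler_norml => /andP[h _]; move: h q4 q0; lra. Qed.

Lemma p2cE x : normc x = normc z -> p2c (sfun z) x = (p1^-1)%:C.
Proof.
move=> h; have := p1p2 sfun_ge1 (Kser_smallx h); rewrite (p1cE h) realcV => e.
have n0 : p1%:C != 0 :> C by apply/eqP => /complexI; apply/eqP; rewrite gt_eqF// p1_gt0.
by apply: (mulfI n0); rewrite e divff.
Qed.

End Point.
End LeadingCoefficient.

(** * Holomorphic extensions to the disk *)

Section DiskHolomorphic.
Variable R : realType.
Local Notation C := R[i].
Implicit Types (f g : C -> C) (l : C).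

Definition holo f :=
  {within [set l : C | `|l| <= 1], continuous f} /\
  forall l, `|l| < 1 -> derivable f l 1.

Lemma holo_cst (k : C) : holo (fun _ => k).
Proof.
split => [|l _]; first by move=> l; exact: cvg_cst.
exact: derivable_cst.
Qed.

Lemma holo_id : holo id.
Proof.
split => [|l _]; last exact: derivable_id.
by apply/(subspace_continuousP _ _).2 => l _; exact: cvg_within.
Qed.

Lemma holo_add f g : holo f -> holo g -> holo (fun l => f l + g l).
Proof.
move=> [cf df] [cg dg]; split => [l|l hl]; first by apply: cvgD; [exact: cf|exact: cg].
by apply: derivableD; [exact: df|exact: dg].
Qed.

Lemma holo_mul f g : holo f -> holo g -> holo (fun l => f l * g l).
Proof.
move=> [cf df] [cg dg]; split => [l|l hl]; first by apply: cvgM; [exact: cf|exact: cg].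
by apply: derivableM; [exact: df|exact: dg].
Qed.

Lemma holo_opp f : holo f -> holo (fun l => - f l).
Proof.
move=> [cf df]; split => [l|l hl]; first by apply: cvgN; exact: cf.
by apply: derivableN; exact: df.
Qed.

Lemma holo_ext f g : f =1 g -> holo f -> holo g.
Proof. by move=> /funext ->. Qed.

Lemma disk_normc l : (`|l| <= 1) = (normc l <= 1).
Proof. by rewrite normcE' -(lecR (normc l) 1). Qed.

Lemma disk_normc_lt l : (`|l| < 1) = (normc l < 1).
Proof. by rewrite normcE' -(ltcR (normc l) 1). Qed.

Section PowerSeries.
Variables (c : nat -> nat -> C) (e : nat -> nat -> nat) (q : R).
Hypothesis q01 : 0 <= q < 1.
Hypothesis cq : forall n i, (i <= n)%N -> normc (c n i) <= q ^+ n.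
Hypothesis en : forall n i, (i <= n)%N -> (e n i <= n.*2.+1)%N.

Let term n l := \sum_(i < n.+1) c n i * l ^+ e n i.
Let q0 : 0 <= q. Proof. by case/andP: q01. Qed.

Let term_le n l : normc l <= 1 -> normc (term n l) <= n.+1%:R * q ^+ n.
Proof.
move=> l1; apply: le_trans (le_normc_sum _ _ _) _.
apply: (@le_trans _ _ (\sum_(i < n.+1) q ^+ n)); last by rewrite sumr_const card_ord mulr_natl.
apply: ler_sum => -[i /= hi] _; rewrite normcM normcX -[leRHS]mulr1.
apply: ler_pM; rewrite ?normc_ge0 ?exprn_ge0 ?normc_ge0//; first exact: cq.
by rewrite exprn_ile1 ?normc_ge0.
Qed.

Let term_dominated l : normc l <= 1 ->
  cdominated (term ^~ l) (fun n => n.+1%:R ^+ 1 * q ^+ n).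
Proof. by move=> l1; split => [n|]; [rewrite expr1; exact: term_le|exact: cvg_poly_geo]. Qed.

Let dterm n l := \sum_(i < n.+1) c n i * ((e n i)%:R * l ^+ (e n i).-1).

Let M n : R := n.+1%:R ^+ 2 * q ^+ n.

Let enM n i : (i <= n)%N -> (e n i)%:R <= 2 * n.+1%:R :> R.
Proof.
move=> h; rewrite -natrM ler_nat; have := en h; lia.
Qed.

Let term_lip n (h l : C) : normc l <= 1 -> normc h <= 1 ->
  normc (term n h - term n l) <= 2 * M n * normc (h - l).
Proof.
move=> l1 h1; rewrite /term -sumrB.
apply: le_trans (le_normc_sum _ _ _) _.
apply: (@le_trans _ _ (\sum_(i < n.+1) q ^+ n * (2 * n.+1%:R * normc (h - l)))).
  apply: ler_sum => -[i /= hi] _; rewrite -mulrBr normcM.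
  apply: ler_pM; rewrite ?normc_ge0//; first exact: cq.
  have := expr_lipschitz (e n i) h1 l1; rewrite expr1n mulr1 => h'.
  apply: le_trans h' _; apply: ler_wpM2r; first exact: normc_ge0.
  exact: enM.
rewrite sumr_const card_ord -[leLHS]mulr_natl /M.
by rewrite le_eqVlt; apply/orP; left; apply/eqP; ring.
Qed.

Let dterm_le n l : normc l <= 1 -> normc (dterm n l) <= 2 * M n.
Proof.
move=> l1; apply: le_trans (le_normc_sum _ _ _) _.
apply: (@le_trans _ _ (\sum_(i < n.+1) q ^+ n * (2 * n.+1%:R))).
  apply: ler_sum => -[i /= hi] _; rewrite !normcM normcX.
  apply: ler_pM; rewrite ?mulr_ge0 ?normc_ge0 ?exprn_ge0 ?normc_ge0//; first exact: cq.
  rewrite -[leRHS]mulr1; apply: ler_pM; rewrite ?normc_ge0 ?exprn_ge0 ?normc_ge0//.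
    have -> : (e n i)%:R = ((e n i)%:R : R)%:C by rewrite rmorph_nat.
    by rewrite normc_real ger0_norm//; exact: enM.
  by rewrite exprn_ile1 ?normc_ge0.
rewrite sumr_const card_ord -[leLHS]mulr_natl /M.
by rewrite le_eqVlt; apply/orP; left; apply/eqP; ring.
Qed.

Lemma holo_csum : holo (fun l => csum (fun n => \sum_(i < n.+1) c n i * l ^+ e n i)).
Proof.
split.
  apply/(subspace_continuousP _ _).2 => l /=; rewrite disk_normc => l1.
  apply: csum_cvg (term_dominated l1) _.
    move=> n; apply: cvgC_normc; apply/cvgrPdist_lt => eps eps0.
    have B0 : 0 < 2 * M n + 1 by rewrite ltr_wpDl// !mulr_ge0// exprn_ge0.
    have d0 : 0 < (eps / (2 * M n + 1))%:C :> C by rewrite ltcR divr_gt0.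
    apply/nbhs_ballP; exists (eps / (2 * M n + 1))%:C => //= y.
    rewrite /ball/= -opprB normrN normcE' ltcR => hy y1.
    rewrite sub0r normrN ger0_norm ?normc_ge0//.
    have y1' : normc y <= 1 by move: y1; rewrite -disk_normc.
    apply: le_lt_trans (term_lip n l1 y1') _.
    apply: (@le_lt_trans _ _ ((2 * M n + 1) * normc (y - l))).
      by apply: ler_wpM2r; rewrite ?normc_ge0// lerDl.
    by rewrite mulrC -ltr_pdivlMr.
  apply/nbhs_ballP; exists 1 => //= y _ y1 n; rewrite expr1; apply: term_le.
  by move: y1; rewrite -disk_normc.
move=> l; rewrite disk_normc_lt => l1.
have cM : cvgn (series (fun n => 2 * M n)).
  rewrite (_ : (fun n => _) = 2 *: (fun n => n.+1%:R ^+ 2 * q ^+ n))//.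
  exact/is_cvg_seriesZ/cvg_poly_geo.
have [] // := @csum_is_derive _ (term) (dterm ^~ l) l _ (fun n => 2 * M n) _ (term_dominated (ltW l1)).
- move=> n; rewrite /term /dterm.
  have h i : is_derive l (1 : C) (fun l : C => c n i * l ^+ e n i)
      (c n i * ((e n i)%:R * l ^+ (e n i).-1)).
    by apply: is_deriveC_scale; exact: is_deriveC_exp.
  have := @is_derive_sum _ _ _ n.+1 (fun (i : 'I_n.+1) l => c n i * l ^+ e n i) l 1 _ (fun i => h i).
  by congr is_derive; apply/funext => y; rewrite fct_sumE.
- have r0 : 0 < (1 - normc l)%:C :> C by rewrite ltcR subr_gt0.
  apply: nbhs_dnbhs; apply/nbhs_ballP; exists (1 - normc l)%:C => //= h.
  rewrite /ball/= sub0r normrN normcE' ltcR => hl n.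
  have hl1 : normc (h + l) <= 1 by apply: le_trans (le_normcD _ _) _; lra.
  by have := term_lip n (ltW l1) hl1; rewrite addrK.
- by split => // n; exact: dterm_le (ltW l1).
Qed.

End PowerSeries.
End DiskHolomorphic.

Section HolomorphicMatrices.
Variable R : realType.
Local Notation C := R[i].
Implicit Types (M N : C -> 'M[C]_2) (l : C).

Definition holo_mx M := forall i j, holo (fun l => M l i j).

Lemma holo_mx2 (f g h k : C -> C) : holo f -> holo g -> holo h -> holo k ->
  holo_mx (fun l => mx2 (f l) (g l) (h l) (k l)).
Proof.
move=> hf hg hh hk; apply: ord2P; apply: ord2P.
- by apply: holo_ext hf => l; rewrite mx2E.
- by apply: holo_ext hg => l; rewrite mx2E.
- by apply: holo_ext hh => l; rewrite mx2E.
- by apply: holo_ext hk => l; rewrite mx2E.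
Qed.

Lemma holo_mulmx M N : holo_mx M -> holo_mx N -> holo_mx (fun l => M l *m N l).
Proof.
move=> hM hN i j.
apply: holo_ext (holo_add (holo_mul (hM i 0) (hN 0 j)) (holo_mul (hM i 1) (hN 1 j))) => l.
by rewrite mulmx2.
Qed.

Lemma holo_adj2 M : holo_mx M -> holo_mx (fun l => adj2 (M l)).
Proof.
by move=> hM; apply: holo_mx2; try exact: hM; apply: holo_opp; exact: hM.
Qed.

Lemma derivable_bigO (f : C -> C) : derivable f 0 1 ->
  exists2 K : R, 0 < K & \forall l \near (0 : C), normc (f l - f 0) <= K * normc l.
Proof.
move=> df; have D : is_derive (0 : C) (1 : C) f (derive f 0 1) by split.
have c := deriveC_cvg D; set d := derive f 0 1 in c.
have h := (cvgrPdist_lt _ _).1 (cvgC_normc_inv _ c) 1 ltr01.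
exists (normc d + 1); first by rewrite ltr_wpDl// normc_ge0.
have {}h : nbhs (0 : C) (fun l : C => l != 0 -> `|0 - normc (l^-1 * (f (l + 0) - f 0) - d)| < 1).
  exact: h.
have [eps eps0 he] := (nbhs_ballP _ _).1 h.
apply/nbhs_ballP; exists eps => // l hl.
have [->|l0] := eqVneq l 0; first by rewrite subrr normc0 mulr0.
have := he _ hl l0; rewrite sub0r normrN ger0_norm ?normc_ge0// addr0 => hl'.
have e : f l - f 0 = l * (l^-1 * (f l - f 0)) by rewrite mulrA mulfV// mul1r.
rewrite e normcM mulrC; apply: ler_wpM2r; first exact: normc_ge0.
have := le_normcD (l^-1 * (f l - f 0) - d) d; rewrite subrK.
by move: (normc _) (normc _) (normc _) hl' => u v w; lra.
Qed.

Lemma holo_mx_bigO M : holo_mx M ->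
  (fun l => M l - M 0) =O_ (nbhs (0 : C)) (@id C).
Proof.
move=> hM; have bd i j : exists2 K : R, 0 < K &
    \forall l \near (0 : C), normc (M l i j - M 0 i j) <= K * normc l.
  by apply: (@derivable_bigO (fun l => M l i j)); apply: (hM i j).2; rewrite normr0 ltr01.
have [K1 K10 h1] := bd 0 0; have [K2 K20 h2] := bd 0 1.
have [K3 K30 h3] := bd 1 0; have [K4 K40 h4] := bd 1 1.
apply/eqO_exP; exists (K1 + K2 + K3 + K4)%:C; first by rewrite ltcR !addr_gt0.
apply: filterS2 (filterI h1 h2) (filterI h3 h4) => l [e1 e2] [e3 e4].
suff: mx_norm (M l - M 0) <= (K1 + K2 + K3 + K4)%:C * `|l| by [].
have [->|/mx_norm_neq0[[i j] ->]] := eqVneq (mx_norm (M l - M 0)) 0.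
  by rewrite mulr_ge0// ?normr_ge0// ltW// ltcR !addr_gt0.
rewrite [X in `|X|](_ : _ = M l i j - M 0 i j); last by rewrite !mxE.
rewrite !normcE' -rmorphM lecR.
have n0 := normc_ge0 l; have up (k : R) u : u <= k * normc l -> k <= K1 + K2 + K3 + K4 ->
    u <= (K1 + K2 + K3 + K4) * normc l.
  by move=> hu hk; apply: le_trans hu _; exact: ler_wpM2r.
move: i j; apply: ord2P; apply: ord2P.
- by apply: (up _ _ e1); lra.
- by apply: (up _ _ e2); lra.
- by apply: (up _ _ e3); lra.
- by apply: (up _ _ e4); lra.
Qed.

Lemma tconj_entry l (M : 'M[C]_2) (r c : 'I_2) : l != 0 ->
  tconj l M r c = l ^+ c / l ^+ r * M r c.
Proof.
move=> l0; move: r c; apply: ord2P; apply: ord2P; rewrite /tconj mx2E/= ?expr0 ?expr1 ?divr1 ?mul1r//.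
by rewrite divff ?mul1r.
Qed.

End HolomorphicMatrices.

Lemma Pser_plus (R : realType) (s : R) (r c : 'I_2) i j :
  (j.*2 + c < i.*2 + r)%N -> Pser s r c i j = 0.
Proof. by move=> h; apply: (@herm_factor_plus _ _ (@gser00 R s) r c i j h). Qed.

Section PlusFactor.
Variable R : realType.
Local Notation C := R[i].
Variable a : R.
Hypothesis a0 : 0 < a.
Local Notation sfun := (sfun a).
Local Notation p1 := (p1 a).

Definition Bfun (z : C) : loop R := fun l =>
  tconj l (bmx (sfun z) (p1 z) (Phat (sfun z) (z / l ^+ 2))).

Definition kfun (z : C) : R := Num.sqrt (sfun z) / Num.sqrt (p1 z).

Definition Pext (z : C) : loop R := fun l => \matrix_(r < 2, c < 2)
  csum (fun n => \sum_(i < n.+1)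
    ((Pser (sfun z) r c i (n - i)%N)%:C * (z ^+ i * conjc z ^+ (n - i)))
     * l ^+ ((n - i).*2 + c - (i.*2 + r))).

Definition Bext (z : C) : loop R := fun l =>
  mx2 (Num.sqrt (p1 z))%:C 0 0 ((Num.sqrt (p1 z))^-1)%:C *m adj2 (Pext z l) *m
  mx2 (Num.sqrt (sfun z))%:C (- (((Num.sqrt (sfun z))^-1)%:C * l)) 0 ((Num.sqrt (sfun z))^-1)%:C.

Section Point.
Variable z : C.
Hypothesis Uz : Udom a z.
Let s1 := sfun_ge1 Uz.
Let small := Kser_small a0 Uz.
Let q : R := Kser (sfun z) * normc z.
Let q01 : 0 <= q < 1.
Proof.
have q0 : 0 <= q := mulr_ge0 (mulr_ge0 (ler0n _ _) (sqr_ge0 _)) (normc_ge0 _).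
by rewrite q0/=; move: small; rewrite -mulrA -/q; lra.
Qed.

Lemma Pext_holo : holo_mx (Pext z).
Proof.
move=> r c; pose k n i : C := (Pser (sfun z) r c i (n - i)%N)%:C * (z ^+ i * conjc z ^+ (n - i)).
pose e n i := ((n - i).*2 + c - (i.*2 + r))%N.
suff h : holo (fun l => csum (fun n => \sum_(i < n.+1) k n i * l ^+ e n i)).
  by apply: holo_ext h => l; rewrite mxE.
apply: (holo_csum q01); rewrite /k /e.
  move=> n i hi; rewrite normcM normc_real normcM !normcX normc_conj -exprD subnKC//.
  rewrite /q exprMn; apply: ler_pM; rewrite ?exprn_ge0 ?normc_ge0//.
  by have := Pser_le r c i (n - i)%N s1; rewrite subnKC.
by move=> n i hi; have := ltn_ord c; lia.
Qed.

Lemma Bext_holo : holo_mx (Bext z).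
Proof.
apply: holo_mulmx; last first.
  apply: holo_mx2; try exact: holo_cst.
  by apply: holo_opp; apply: holo_mul (holo_cst _) (@holo_id R).
by apply: holo_mulmx; [apply: holo_mx2; exact: holo_cst|exact: holo_adj2 Pext_holo].
Qed.

Lemma Pext_circle l : `|l| = 1 -> Pext z l = tconj l (Phat (sfun z) (z / l ^+ 2)).
Proof.
move=> l1; have l0 := unit_neq0 l1; apply/matrixP => r c.
rewrite tconj_entry// mxE /Phat /evmx mxE /ev.
have hx : normc (z / l ^+ 2) = normc z by exact: normc_x.
have eb : ebound (Kser (sfun z)) (z / l ^+ 2) (conjc (z / l ^+ 2)).
  split; [exact: mulr_ge0 (ler0n _ _) (sqr_ge0 _)| |by rewrite normc_conj].
  by rewrite hx; case/andP: q01.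
have [M hM] := eterm_dominated eb (mbounded_P s1 r c).
rewrite -(csumZ _ hM); congr csum; apply/funext => n; rewrite /eterm big_distrr/=.
apply: eq_bigr => -[i /= hi] _.
have [h|h] := ltnP ((n - i).*2 + c) (i.*2 + r).
  by rewrite (Pser_plus _ h)// !mul0r mulr0.
have lc : conjc l = l^-1 := unit_conj l1.
have -> : conjc (z / l ^+ 2) = conjc z * l ^+ 2.
  by rewrite rmorphM fmorphV rmorphXn/= lc exprVn invrK.
have -> : l ^+ ((n - i).*2 + c - (i.*2 + r)) = l ^+ ((n - i).*2 + c) / l ^+ (i.*2 + r).
  by rewrite -[in RHS](subnK h) exprD mulfK// expf_neq0.
have -> : (z / l ^+ 2) ^+ i = z ^+ i / l ^+ (2 * i) by rewrite exprMn exprVn exprM.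
have -> : (conjc z * l ^+ 2) ^+ (n - i) = conjc z ^+ (n - i) * l ^+ (2 * (n - i)).
  by rewrite exprMn exprM.
rewrite [l ^+ (_ + c)]exprD [l ^+ (_ + r)]exprD -!mul2n.
have := expf_neq0 r l0; have := expf_neq0 (2 * i) l0.
move: (l ^+ (2 * i)) (l ^+ (2 * (n - i))) (l ^+ c) (l ^+ r) (z ^+ i) (conjc z ^+ (n - i)) (_ %:C).
by move=> A1 A2 A3 A4 A5 A6 A7 n1 n2; field; apply/andP.
Qed.

Lemma Pext0 : Pext z 0 = mx2 (p1 z)%:C 0 0 ((p1 z)^-1)%:C.
Proof.
have e r c : Pext z 0 r c = ev (wct r c (Pser (sfun z) r c)) z (conjc z).
  rewrite mxE /ev; congr csum; apply/funext => n; apply: eq_bigr => -[i /= hi] _.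
  rewrite /wct expr0n subn_eq0.
  have [h|h] := ltnP ((n - i).*2 + c) (i.*2 + r).
    by rewrite (Pser_plus _ h); case: ifP; rewrite !mul0r.
  by rewrite eqn_leq h /=; case: ifP; rewrite ?mulr1// mulr0 mul0r.
have odd0 (r c : 'I_2) : odd (r + c) -> Pext z 0 r c = 0.
  move=> o; rewrite e -[RHS](ev0 z (conjc z)); congr ev; apply: ps2P => i j.
  by rewrite /wct; case: eqP => // h; exfalso; move: o; lia.
apply/matrixP; apply: ord2P; apply: ord2P; rewrite mx2E.
- by rewrite e; exact: p1cE.
- exact: odd0.
- exact: odd0.
- rewrite e -(p2cE a0 Uz (erefl _)) /p2c; congr ev; apply: ps2P => i j.
  by rewrite /wct !eqn_add2r.
Qed.

Lemma Bext_circle l : `|l| = 1 -> Bext z l = Bfun z l.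
Proof.
move=> l1; have l0 := unit_neq0 l1; rewrite /Bext /Bfun /bmx !tconjM// -tconj_adj2 -Pext_circle//.
congr (_ *m _ *m _); rewrite /b0mx /tconj; apply: mx2P; rewrite !mx2E ?mulr0//.
by rewrite mulrN mulrC.
Qed.

Lemma Bext0 : Bext z 0 = mx2 (kfun z)%:C 0 0 ((kfun z)^-1)%:C.
Proof.
rewrite /Bext Pext0 /kfun; have p0 := p1_gt0 a0 Uz; have s0 := sfun_gt0 Uz.
set p := p1 z in p0 *; set s := sfun z in s0 *.
have rp : Num.sqrt p != 0 by rewrite gt_eqF// sqrtr_gt0.
have rs : Num.sqrt s != 0 by rewrite gt_eqF// sqrtr_gt0.
have rpE : Num.sqrt p * Num.sqrt p = p by rewrite -expr2 sqr_sqrtr// ltW.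
have pE : p^-1 = (Num.sqrt p)^-1 * (Num.sqrt p)^-1 by rewrite -invfM rpE.
move: (Num.sqrt p) (Num.sqrt s) rp rs rpE pE => u v u0 v0 uE pE.
rewrite pE -uE /adj2.
have -> : (- ((v^-1)%:C * 0)) = 0 :> C by rewrite mulr0 oppr0.
apply: mx2P; rewrite !mulmx2 !mx2E ?mulr0 ?mul0r ?addr0 ?add0r ?oppr0 ?mulr0 ?mul0r -?rmorphM//.
  by congr (_ %:C); field; rewrite u0.
by congr (_ %:C); field; rewrite u0 v0.
Qed.

End Point.
End PlusFactor.

(** * The Iwasawa factorization *)

Section Slices.
Variable R : realType.
Local Notation V3 := (R * R * R)%type.

Lemma Ck_slice k (O : set V3) (f : V3 -> R) (q : R * R) :
  (forall w, O (q, w)) -> Ck_on k O f -> Ck_on k [set: R] (fun w => f (q, w)).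
Proof.
move=> qO; have cq (w : R) : {for w, continuous (fun w => (q, w))}.
  by apply: (@cvg_pair _ _ _ (nbhs w) (nbhs q) (nbhs w) _ _ _ (fun=> q) id); [exact: cvg_cst|exact: cvg_id].
have c (g : V3 -> R) (cg : forall x, O x -> {for x, continuous g}) (w : R) :
    {for w, continuous (fun w => g (q, w))}.
  by apply: (@continuous_comp _ _ _ (fun w => (q, w)) g); [exact: cq|exact: cg].
have dE (g : V3 -> R) (v w : R) :
    (fun h : R => h^-1 *: (((fun w => g (q, w)) \o shift w) (h *: v) - g (q, w))) =
    (fun h : R => h^-1 *: ((g \o shift (q, w)) (h *: ((0, v) : V3)) - g (q, w))).
  apply/funext => h /=.
  have -> : h *: ((0, v) : V3) + (q, w) = (h *: (0 : R * R) + q, h *: v + w) by [].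
  by rewrite scaler0 add0r.
elim: k f => [|k IH] f [cf hf]; first by split => // w _; exact (c f cf w).
split => [w _|v]; first exact (c f cf w).
have [df Df] := hf (0, v); split => [w _|].
  by rewrite /derivable dE; exact: df (qO w).
rewrite (_ : 'D_v _ = fun w => 'D_((0, v) : V3) f (q, w)); first exact: (IH _ Df).
by apply/funext => w; rewrite /derive dE.
Qed.

Lemma smooth_mx_slice (O : set V3) (M : V3 -> 'M[R[i]]_2) (q : R * R) :
  (forall w, O (q, w)) -> smooth_mx_on O M -> smooth_mx_on [set: R] (fun w => M (q, w)).
Proof.
move=> qO h i j; have [h1 h2] := h i j.
by split => k; [exact: (Ck_slice qO (h1 k))|exact: (Ck_slice qO (h2 k))].
Qed.

End Slices.

Section TwistedLoops.
Variable R : realType.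
Local Notation C := R[i].
Local Notation D := (Dmx R).
Implicit Types (M : 'M[C]_2) (l z : C).

Lemma sigma_tconj (M : C -> 'M[C]_2) l :
  sigma (fun l => tconj l (M (l ^+ 2))) l = tconj l (M (l ^+ 2)).
Proof.
rewrite /sigma sqrrN /tconj invrN; move: (M _) => N; rewrite /Dmx.
by apply: mx2P; rewrite !mulmx2 !mx2E; ring.
Qed.

Lemma unitary_inv M : cadj M *m D *m M = D -> D *m invmx (cadj M) *m D = M.
Proof.
move=> h; have e : cadj M *m (D *m M *m D) = 1%:M by rewrite !mulmxA h D_D.
have [u _] := mulmx1_unit e.
have -> : invmx (cadj M) = D *m M *m D by rewrite -[RHS](mulKmx u) e mulmx1.
by rewrite !mulmxA D_D mul1mx -mulmxA D_D mulmx1.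
Qed.

Lemma Cinv_tconj (M : C -> 'M[C]_2) l : `|l| = 1 ->
  cadj (M l) *m D *m M l = D ->
  Cinv (fun l => tconj l (M l)) l = tconj l (M l).
Proof.
move=> l1 h; have l0 := unit_neq0 l1.
rewrite /Cinv (unit_conj l1) invrK; apply: unitary_inv.
by rewrite cadj_tconj// -[X in _ *m X *m _](tconj_D l) -!tconjM// h tconj_D.
Qed.

End TwistedLoops.

Section Factorization.
Variable R : realType.
Local Notation C := R[i].
Local Notation V3 := (R * R * R)%type.
Local Notation D := (Dmx R).
Variable a : R.
Hypothesis a0 : 0 < a.
Variable t : C -> C.
Hypothesis ht : log_branch t.
Local Notation U := (Udom a).
Local Notation U3 := (@U3 R a).
Local Notation sfun := (sfun a).
Local Notation p1 := (p1 a).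
Local Notation Bfun := (Bfun a).

Definition Bmat (z x : C) : 'M[C]_2 := bmx (sfun z) (p1 z) (Phat (sfun z) x).

(** [gamma0] and [gamma0^-1] at [l = 1] *)
Definition gmat : 'M[C]_2 :=
  mx2 ((Num.sqrt a)^-1)%:C (- ((Num.sqrt a)^-1)%:C) 0 (Num.sqrt a)%:C.
Definition gimat : 'M[C]_2 :=
  mx2 (Num.sqrt a)%:C ((Num.sqrt a)^-1)%:C 0 ((Num.sqrt a)^-1)%:C.

Definition Fmat (z x : C) : 'M[C]_2 :=
  gimat *m (mx2 1 0 (t z) 1 *m ellhat x) *m adj2 (Bmat z x) *m adj2 (@Jmx R).

Definition Ffun (z : C) : loop R := fun l => tconj l (Fmat z (z / l ^+ 2)).

Let ra0 : (Num.sqrt a)%:C != 0 :> C.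
Proof. by apply/eqP => /complexI; apply/eqP; rewrite gt_eqF// sqrtr_gt0. Qed.

Lemma gamma0E l : gamma0 a l = tconj l gmat.
Proof. by rewrite /gamma0 /tconj; apply: mx2P; rewrite !mx2E ?mulr0 ?div1r ?realcV ?mulrN. Qed.

Lemma det_gmat : \det gmat = 1.
Proof. by rewrite /gmat det_mx2 realcV mulr0 subr0 mulVf. Qed.

Lemma adj2_gmat : adj2 gmat = gimat.
Proof. by rewrite /adj2 /gmat; apply: mx2P; rewrite /gimat !mx2E ?oppr0 ?opprK. Qed.

Lemma windingE l : winding l = tconj l (@Jmx R).
Proof. by rewrite /winding /tconj /Jmx; apply: mx2P; rewrite !mx2E ?mulr1 ?mulrN1. Qed.

Lemma invmx_gamma0 l : `|l| = 1 -> invmx (gamma0 a l) = tconj l gimat.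
Proof.
move=> l1; have l0 := unit_neq0 l1.
by rewrite gamma0E invmx_adj2 ?det_tconj ?det_gmat// tconj_adj2 adj2_gmat.
Qed.

Section Point.
Variable z : C.
Hypothesis Uz : U z.
Let s1 := sfun_ge1 Uz.
Let s0 := sfun_gt0 Uz.
Let p0 := p1_gt0 a0 Uz.

Lemma log_sum : a%:C + t z + conjc (t z) = - (sfun z)%:C.
Proof.
have [_ sz] := Uz; have := log_branch_Re ht sz; have -> : sfun z = - a - ln (complex.Re z ^+ 2 + complex.Im z ^+ 2) by [].
case: (t z) => u v /= ->; apply/eqP; rewrite eq_complex/=.
by apply/andP; split; apply/eqP; ring.
Qed.

Lemma normc_z_half : normc z < 2^-1.
Proof.
have := Kser_small a0 Uz; have K1 : 1 <= Kser (sfun z).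
  by have := exprn_ege1 2 s1; rewrite /Kser => h; apply: (le_trans h); rewrite ler_peMl ?sqr_ge0// ler1n.
have h : 64 * normc z <= 64 * Kser (sfun z) * normc z.
  by apply: ler_wpM2r; [exact: normc_ge0|lra].
by move=> small; have n0 := normc_ge0 z; lra.
Qed.

Lemma LmapE l : `|l| = 1 ->
  Lmap t z l = tconj l (mx2 1 0 (t z) 1 *m ellhat (z / l ^+ 2)).
Proof.
move=> l1; have l0 := unit_neq0 l1.
rewrite /Lmap tconjM// (L0E l1 normc_z_half); congr (_ *m _).
by rewrite /tconj; apply: mx2P; rewrite !mx2E ?mulr0.
Qed.

Section Norm.
Variable x : C.
Hypothesis hx : normc x = normc z.
Let small := Kser_smallx a0 Uz hx.

Lemma det_Bmat : \det (Bmat z x) = 1.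
Proof. exact: (det_bmx s0 p0 (det_Phat s1 small)). Qed.

Lemma Fmat_unitary : cadj (Fmat z x) *m D *m Fmat z x = D.
Proof.
apply: frame_unitary; last exact: det_Bmat.
rewrite /gimat gram_gamma0// log_sum.
have hP := Phat_unitary s1 small; rewrite (p1cE a0 Uz hx) (p2cE a0 Uz hx) in hP.
have h := bmx_unitary s0 p0 (det_Phat s1 small) hP (ahat_b1 s1 small).
rewrite /Bmat h -mulNmx -mulmxN; congr (_ *m _ *m _).
by apply: mx2P; rewrite [RHS]mxE !mx2E ?oppr0 ?opprK.
Qed.

Lemma det_Fmat : \det (Fmat z x) = 1.
Proof.
rewrite /Fmat !det_mulmx !det_adj2 det_Bmat det_J (det_ellhat s1 small).
by rewrite -adj2_gmat det_adj2 det_gmat det_mx2 mul0r subr0 !mulr1.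
Qed.

End Norm.

Lemma factorization l : `|l| = 1 ->
  invmx (gamma0 a l) *m Lmap t z l = Ffun z l *m winding l *m Bfun z l.
Proof.
move=> l1; have l0 := unit_neq0 l1; have hx : normc (z / l ^+ 2) = normc z by exact: normc_x.
have eJ : adj2 (@Jmx R) *m Jmx R = 1%:M := adj2_mul (det_J R).
have eB := adj2_mul (det_Bmat hx).
rewrite (invmx_gamma0 l1) (LmapE l1) windingE.
rewrite -[Bfun z l]/(tconj l (Bmat z (z / l ^+ 2))) /Ffun /Fmat.
move: (Bmat _ _) eB (Jmx R) eJ (mx2 1 0 _ 1 *m _) gimat => B eB J eJ E g.
by rewrite -!tconjM// -2!mulmxA [adj2 J *m _]mulmxA eJ mul1mx -mulmxA eB mulmx1.
Qed.

Lemma Ffun_frame l : `|l| = 1 -> Ffun z l *m winding l =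
  invmx (gamma0 a l) *m Lmap t z l *m adj2 (Bfun z l).
Proof.
move=> l1; have l0 := unit_neq0 l1; have hx : normc (z / l ^+ 2) = normc z by exact: normc_x.
have dB : \det (Bfun z l) = 1 by rewrite /Bfun det_tconj//; exact: det_Bmat.
rewrite (factorization l1); move: (Bfun z l) dB (Ffun z l *m winding l) => B dB W.
by rewrite -[RHS]mulmxA (mul_adj2 dB) mulmx1.
Qed.

End Point.

(** ** Smoothness *)

Let oU3 := @open_U3 R a.

Lemma csmooth_lp (O : set V3) : open O -> csmooth O (@lp R).
Proof.
move=> oO; split => k;
  have [hc hs] := @CkB_cos_sin _ _ k O (fun p : V3 => p.2) (fun v => v.2) oO
  (@continuous_thd3 R) (fun v x h => ltac:(by rewrite /= addrK)) (@norm_thd3 R).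
- exact: CkB_Ck hc.
- exact: CkB_Ck hs.
Qed.

Lemma lp_inv (p : V3) : conjc (lp p) = (lp p)^-1.
Proof. exact: unit_conj (cis_norm _). Qed.

Lemma smooth_tconj_lp (M : V3 -> 'M[C]_2) : smooth_mx_on U3 M ->
  smooth_mx_on U3 (fun p => tconj (lp p) (M p)).
Proof.
move=> h; have hl := csmooth_lp oU3.
by apply: (smooth_tconj oU3 hl (csmooth_conj oU3 hl)) => // p _; exact: lp_inv.
Qed.

Lemma smooth_Phat : smooth_mx_on U3 (fun p => Phat (sp a p) (xp p)).
Proof.
apply: smooth_mxI => r c; apply: csmooth_ext (csmooth_P a0 r c) => // p _.
by rewrite /Phat /evmx mxE.
Qed.

Lemma smooth_ellhat : smooth_mx_on U3 (fun p => ellhat (xp p)).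
Proof.
apply: smooth_mxI => r c; apply: csmooth_ext (csmooth_ell a0 r c) => // p _.
by rewrite /ellhat /evmx mxE.
Qed.

Lemma smooth_p1 : smooth_on U3 (fun p => p1 (zp p)).
Proof.
have [h _] := csmooth_p1 a0; apply: smooth_ext oU3 _ h => p Up.
have h' : p1c (sp a p) (xp p) = (p1 (zp p))%:C := p1cE a0 Up (xp_norm p).
by rewrite -[LHS]/(complex.Re (p1c (sp a p) (xp p))) h'.
Qed.

Lemma csmooth_sqrt (f : V3 -> R) : (forall p, U3 p -> 0 < f p) -> smooth_on U3 f ->
  csmooth U3 (fun p => (Num.sqrt (f p))%:C) /\
  csmooth U3 (fun p => ((Num.sqrt (f p))^-1)%:C).
Proof.
move=> f0 hf; have h := smooth_sqrt oU3 f0 hf.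
split; apply: csmooth_real => //; apply: smooth_inv => // p Up.
by rewrite gt_eqF// sqrtr_gt0 f0.
Qed.

Let sc (c : C) := csmooth_cst c oU3.

Lemma smooth_Bmat : smooth_mx_on U3 (fun p => Bmat (zp p) (xp p)).
Proof.
have [hs hs'] := csmooth_sqrt (fun p (Up : U3 p) => sfun_gt0 Up) (smooth_sp a0).
have [hp hp'] := csmooth_sqrt (fun p (Up : U3 p) => p1_gt0 a0 Up) smooth_p1.
rewrite /Bmat /bmx /b0mx; apply: smooth_mulmx => //.
  by apply: smooth_mulmx => //; [apply: smooth_mx2 => //|apply: smooth_adj2 => //; exact: smooth_Phat].
by apply: smooth_mx2 => //; exact: csmooth_opp.
Qed.

Lemma smooth_t : csmooth U3 (fun p => t (zp p)).
Proof.
split; last by apply: smooth_log_Im => // p [].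
have h1 : smooth_on U3 (fun p => a + sp a p).
  by apply: smooth_add (smooth_sp a0) => //; exact: smooth_cst.
have h2 := smooth_mul oU3 (smooth_cst (- 2^-1 : R) oU3) h1.
apply: smooth_ext oU3 _ h2 => p [_ sl].
by have := log_branch_Re ht sl; rewrite spE /rho => ->; lra.
Qed.

Lemma smooth_frame : smooth_mx_on U3
  (fun p => gimat *m (mx2 1 0 (t (zp p)) 1 *m ellhat (xp p)) *m adj2 (Bmat (zp p) (xp p))).
Proof.
apply: smooth_mulmx => //; last by apply: smooth_adj2 => //; exact: smooth_Bmat.
apply: smooth_mulmx => //; first by rewrite /gimat; apply: smooth_mx2.
apply: smooth_mulmx => //; last exact: smooth_ellhat.
by apply: smooth_mx2 => //; exact: smooth_t.
Qed.

Lemma smooth_family_B : smooth_family U Bfun.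
Proof.
have h := smooth_tconj_lp smooth_Bmat.
by apply: smooth_mx_ext oU3 _ h => p _; rewrite xpE; reflexivity.
Qed.

Lemma smooth_family_F : smooth_family U Ffun.
Proof.
have h : smooth_mx_on U3 (fun p => Fmat (zp p) (xp p)).
  apply: smooth_mulmx => //; first exact: smooth_frame.
  by apply: smooth_adj2 => //; rewrite /Jmx; apply: smooth_mx2.
have h' := smooth_tconj_lp h.
by apply: smooth_mx_ext oU3 _ h' => p _; rewrite xpE; reflexivity.
Qed.

Lemma LSL2s_of (X : C -> loop R) (M : C -> C -> 'M[C]_2) z : smooth_family U X -> U z ->
  (forall l, X z l = tconj l (M z (z / l ^+ 2))) ->
  (forall x, normc x = normc z -> \det (M z x) = 1) -> LSL2s (X z).
Proof.
move=> sX Uz XE dM; split; first split.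
- have := @smooth_mx_slice R U3 _ (complex.Re z, complex.Im z) _ sX => h.
  by case: z Uz {XE dM} h => x y Uz h; apply: h.
- by move=> l l1; rewrite XE det_tconj ?unit_neq0//; apply: dM; exact: normc_x.
- move=> l l1; have -> : X z = fun l => tconj l ((fun w => M z (z / w)) (l ^+ 2)).
    by apply/funext => w; exact: XE.
  exact: (sigma_tconj (fun w => M z (z / w))).
Qed.

Lemma LSL2s_B z : U z -> LSL2s (Bfun z).
Proof.
move=> Uz; apply: (@LSL2s_of _ Bmat) => //; first exact: smooth_family_B.
by move=> x hx; exact: det_Bmat.
Qed.

Lemma LSL2s_F z : U z -> LSL2s (Ffun z).
Proof.
move=> Uz; apply: (@LSL2s_of _ Fmat) => //; first exact: smooth_family_F.
by move=> x hx; exact: det_Fmat.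
Qed.

Lemma LSU11s_F z : U z -> LSU11s (Ffun z).
Proof.
move=> Uz; split; first exact: LSL2s_F.
move=> l l1; apply: (Cinv_tconj (M := fun l => Fmat z (z / l ^+ 2))) => //.
by apply: Fmat_unitary => //; exact: normc_x.
Qed.

Lemma holo_extension_B z : U z -> holo_extension (Bfun z) (Bext a z).
Proof.
by move=> Uz; split => [l l1|i j]; [exact: Bext_circle|exact: (Bext_holo a0 Uz)].
Qed.

Lemma LplusSL2s_B z : U z -> LplusSL2s (Bfun z).
Proof.
move=> Uz; split; first exact: LSL2s_B.
by exists (Bext a z); exact: holo_extension_B.
Qed.

Lemma leading_diag_B z : U z -> leading_diag (Bfun z) (kfun a z).
Proof.
move=> Uz; exists (Bext a z); first exact: holo_extension_B.
by rewrite -(Bext0 a0 Uz); exact: holo_mx_bigO (Bext_holo a0 Uz).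
Qed.

Lemma kfun_gt0 z : U z -> 0 < kfun a z.
Proof. by move=> Uz; rewrite divr_gt0// sqrtr_gt0 ?sfun_gt0// p1_gt0. Qed.

Lemma iwasawa : Iwasawa U (@winding R)
  (fun z l => invmx (gamma0 a l) *m Lmap t z l) Ffun Bfun (kfun a).
Proof.
split; [exact: smooth_family_F|exact: smooth_family_B|exact: LSU11s_F|
  exact: LplusSL2s_B| |].
- by move=> z Uz; split; [exact: kfun_gt0|exact: leading_diag_B].
- by move=> z l Uz l1; exact: factorization.
Qed.

End Factorization.

(** * Homogeneity *)

Lemma adj2M (K : comNzRingType) (M N : 'M[K]_2) : adj2 (M *m N) = adj2 N *m adj2 M.
Proof. by apply: mx2P; rewrite mulmx2 /adj2 !mx2E !mulmx2; ring. Qed.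

Section MatrixDerivative.
Variable R : realType.
Local Notation C := R[i].
Local Notation V3 := (R * R * R)%type.

Definition is_cderive (f : R -> C) (d : C) :=
  is_derive (0 : R) (1 : R) (fun s => complex.Re (f s)) (complex.Re d) /\
  is_derive (0 : R) (1 : R) (fun s => complex.Im (f s)) (complex.Im d).

Definition is_mxderive (M : R -> 'M[C]_2) (D : 'M[C]_2) :=
  forall i j, is_cderive (fun s => M s i j) (D i j).

Lemma is_cderive_add f g d e : is_cderive f d -> is_cderive g e ->
  is_cderive (fun s => f s + g s) (d + e).
Proof.
move=> [f1 f2] [g1 g2]; split.
  rewrite (_ : (fun s => _) = (fun s => complex.Re (f s)) + (fun s => complex.Re (g s))).
    by rewrite Re_add; exact: is_deriveD.
  by apply/funext => s; rewrite Re_add.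
rewrite (_ : (fun s => _) = (fun s => complex.Im (f s)) + (fun s => complex.Im (g s))).
  by rewrite Im_add; exact: is_deriveD.
by apply/funext => s; rewrite Im_add.
Qed.

Lemma is_cderive_mull c f d : is_cderive f d -> is_cderive (fun s => c * f s) (c * d).
Proof.
move=> [f1 f2]; split.
  rewrite (_ : (fun s => _) = complex.Re c *: (fun s => complex.Re (f s)) -
      complex.Im c *: (fun s => complex.Im (f s))).
    by rewrite Re_mul; exact: is_deriveB.
  by apply/funext => s; rewrite Re_mul.
rewrite (_ : (fun s => _) = complex.Re c *: (fun s => complex.Im (f s)) +
    complex.Im c *: (fun s => complex.Re (f s))).
  by rewrite Im_mul; exact: is_deriveD.
by apply/funext => s; rewrite Im_mul.
Qed.

Lemma is_mxderive_mull A M D : is_mxderive M D -> is_mxderive (fun s => A *m M s) (A *m D).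
Proof.
move=> h i j; rewrite mulmx2 (_ : (fun s => _) = fun s => A i 0 * M s 0 j + A i 1 * M s 1 j).
  by apply: is_cderive_add; apply: is_cderive_mull; exact: h.
by apply/funext => s; rewrite mulmx2.
Qed.

Lemma is_mxderive_mulr A M D : is_mxderive M D -> is_mxderive (fun s => M s *m A) (D *m A).
Proof.
move=> h i j; rewrite mulmx2 (_ : (fun s => _) = fun s => A 0 j * M s i 0 + A 1 j * M s i 1).
  by rewrite [D i 0 * _]mulrC [D i 1 * _]mulrC; apply: is_cderive_add;
    apply: is_cderive_mull; exact: h.
by apply/funext => s; rewrite mulmx2 ![_ * A _ _]mulrC.
Qed.

Lemma is_mxderive_near M N D : (\forall s \near (0 : R), M s = N s) ->
  is_mxderive M D -> is_mxderive N D.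
Proof.
move=> e h i j; have [h1 h2] := h i j; split.
  by apply: near_eq_is_derive h1; apply: filterS e => s ->.
by apply: near_eq_is_derive h2; apply: filterS e => s ->.
Qed.

Lemma is_mxderive_ext M N D : (forall s, M s = N s) -> is_mxderive M D -> is_mxderive N D.
Proof. by move=> /funext ->. Qed.

Lemma mx_differentialE (M : C -> 'M[C]_2) (z v : C) D :
  is_mxderive (fun s => M (z + s%:C * v)) D -> mx_differential M z v = D.
Proof.
move=> h; apply/matrixP => i j; rewrite mxE !derive1E.
have [[_ ->] [_ ->]] := h i j; by case: (D i j).
Qed.

Lemma smooth_is_mxderive (O : set V3) (M : V3 -> 'M[C]_2) (p d : V3) :
  smooth_mx_on O M -> O p -> exists D, is_mxderive (fun s => M (s *: d + p)) D.
Proof.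
move=> hM Op.
exists (\matrix_(i, j) ('D_d (fun q => complex.Re (M q i j)) p +i*
  'D_d (fun q => complex.Im (M q i j)) p)).
move=> i j; have [h1 h2] := hM i j; rewrite mxE; split => /=; rewrite derive_line.
  have [_ /(_ d)[df _]] := h1 1%N; apply: DeriveDef => //.
  exact: (derivable1P _ _ _).1 (df p Op).
have [_ /(_ d)[df _]] := h2 1%N; apply: DeriveDef => //.
exact: (derivable1P _ _ _).1 (df p Op).
Qed.

Lemma unit_cis (l : C) : `|l| = 1 -> exists theta, l = cis theta.
Proof.
move=> l1; have n1 := unit_normc l1; have e : normc l ^+ 2 = 1 by rewrite n1 expr1n.
move: l e {l1 n1} => [x y]; rewrite -normc_sq /= => e.
have x1 : -1 <= x <= 1.
  by rewrite -ler_norml -(@ler_pXn2r _ 2) ?nnegrE// expr1n real_normK ?num_real//; nra.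
have s2 : sin (acos x) = `|y|.
  by rewrite sin_acos// (_ : 1 - x ^+ 2 = y ^+ 2) ?sqrtr_sqr//; lra.
have c2 : cos (acos x) = x by rewrite acosK// in_itv.
have [y0|y0] := leP 0 y.
  by exists (acos x); rewrite /cis c2 s2 ger0_norm.
by exists (- acos x); rewrite /cis cosN sinN c2 s2 ltr0_norm// opprK.
Qed.

End MatrixDerivative.

Section Homogeneous.
Variable R : realType.
Local Notation C := R[i].
Local Notation V3 := (R * R * R)%type.
Variable a : R.
Hypothesis a0 : 0 < a.
Variable t : C -> C.
Hypothesis ht : log_branch t.
Local Notation U := (Udom a).
Local Notation U3 := (@U3 R a).

Lemma sfun_normc (z w : C) : normc z = normc w -> sfun a z = sfun a w.
Proof. by move=> h; rewrite /sfun !normc_sq h. Qed.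

Lemma p1_normc (z w : C) : normc z = normc w -> p1 a z = p1 a w.
Proof.
by move=> h; rewrite /p1 (sfun_normc h) /p1c (ev_wct_normc _ _ h).
Qed.

Lemma normc_unit_mul (e z : C) : `|e| = 1 -> normc (e * z) = normc z.
Proof. by move=> e1; rewrite normcM unit_normc// mul1r. Qed.

Lemma normc_rot (e z : C) : `|e| = 1 -> normc (e ^+ 2 * z) = normc z.
Proof. by move=> e1; rewrite expr2 -mulrA !normc_unit_mul. Qed.

Lemma Bmat_normc (z w x : C) : normc z = normc w -> Bmat a z x = Bmat a w x.
Proof. by move=> h; rewrite /Bmat (sfun_normc h) (p1_normc h). Qed.

Lemma homog_coord (e l z : C) : e != 0 -> (e ^+ 2 * z) / (e * l) ^+ 2 = z / l ^+ 2.
Proof.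
move=> e0; rewrite exprMn invfM mulrACA divff ?mul1r//; exact: expf_neq0.
Qed.

Lemma homogeneous_B : homogeneous_on U (Bfun a).
Proof.
move=> e l z e1 l1 Uz Uez; have e0 := unit_neq0 e1.
rewrite -tconjE//.
transitivity (tconj (e * l) (Bmat a (e ^+ 2 * z) ((e ^+ 2 * z) / (e * l) ^+ 2))); first by [].
by rewrite homog_coord// (Bmat_normc _ (normc_rot z e1)) tconj_comp.
Qed.

Lemma log_rot (e z : C) : `|e| = 1 -> U z -> U (e ^+ 2 * z) -> \forall w \near z,
  U w /\ U (e ^+ 2 * w) /\ t (e ^+ 2 * w) = t w + (t (e ^+ 2 * z) - t z).
Proof.
move=> e1 Uz Uez; have [_ sz] := Uz; have [_ sez] := Uez.
have cm : (fun w : C => e ^+ 2 * w) @ nbhs z --> e ^+ 2 * z.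
  refine (@cvgC_normc R C (nbhs z) _ _ _ _).
  apply/cvgrPdist_lt => eps eps0.
  apply/nbhs_ballP; exists eps%:C; first by rewrite /= ltcR.
  move=> w; rewrite /ball/= -opprB normrN normcE' ltcR => hw.
  by rewrite sub0r normrN ger0_norm ?normc_ge0// -mulrBr normc_rot.
have nU : \forall w \near z, U w.
  by apply: open_nbhs_nbhs; split => //; exact: open_Udom.
have nUe : \forall w \near z, U (e ^+ 2 * w).
  by apply: cm; apply: open_nbhs_nbhs; split => //; exact: open_Udom.
have n1 := log_branch_Im ht sz; have n2 := cm _ (log_branch_Im ht sez).
apply: filterS2 (filterI nU nUe) (filterI n1 n2) => w [Uw Uew] [].
have [_ sw] := Uw; have [_ sew] := Uew.
move=> /(_ sw) i1 /(_ sew) i2; split => //; split => //.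
have rE (u : C) : slit_plane u -> complex.Re (t u) = ln (normc u ^+ 2) / 2.
  by move=> su; have := log_branch_Re ht su; rewrite normc_sq => ->; field.
have unit2 : complex.Re (e ^+ 2) ^+ 2 + complex.Im (e ^+ 2) ^+ 2 = 1.
  by rewrite normc_sq normcX (unit_normc e1) !expr1n.
have [cE dE] : cross (e ^+ 2 * z) (e ^+ 2 * w) = cross z w /\
    dotp (e ^+ 2 * z) (e ^+ 2 * w) = dotp z w.
  move: (e ^+ 2) unit2 => [u1 u2] /= unit2.
  by rewrite /cross /dotp !Re_mul !Im_mul/=; split; rewrite -[RHS]mul1r -[1 in RHS]unit2; ring.
rewrite cE dE in i2; apply/eqP; rewrite eq_complex; apply/andP; split; apply/eqP.
  have -> : complex.Re (t w + (t (e ^+ 2 * z) - t z)) =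
    complex.Re (t w) + (complex.Re (t (e ^+ 2 * z)) - complex.Re (t z)).
    by case: (t w) (t (e ^+ 2 * z)) (t z) => [? ?] [? ?] [? ?].
  by rewrite !rE// !normc_rot// subrr addr0.
have -> : complex.Im (t w + (t (e ^+ 2 * z) - t z)) =
  complex.Im (t w) + (complex.Im (t (e ^+ 2 * z)) - complex.Im (t z)).
  by case: (t w) (t (e ^+ 2 * z)) (t z) => [? ?] [? ?] [? ?].
by rewrite i1 i2; lra.
Qed.

Definition Gmat (z x : C) : 'M[C]_2 :=
  gimat a *m (mx2 1 0 (t z) 1 *m ellhat x) *m adj2 (Bmat a z x).

Definition Gfun (z : C) : loop R := fun l => tconj l (Gmat z (z / l ^+ 2)).

Lemma frame_Gfun z l : `|l| = 1 -> Ffun a t z l *m winding l = Gfun z l.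
Proof.
move=> l1; have l0 := unit_neq0 l1; rewrite windingE /Ffun /Fmat /Gfun -/(Gmat _ _).
move: (Gmat _ _) => G; have eJ : adj2 (@Jmx R) *m Jmx R = 1%:M := adj2_mul (det_J R).
by move: (Jmx R) eJ => J eJ; rewrite -tconjM// -mulmxA eJ mulmx1.
Qed.

Lemma det_Gmat z x : U z -> normc x = normc z -> \det (Gmat z x) = 1.
Proof.
move=> Uz hx; have dB := det_Bmat a0 Uz hx.
have dL := det_ellhat (sfun_ge1 Uz) (Kser_smallx a0 Uz hx).
rewrite /Gmat !det_mulmx det_adj2 dB dL -adj2_gmat// det_adj2 det_gmat//.
by rewrite det_mx2 mul0r subr0 !mulr1.
Qed.

Lemma Gfun_derivable z v l : U z -> `|l| = 1 ->
  exists D, is_mxderive (fun s => Gfun (z + s%:C * v) l) D.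
Proof.
move=> Uz /unit_cis[th ->].
have sG : smooth_mx_on U3 (fun p => tconj (lp p) (Gmat (zp p) (xp p))).
  by apply: smooth_tconj_lp; exact: smooth_frame.
pose p : V3 := (complex.Re z, complex.Im z, th).
pose d : V3 := (complex.Re v, complex.Im v, 0).
have zE : zp p = z by rewrite /zp/=; case: z {Uz p}.
have Up : U3 p by rewrite -[U3 p]/(U (zp p)) zE.
have [D hD] := smooth_is_mxderive d sG Up; exists D.
apply: is_mxderive_ext hD => s.
have zs : zp (s *: d + p) = z + s%:C * v.
  apply/eqP; rewrite eq_complex Re_add Im_add Re_mulR Im_mulR /zp/=.
  by rewrite [X in X == _]addrC eqxx/= addrC eqxx.
have ls : lp (s *: d + p) = cis th by rewrite /lp/= scaler0 add0r.
by rewrite xpE zs ls; reflexivity.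
Qed.

Lemma Gfun_rot (e l w kap : C) : `|e| = 1 -> `|l| = 1 ->
  t (e ^+ 2 * w) = t w + kap ->
  Gfun (e ^+ 2 * w) (e * l) =
  tconj e (tconj l (gimat a *m mx2 1 0 kap 1 *m gmat a) *m Gfun w l).
Proof.
move=> e1 l1 te; have e0 := unit_neq0 e1; have l0 := unit_neq0 l1.
rewrite -[LHS]/(tconj (e * l) (Gmat (e ^+ 2 * w) ((e ^+ 2 * w) / (e * l) ^+ 2))).
rewrite -[Gfun w l]/(tconj l (Gmat w (w / l ^+ 2))) (homog_coord l w e0) tconj_comp.
move: (w / l ^+ 2) => x; rewrite /Gmat te (Bmat_normc x (normc_rot w e1)).
have eg : gmat a *m gimat a = 1%:M.
  by rewrite -(adj2_gmat a) mul_adj2//; exact: det_gmat.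
have -> : mx2 1 0 (t w + kap) 1 = mx2 1 0 kap 1 *m mx2 1 0 (t w) 1.
  by apply: mx2P; rewrite !mulmx2 !mx2E; ring.
move: (gmat a) (gimat a) eg (mx2 1 0 kap 1) (mx2 1 0 (t w) 1) (ellhat x) (adj2 _) => g g' eg A1 A2 E B.
rewrite -tconjM//; congr (tconj _ (tconj _ _)).
by rewrite -!mulmxA (mulmxA g g') eg mul1mx.
Qed.

Lemma homogeneous_form : homogeneous_form_on U
  (maurer_cartan (fun z l => Ffun a t z l *m winding l)).
Proof.
move=> e l z v e1 l1 Uz Uez; have e0 := unit_neq0 e1; have l0 := unit_neq0 l1.
have el1 : `|e * l| = 1 by rewrite normrM e1 l1 mulr1.
pose kap := t (e ^+ 2 * z) - t z.
pose H := tconj l (gimat a *m mx2 1 0 kap 1 *m gmat a).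
have dH : \det H = 1.
  rewrite /H det_tconj// !det_mulmx -adj2_gmat// det_adj2 det_gmat//.
  by rewrite det_mx2 mul0r subr0 !mulr1.
have [D hD] := Gfun_derivable v Uz l1.
have hx : normc (z / l ^+ 2) = normc z by exact: normc_x.
have dG : \det (Gfun z l) = 1 by rewrite /Gfun det_tconj//; exact: det_Gmat.
have D1 : mx_differential (fun x => Ffun a t x l *m winding l) z v = D.
  by apply: mx_differentialE; apply: is_mxderive_ext hD => s; rewrite frame_Gfun.
have D2 : mx_differential (fun x => Ffun a t x (e * l) *m winding (e * l)) (e ^+ 2 * z) (e ^+ 2 * v)
    = tconj e (H *m D).
  apply: mx_differentialE; rewrite tconjE//.
  apply: is_mxderive_near (is_mxderive_mulr (Tmx e) (is_mxderive_mull (invmx (Tmx e))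
    (is_mxderive_mull H hD))).
  have cs : (fun s : R => z + s%:C * v) @ (0 : R) --> z.
    refine (@cvgC_normc R R (nbhs (0 : R)) _ _ _ _).
    have c : (fun s : R => `|s| * normc v) @ (0 : R) --> (0 : R).
      by rewrite -[X in _ --> X](mul0r (normc v)) -[X in X * _](@normr0 _ R);
        apply: cvgM; [apply: cvg_norm; exact: cvg_id|exact: cvg_cst].
    apply: cvg_trans c; apply: near_eq_cvg; apply/nbhs_ballP; exists 1 => //= s _.
    by rewrite addrAC subrr add0r normcM normc_real.
  have [r r0 hr] := (nbhs_ballP _ _).1 (cs _ (log_rot e1 Uz Uez)).
  apply/nbhs_ballP; exists r; [exact: r0|move=> s /hr[_ [_ te]]].
  have eE : e ^+ 2 * z + s%:C * (e ^+ 2 * v) = e ^+ 2 * (z + s%:C * v) by ring.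
  rewrite (frame_Gfun _ el1) -[LHS](tconjE _ e0) eE.
  by rewrite (Gfun_rot e1 l1 te).
have h1 : maurer_cartan (fun z l => Ffun a t z l *m winding l) l z v = invmx (Gfun z l) *m D.
  by rewrite /maurer_cartan D1 (frame_Gfun _ l1).
have h2 : maurer_cartan (fun z l => Ffun a t z l *m winding l) (e * l) (e ^+ 2 * z) (e ^+ 2 * v)
    = invmx (Gfun (e ^+ 2 * z) (e * l)) *m tconj e (H *m D).
  by rewrite /maurer_cartan D2 (frame_Gfun _ el1).
rewrite h1 h2 -[RHS](tconjE _ e0) {h1 h2 D1 D2}.
have te : t (e ^+ 2 * z) = t z + kap by rewrite /kap addrC subrK.
rewrite (Gfun_rot e1 l1 te) -/H.
move: (Gfun z l) dG H dH D {hD} => G dG H dH D.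
have dHG : \det (H *m G) = 1 by rewrite det_mulmx dH dG mulr1.
rewrite !invmx_adj2// ?det_tconj// tconj_adj2 -tconjM//; congr tconj.
rewrite adj2M.
by rewrite -mulmxA (mulmxA (adj2 H)) adj2_mul// mul1mx.
Qed.

End Homogeneous.

(** * The theorem *)

Section Conclusion.
Variable R : realType.
Local Notation C := R[i].
Variable a : R.
Hypothesis a0 : 0 < a.
Local Notation U := (Udom a).

Lemma rad_gt0 : 0 < rad a. Proof. exact: expR_gt0. Qed.

Lemma Vdom0 : Vdom a 0.
Proof. by have : normc (0 : C) < rad a; [rewrite normc0; exact: rad_gt0|exact]. Qed.

Lemma connected_Udom : connected U.
Proof.
pose c : R := rad a / 2; have c0 : 0 < c by rewrite divr_gt0 ?rad_gt0.
have cr : c < rad a by rewrite /c ltr_pdivrMr// ltr_pMr ?rad_gt0// ltr1n.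
pose seg (z : C) (s : R) : C := c%:C + s%:C * (z - c%:C).
have segU z s : U z -> 0 <= s <= 1 -> U (seg z s).
  move=> [Vz sz] /andP[s0 s1]; split.
    have -> : seg z s = (1 - s)%:C * c%:C + s%:C * z by rewrite /seg rmorphB rmorph1; ring.
    rewrite /Vdom/=; apply: le_lt_trans (le_normcD _ _) _.
    rewrite !normcM !normc_real !ger0_norm ?subr_ge0// ?ltW//.
    have [->|s1'] := eqVneq s 1; first by rewrite subrr mul0r add0r mul1r.
    have h1 : (1 - s) * c < (1 - s) * rad a by rewrite ltr_pM2l// subr_gt0 lt_neqAle s1'.
    have h2 : s * normc z <= s * rad a by rewrite ler_wpM2l// ltW.
    lra.
  apply/slitP; have [->|s0'] := eqVneq s 0.
    by right; rewrite /seg mul0r addr0.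
  have sp : 0 < s by rewrite lt_neqAle eq_sym s0'.
  have iE : complex.Im (seg z s) = s * complex.Im z.
    by rewrite /seg Im_add Im_mulR; case: (z) => x y /=; ring.
  have rE : complex.Re (seg z s) = (1 - s) * c + s * complex.Re z.
    by rewrite /seg Re_add Re_mulR; case: (z) => x y /=; ring.
  rewrite iE rE; have [zi|zr] := (slitP z).1 sz; first by left; rewrite mulf_neq0.
  by right; rewrite ltr_wpDl ?mulr_gt0// mulr_ge0 ?subr_ge0// ltW.
have cU : U c%:C.
  split; first by have : normc (c%:C : C) < rad a; [rewrite normc_real gtr0_norm|exact].
  by apply/slitP; right.
have cseg z : continuous (seg z).
  move=> s; apply: cvgC_ReIm.
    have e u : complex.Re (seg z u) = c + u * complex.Re (z - c%:C).
      by rewrite /seg Re_add Re_mulR.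
    rewrite e; under eq_fun do rewrite e.
    by apply: cvgD; [exact: cvg_cst|apply: cvgMr_tmp; exact: cvg_id].
  have e u : complex.Im (seg z u) = u * complex.Im (z - c%:C).
    by rewrite /seg Im_add Im_mulR add0r.
  rewrite e; under eq_fun do rewrite e.
  by apply: cvgMr_tmp; exact: cvg_id.
have -> : U = \bigcup_(z in U) (seg z @` `[0, 1]%classic).
  apply/seteqP; split => [z Uz|w [z Uz [s]]].
    exists z => //; exists 1; first by rewrite /= in_itv/= lexx ler01.
    by rewrite /seg mul1r addrC subrK.
  by rewrite /= in_itv/= => hs <-; exact: segU.
apply: bigcup_connected.
  exists c%:C => z Uz; exists 0; first by rewrite /= in_itv/= lexx ler01.
  by rewrite /seg mul0r addr0.
move=> z Uz; apply: connected_continuous_connected; first exact: segment_connected.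
by apply: continuous_subspaceT; exact: cseg.
Qed.

Lemma p1_cvg1 : p1 a z @[z --> within U (nbhs (0 : C))] --> (1 : R).
Proof.
apply/cvgrPdist_lt => e e0; pose M : R := 2 ^+ 20 / e.
have M0 : 0 < M by rewrite divr_gt0// exprn_gt0.
have r0 : 0 < (expR (- (a + M) / 2))%:C :> C by rewrite ltcR expR_gt0.
apply/nbhs_ballP; exists (expR (- (a + M) / 2))%:C => // z.
rewrite /ball/= sub0r normrN normcE' ltcR => hz Uz.
rewrite -normrN opprB; apply: le_lt_trans (p1_near1_sfun a0 Uz) _.
have s0 := sfun_gt0 Uz; rewrite ltr_pdivrMr// mulrC -ltr_pdivrMr//.
move: hz; rewrite (normc_sfun a (Udom_neq0 Uz)) ltr_expR -/M; lra.
Qed.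

Lemma inv_sqrt_p1_cvg1 :
  (Num.sqrt (p1 a z))^-1 @[z --> within U (nbhs (0 : C))] --> (1 : R).
Proof.
have h : Num.sqrt (p1 a z) @[z --> within U (nbhs (0 : C))] --> (1 : R).
  rewrite -[X in _ --> X](@sqrtr1 R).
  by apply: (cvg_comp _ _ p1_cvg1); exact: sqrt_continuous.
by rewrite -[X in _ --> X]invr1; apply: cvgV => //; exact: oner_neq0.
Qed.

Lemma sqrtC_real (x : R) : 0 <= x -> sqrtC (x%:C : C) = (Num.sqrt x)%:C.
Proof.
move=> x0; rewrite -(sqrtC_mul x0) -expr2 sqrCK// lecR sqrtr_ge0//.
Qed.

Lemma LSL2s_gamma0 : LSL2s (gamma0 a).
Proof.
split; first split.
- have oT : open [set: R] by exact: openT.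
  have cc : csmooth [set: R] (@cis R).
    split => k; have [hc hs] := @CkB_cos_sin _ _ k [set: R] (fun w : R => w) (fun v => v) oT
      (fun x => cvg_id) (fun v x h => ltac:(by rewrite addrK)) (fun v => lexx _).
      exact: CkB_Ck hc.
    exact: CkB_Ck hs.
  rewrite /smooth_loop /gamma0; apply: smooth_mx2; try exact: csmooth_cst.
  apply: csmooth_opp => //; apply: csmooth_mul => //; exact: csmooth_cst.
- move=> l l1; have l0 := unit_neq0 l1.
  by rewrite gamma0E// det_tconj// det_gmat.
- move=> l l1; have -> : gamma0 a = fun l => tconj l ((fun _ => gmat a) (l ^+ 2)).
    by apply/funext => w; rewrite gamma0E.
  exact: (sigma_tconj (fun _ => gmat a)).
Qed.

Lemma gamma0_conj l : `|l| = 1 -> gamma0 a l =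
  invmx (mx2 1 0 0 l) *m mx2 (1 / Num.sqrt a)%:C (- (1 / Num.sqrt a))%:C 0 (Num.sqrt a)%:C
  *m mx2 1 0 0 l.
Proof.
move=> l1; rewrite gamma0E// (tconjE _ (unit_neq0 l1)) /Tmx /gmat.
by rewrite div1r rmorphN.
Qed.

Lemma kfun_sqrtC (t : C -> C) z : log_branch t -> U z ->
  (kfun a z)%:C = sqrtC (- a%:C - t z - conjc (t z)) * ((Num.sqrt (p1 a z))^-1)%:C.
Proof.
move=> ht Uz; have e : - a%:C - t z - conjc (t z) = (sfun a z)%:C.
  by rewrite -[RHS]opprK -(log_sum ht Uz) !opprD.
by rewrite e sqrtC_real ?(ltW (sfun_gt0 Uz))// /kfun rmorphM.
Qed.

End Conclusion.

Theorem theorem4p1 (R : realType) (a : R) (ha : 0 < a)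
    (t : R[i] -> R[i]) (ht : log_branch t) :
  [/\ LSL2s (gamma0 a),
      (forall l : R[i], `|l| = 1 ->
        gamma0 a l =
          invmx (mx2 1 0 0 l)
          *m mx2 (1 / Num.sqrt a)%:C (- (1 / Num.sqrt a))%:C
                 0 (Num.sqrt a)%:C
          *m mx2 1 0 0 l)
    & exists (V : set R[i]) (F B : R[i] -> loop R) (k : R[i] -> R),
        let U := V `&` @slit_plane R in
        [/\ [/\ open V, V 0 & connected U],
            Iwasawa U (@winding R)
              (fun z l => invmx (gamma0 a l) *m Lmap t z l) F B k,
            homogeneous_on U B,
            homogeneous_form_on U
              (maurer_cartan (fun z l => F z l *m winding l))
          & exists2 h : R[i] -> R,
              (forall z, U z ->
                (k z)%:C =
                  sqrtC (- a%:C - t z - conjc (t z)) * (h z)%:C)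
              & h z @[z --> within U (nbhs (0 : R[i]))] --> (1 : R)]].
Proof.
split; [exact: LSL2s_gamma0|exact: gamma0_conj|].
exists (Vdom a), (Ffun a t), (Bfun a), (kfun a); split.
- by split; [exact: open_Vdom|exact: Vdom0|exact: connected_Udom].
- exact: iwasawa.
- exact: homogeneous_B.
- exact: homogeneous_form.
- exists (fun z => (Num.sqrt (p1 a z))^-1); last exact: inv_sqrt_p1_cvg1.
  by move=> z Uz; exact: kfun_sqrtC.
Qed.
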